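(* Let $k$ satisfy (k1)-(k3) and $b$ satisfy (b1)-(b5) (listed in the context), and let $$c_1=\inf_{\lambda>0}\frac{\ln\left(b'(0)\int_{\mathbb R}e^{\lambda y}k(y)\,dy\right)}{\lambda}.$$ Then there exist constants $0<v_1\le v_2\le\overline v$, depending only on $b$, with $\underline b(v_1)=v_1$ and $\overline b(v_2)=v_2$, such that for every $c\ge c_1$ the equation $$\varphi(\xi)=\int_{\mathbb R}b(\varphi(\xi-c+y))k(y)\,dy,\qquad \xi\in\mathbb R,$$ has a positive solution $\varphi$ (a bounded uniformly continuous function on $\mathbb R$) such that $\lim_{\xi\to-\infty}\varphi(\xi)=0$ and $$v_1\le\liminf_{\xi\to+\infty}\varphi(\xi)\le\limsup_{\xi\to+\infty}\varphi(\xi)\le v_2 .$$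
   Context: The kernel $k:\mathbb R\to[0,\infty)$ satisfies: (k1) $k$ is Lebesgue measurable and integrable; (k2) $k(x)=k(-x)$; (k3) $\int_{\mathbb R}k(y)\,dy=1$ and $\int_{\mathbb R}k(y)e^{\lambda y}dy<\infty$ for every $\lambda\ge0$. The function $b:[0,\infty)\to[0,\infty)$ is bounded and continuous and satisfies: (b1) $b(0)=0$, $b(v^* )=v^*$ for some $v^*>0$, and there is $\overline v\ge v^*$ such that $[0,\overline v]$ is an invariant region of $v_{n+1}=b(v_n)$ (i.e. $b([0,\overline v])\subset[0,\overline v]$); (b2) $b$ is continuous on $[0,\overline v]$ and $\lim_{v\to0+}b(v)/v=b'(0)>1$; (b3) $b(v)>v$ for $v\in(0,v^* )$; (b4) $0<b(v)<b'(0)v$ for $v\in(0,\overline v]$; (b5) there is $L_1>0$ with $0\le b'(0)v-b(v)\le L_1v^2$ for $v\in[0,\overline v]$. Define $\overline b(v)=\sup_{u\in(0,v)}b(u)$ and $\underline b(v)=\inf_{u\in(v,\overline v)}b(u)$ for $v\in[0,\overline v]$, extended by continuity at the endpoints where the index interval is empty ($\overline b(0)=0$, $\underline b(\overline v)=b(\overline v)$). Both are continuous and nondecreasing on $[0,\overline v]$. One has $c_1>0$. *)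

(* Defs.v *)
From HB Require Import structures.
From mathcomp Require Import all_boot all_order all_algebra.
From mathcomp Require Import all_classical all_reals all_analysis.

Set Implicit Arguments.
Unset Strict Implicit.
Unset Printing Implicit Defensive.

Import Order.TTheory GRing.Theory Num.Theory.
Import numFieldNormedType.Exports.

Local Open Scope classical_set_scope.
Local Open Scope ring_scope.

(* The completed measure is used because kernels are Lebesgue measurable, not
   necessarily Borel measurable; its domain is the Caratheodory sigma-algebra. *)
Notation leb R := (@completed_lebesgue_measure R).

Record dispersal_kernel (R : realType) (k : R -> R) : Prop := {
  kernel_ge0 : forall x : R, 0 <= k x;
  (* integrable includes measurability *)
  kernel_integrable : (leb R).-integrable setT (fun y => (k y)%:E);
  kernel_even : forall x : R, k x = k (- x);
  kernel_mass : (\int[leb R]_y (k y)%:E = 1)%E;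
  kernel_exp_moments : forall l : R, 0 <= l ->
    (\int[leb R]_y (k y * expR (l * y))%:E < +oo)%E
}.

(* A function [0, +oo[ -> [0, +oo[ is represented by b : R -> R, of which only
   the values on [0, +oo[ matter. [db0] is the (right) derivative b'(0). *)
Record growth_function (R : realType) (b : R -> R) (vstar vbar db0 : R) : Prop
  := {
  growth_ge0 : forall v : R, 0 <= v -> 0 <= b v;
  growth_bounded : exists M : R, forall v : R, 0 <= v -> b v <= M;
  growth_continuous : {within `[0, +oo[, continuous b};
  growth_0 : b 0 = 0;
  growth_vstar_gt0 : 0 < vstar;
  growth_vstar : b vstar = vstar;
  growth_vstar_le : vstar <= vbar;
  growth_invariant : forall v : R, 0 <= v <= vbar -> 0 <= b v <= vbar;
  growth_continuous_vbar : {within `[0, vbar], continuous b};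
  growth_deriv0 : b v / v @[v --> 0^'+] --> db0;
  growth_deriv0_gt1 : 1 < db0;
  growth_gt_id : forall v : R, 0 < v < vstar -> v < b v;
  growth_sublinear : forall v : R, 0 < v <= vbar -> 0 < b v < db0 * v;
  growth_quadratic : exists2 L1 : R, 0 < L1 &
    forall v : R, 0 <= v <= vbar -> 0 <= db0 * v - b v <= L1 * v ^+ 2
}.

Definition upper_env (R : realType) (b : R -> R) (v : R) : R :=
  if v == 0 then 0 else sup [set b u | u in `]0, v[].

Definition lower_env (R : realType) (b : R -> R) (vbar v : R) : R :=
  if v == vbar then b vbar else inf [set b u | u in `]v, vbar[].

Definition critical_speed (R : realType) (db0 : R) (k : R -> R) : R :=
  inf [set ln (db0 * \int[leb R]_y (expR (l * y) * k y)) / l |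
        l in `]0, +oo[].

Definition wave_equation (R : realType) (b k : R -> R) (c : R) (phi : R -> R)
  : Prop :=
  forall xi : R, phi xi = \int[leb R]_y (b (phi (xi - c + y)) * k y).

(* Main.v *)
Require Import Defs.
From HB Require Import structures.
From mathcomp Require Import all_boot all_order all_algebra.
From mathcomp Require Import all_classical all_reals all_analysis.
From mathcomp Require Import measurable_realfun zify ring lra.

(** Why the theorem is true.

    Write V for the upper bound of the invariant interval.  After replacing the
    kernel by a Borel version and b by its composition beta with the projection
    onto [0, V], the wave equation reads phi x = A phi (x - c), where A phi z is
    the average of beta (phi (z + y)) against k.  Besides its exponential
    moments, all that is used of k is the record averaging: this average is even,
    has small tails and no atoms, and depends continuously on translations,
    uniformly over bounded integrands.  The last point is the continuity of
    translations in L1, and it makes the image of A equicontinuous.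

    A wave is found without any explicit lower solution.  For every c' > c there
    is a rate l for which V exp (l x) is an upper solution.  Between 0 and
    min (V, V exp (l x)) the forced equation
      phi x = max (A phi (x - c'), th * ramp x)
    has a solution (schauder_between); since b is not monotone a topological
    fixed point theorem is needed, and it is derived from a combinatorial lemma
    of Scarf (rainbow_cell) by way of an approximate form of Brouwer's theorem.
    The forcing makes phi positive far to the right, and the hair-trigger effect
    (hair_trigger) then lifts it above a threshold del that does not depend on
    th, whereas phi tends to 0 on the left.  So phi crosses the level del / 2,
    and it is translated so that it does so for the first time at 0.  When th
    goes to 0 and c' goes to c, a locally uniform cluster point is a wave of
    speed c with the value del / 2 at 0 and values at most del / 2 on the left
    of 0 (wave_exists).  The critical speed is thus reached as a limit of
    larger ones.

    The wave vanishes at -oo: otherwise its translates would cluster at a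
    nontrivial wave bounded by del / 2, against the hair-trigger effect
    (wave_vanishes_left).  It is positive: positivity spreads over intervals
    whose length grows linearly, and a wave that vanishes on a left half-line is
    identically zero (wave_zero_left).

    Far on the right the hair-trigger effect gives phi >= del.  A lower limit s
    of phi with s < lower_env s, or an upper limit s with upper_env s < s, could
    be improved by one application of the equation.  So v1 is taken to be the
    least positive fixed point of the lower envelope and v2 the greatest fixed
    point of the upper one; both exist because the envelopes are monotone.  *)

Set Implicit Arguments.
Unset Strict Implicit.
Unset Printing Implicit Defensive.

Import Order.TTheory GRing.Theory Num.Theory.
Import numFieldNormedType.Exports.

(** * Dominant sets and a parity argument *)

Section DominantSets.
Variables (V I : finType) (rk : I -> V -> nat).
Hypothesis rk_inj : forall i, injective (rk i).

(** Scarf's notion: no element beats the minimum of S in every order. Dominant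
    sets replace the simplices of a triangulation. *)
Definition dominant (S : {set V}) :=
  [forall y, exists i, [forall x in S, rk i y <= rk i x]].

Lemma dominantP (S : {set V}) :
  reflect (forall y, exists i, forall x, x \in S -> rk i y <= rk i x)
          (dominant S).
Proof.
apply: (iffP forallP) => [H y|H y].
  by have /existsP[i /forall_inP Hi] := H y; exists i.
by have [i Hi] := H y; apply/existsP; exists i; apply/forall_inP.
Qed.

Lemma dominantS (S T : {set V}) : T \subset S -> dominant S -> dominant T.
Proof.
move=> /fintype.subsetP sTS /dominantP domS; apply/dominantP => y.
by have [i Hi] := domS y; exists i => x /sTS /Hi.
Qed.

(** A dominant set tau with one element fewer than there are orders has exactly
    two dominant extensions. Indeed every element of tau is the minimum of tau in
    some order, so exactly one pair of orders shares its minimum. An added element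
    becomes the minimum for one order j of that pair, and must be the j-largest
    among those that beat the minima of tau in all other orders. *)
Lemma card_pivots (tau : {set V}) (x0 : V) :
  x0 \in tau -> #|tau|.+1 = #|I| -> dominant tau ->
  (forall j, exists y, forall l, l != j ->
     exists2 x, x \in tau & rk l x < rk l y) ->
  #|[set x | (x \notin tau) && dominant (x |: tau)]| = 2.
Proof.
move=> x0tau card_tau /dominantP domtau above.
pose f i := [arg min_(x < x0 in tau) rk i x].
have ftau i : f i \in tau by rewrite /f; case: arg_minnP.
have fmin i x : x \in tau -> rk i (f i) <= rk i x.
  by move=> xtau; rewrite /f; case: arg_minnP => // z _; apply.
have dom_f y : exists i, rk i y <= rk i (f i).
  by have [i Hi] := domtau y; exists i; exact: Hi.
have f_surj x : x \in tau -> exists i, f i = x.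
  move=> xtau; have [i le_x] := dom_f x; exists i; apply: (@rk_inj i).
  by apply/eqP; rewrite eqn_leq fmin.
(* the pair of orders with a common minimum *)
have [i [i' [ii' fii']]] : exists i i', i != i' /\ f i = f i'.
  have [finj|/injectivePn[i [i' ii' fii']]] := boolP (injectiveb f); last first.
    by exists i, i'.
  exfalso; have : #|I| <= #|tau|.
    rewrite -cardsT -(card_imset _ (injectiveP _ finj)); apply: subset_leq_card.
    by apply/fintype.subsetP => _ /imsetP[l _ ->].
  by rewrite -card_tau ltnn.
have inj_but j j' : j != j' -> f j = f j' -> {in [set~ j] &, injective f}.
  move=> jj' fjj'; apply/imset_injP.
  have -> : f @: [set~ j] = tau.
    apply/setP => x; apply/imsetP/idP => [[l _ ->]//|xtau].
    have [l fl] := f_surj x xtau.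
    have [lj|lj] := eqVneq l j; last by exists l => //; rewrite !inE.
    by exists j'; rewrite ?inE 1?eq_sym// -fl lj fjj'.
  have := cardsC [set j]; rewrite cards1 -card_tau; lia.
have pair_eq l l' : l != l' -> f l = f l' -> (l == i) || (l == i').
  move=> ll' fll'; apply/norP => -[li li'].
  have [l'i|l'i] := eqVneq l' i.
    have fli' : f l = f i' by rewrite fll' l'i.
    have i'i : i' \in [set~ i] by rewrite !inE eq_sym.
    have lNi : l \in [set~ i] by rewrite !inE.
    by case/eqP: li'; exact: (inj_but _ _ ii' fii' _ _ lNi i'i fli').
  by case/eqP: ll'; apply: (inj_but _ _ ii' fii'); rewrite ?inE.
(* M j collects the candidates that may replace the minimum of the order j. *)
pose M j y := [forall l, (l != j) ==> (rk l (f l) < rk l y)].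
have MP j y : reflect (forall l, l != j -> rk l (f l) < rk l y) (M j y).
  apply: (iffP forallP) => H l; first by move=> lj; have /implyP := H l; apply.
  by apply/implyP; exact: H.
have Mne j : exists y, M j y.
  have [y Hy] := above j; exists y; apply/MP => l /Hy[x xtau].
  exact: leq_ltn_trans (fmin _ _ xtau).
pose g j := [arg max_(y > xchoose (Mne j) | M j y) rk j y].
have gM j : M j (g j).
  by rewrite /g; case: arg_maxnP => //; exact: xchooseP (Mne j).
have gmax j y : M j y -> rk j y <= rk j (g j).
  move=> My; rewrite /g; case: arg_maxnP => [|z _]; first exact: xchooseP (Mne j).
  exact.
have g_room j j' : j != j' -> f j = f j' ->
    (g j \notin tau) && dominant (g j |: tau).
  move=> jj' fjj'; have gj_low : rk j (g j) <= rk j (f j).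
    have [l le_l] := dom_f (g j); have [lj|lj] := eqVneq l j.
      by move: le_l; rewrite lj.
    by have := MP _ _ (gM j) l lj; rewrite ltnNge le_l.
  apply/andP; split.
    apply/negP => gtau; have [l fl] := f_surj _ gtau.
    have [lj|lj] := eqVneq l j.
      have := MP _ _ (gM j) j' _; rewrite eq_sym jj' => /(_ isT).
      by rewrite -fl lj fjj' ltnn.
    by have := MP _ _ (gM j) l lj; rewrite fl ltnn.
  apply/dominantP => y; have [My|] := boolP (M j y).
    exists j => x /setU1P[->|xtau]; first exact: gmax.
    exact: leq_trans (gmax _ _ My) (leq_trans gj_low (fmin _ _ xtau)).
  move=> /forallPn[l]; rewrite negb_imply -leqNgt => /andP[lj le_y].
  exists l => x /setU1P[->|xtau]; last exact: leq_trans le_y (fmin _ _ xtau).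
  exact: leq_trans le_y (ltnW (MP _ _ (gM j) l lj)).
have gii' : g i != g i'.
  apply/eqP => gg; have [l le_l] := dom_f (g i).
  have [li|li] := eqVneq l i; last by have := MP _ _ (gM i) l li; rewrite ltnNge le_l.
  move: le_l; rewrite li => le_i.
  by have := MP _ _ (gM i') i ii'; rewrite -gg ltnNge le_i.
suff -> : [set x | (x \notin tau) && dominant (x |: tau)] = [set g i; g i'].
  by rewrite cards2 gii'.
apply/setP => x; rewrite !inE; apply/idP/idP; last first.
  case/orP => /eqP->; first exact: g_room fii'.
  by apply: g_room (esym fii'); rewrite eq_sym.
case/andP => xtau /dominantP domx.
have lt_le l : rk l x <= rk l (f l) -> rk l x < rk l (f l).
  move=> le_l; rewrite ltn_neqAle le_l andbT; apply: contraNneq xtau.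
  by move=> /rk_inj ->.
have below l : rk l x <= rk l (f l) -> forall j, f j = f l ->
    exists2 l', l' != l & f l' = f j /\ rk l' (f l') < rk l' x.
  move=> /lt_le lt_l j fjl; have [l' Hl'] := domx (f j).
  have l'l : l' != l.
    by apply: contraTneq lt_l => l'l; have := Hl' x (setU11 _ _); rewrite l'l fjl -leqNgt.
  have fl' : f l' = f j.
    by apply: (@rk_inj l'); apply/eqP; rewrite eqn_leq fmin//= Hl'// setU1r.
  exists l' => //; split => //; rewrite ltnNge; apply/negP => /lt_le.
  by rewrite ltnNge fl' Hl' ?setU11.
have [j le_j] := dom_f x.
have [l [lj [flj lt_lx]]] : exists l, l != j /\ f l = f j /\ rk l (f l) < rk l x.
  by have [l lj [fl Hl]] := below j le_j j erefl; exists l.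
have jp : (j == i) || (j == i') by apply: (pair_eq j l); rewrite 1?eq_sym.
have MX : M j x.
  apply/MP => l' l'j; rewrite ltnNge; apply/negP => le_l'.
  have [l'' l''l' [fl'' _]] := below l' le_l' l' erefl.
  have lp := pair_eq l j lj flj.
  have l'p : (l' == i) || (l' == i') by apply: (pair_eq l' l''); rewrite 1?eq_sym.
  (* j, l and l' lie in the pair {i, i'}, and l and l' differ from j *)
  have l'l : l' = l.
    by move: lj l'j => + + ; case/orP: jp => /eqP->; case/orP: lp => /eqP->;
      case/orP: l'p => /eqP->; rewrite ?eqxx.
  by move: le_l'; rewrite l'l leqNgt lt_lx.
have -> : x = g j.
  apply: (@rk_inj j); apply/eqP; rewrite eqn_leq gmax//=.
  have [l' Hl'] := domx (g j); have [l'j|l'j] := eqVneq l' j.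
    by have := Hl' x (setU11 _ _); rewrite l'j.
  have := MP _ _ (gM j) l' l'j; rewrite ltnNge Hl'// setU1r//.
by case/orP: jp => /eqP ->; rewrite eqxx ?orbT.
Qed.
End DominantSets.

Section RainbowCell.
Variables (T I : finType) (r : I -> T -> nat) (color : T -> I) (t0 : T).
Hypothesis r_inj : forall i, injective (r i).

Let V : finType := (T + I)%type.
(** The elements inr i stand for the facets of a simplex: inr i is lowest in the
    order i and beats all of T in the other orders. *)
Let rk (i : I) (v : V) : nat :=
  match v with
  | inl x => (r i x).+1
  | inr j => if j == i then 0 else (\max_x r i x + (enum_rank j).+2)%N
  end.
Let colorV (v : V) : I := match v with inl x => color x | inr j => j end.

Let le_max i x : r i x <= \max_z r i z.
Proof. exact: leq_bigmax. Qed.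

Let rk_inj i : injective (rk i).
Proof.
move=> [x|j] [y|k] //=; last 1 first.
- case: eqVneq => [->|_]; case: eqVneq => [->|_] // /eqP; rewrite ?addnS//.
  by rewrite !eqSS eqn_add2l => /eqP/ord_inj/enum_rank_inj ->.
- by case=> /r_inj ->.
- by case: eqVneq => // _ /eqP; have := le_max i x; lia.
- by case: eqVneq => // _ /eqP; have := le_max i y; lia.
Qed.

Let lt_slack l j x : l != j -> rk l (inl x) < rk l (inr j).
Proof. by move=> lj; rewrite /= eq_sym (negbTE lj); have := le_max l x; lia. Qed.

Let dom := @dominant V I rk.
Let i0 := color t0.
Let n := #|I|.
(** The only dominant set with the colors I minus i0 that lies on the boundary. *)
Let tau0 : {set V} := [set inr j | j in [set~ i0]].

(** If the removal of x leaves all colors but i0, either x has color i0 and S is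
    rainbow, or the color of x occurs once more, at a unique x' that can be removed
    instead of x. *)
Let count_rainbow (S : {set V}) : #|S| = n -> colorV @: S != finset.setT ->
  ~~ odd #|[set x in S | colorV @: (S :\ x) == [set~ i0]]|.
Proof.
move=> cardS rainbowN; set X := [set x in S | _].
have [->|[x]] := set_0Vmem X; first by rewrite cards0.
rewrite inE => /andP[xS /eqP imx].
have cardSx : #|S :\ x| = #|[set~ i0]|.
  by have := cardsD1 x S; rewrite xS; have := cardsC [set i0]; rewrite cards1 -/n; lia.
have injx : {in S :\ x &, injective colorV}.
  by apply/imset_injP; rewrite imx cardSx.
have cx : colorV x \in [set~ i0].
  rewrite !inE; apply: contra rainbowN => /eqP cx; apply/eqP/setP => i.
  rewrite inE; have [->|ii0] := eqVneq i i0; first by rewrite -cx imset_f.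
  have : i \in colorV @: (S :\ x) by rewrite imx !inE.
  by case/imsetP => z; rewrite !inE => /andP[_ zS] ->; exact: imset_f.
have [x' x'S cx'] : exists2 x', x' \in S :\ x & colorV x = colorV x'.
  by move: cx; rewrite -imx => /imsetP.
have [x'x x'S'] : x' != x /\ x' \in S by move: x'S; rewrite !inE => /andP.
suff -> : X = [set x; x'] by rewrite cards2 eq_sym x'x.
apply/setP => z; rewrite !inE; apply/andP/orP => [[zS /eqP imz]|]; last first.
  case=> /eqP->; rewrite ?imx ?xS//; split=> //; rewrite -imx; apply/eqP/setP => i.
  apply/imsetP/imsetP => -[y]; rewrite !inE => /andP[yx yS] ->.
    have [->|yx2] := eqVneq y x; first by exists x' => //; rewrite !inE x'x.
    by exists y => //; rewrite !inE yx2.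
  have [->|yx2] := eqVneq y x'; first by exists x => //; rewrite !inE eq_sym x'x.
  by exists y => //; rewrite !inE yx2.
have [->|zx] := eqVneq z x; first by left.
right; have zSx : z \in S :\ x by rewrite !inE zx.
have : colorV z \in colorV @: (S :\ z) by rewrite imz -imx imset_f.
case/imsetP => w; rewrite !inE => /andP[wz wS] czw.
have [wx|wx] := eqVneq w x.
  by apply/eqP/injx => //; rewrite -cx' czw wx.
have wSx : w \in S :\ x by rewrite !inE wx.
by rewrite (injx _ _ zSx wSx czw) eqxx in wz.
Qed.

(** Away from the boundary a door opens to two cells, because an element of T in
    tau lets the facets witness the hypothesis of card_pivots. From tau0 the only
    way in is to add the top element of the order i0. *)
Let count_door (tau : {set V}) : #|tau|.+1 = n -> colorV @: tau = [set~ i0] ->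
  odd #|[set x | (x \notin tau) && dom (x |: tau)]| = (tau == tau0).
Proof.
move=> card_tau im_tau.
have [/existsP[t ttau]|noT] := boolP [exists t, inl t \in tau]; last first.
  have tauE : tau = tau0.
    apply/setP => -[t|j].
      rewrite (negbTE (existsPn noT t)); apply/esym/negbTE/negP.
      by case/imsetP.
    rewrite (mem_imset _ _ (@inr_inj _ _)) -im_tau; apply/idP/imsetP => [jt|].
      by exists (inr j).
    case=> -[t ttau|k ktau /= ->//].
    by move/existsPn: noT => /(_ t); rewrite ttau.
  rewrite tauE eqxx.
  pose tm := [arg max_(t > t0) r i0 t].
  suff -> : [set x | (x \notin tau0) && dom (x |: tau0)] = [set inl tm].
    by rewrite cards1.
  have slack j : j != i0 -> inr j \in tau0 by move=> ji; rewrite imset_f// !inE.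
  have tau0P v : v \in tau0 -> exists2 j, j != i0 & v = inr j.
    by case/imsetP => j; rewrite !inE => ji ->; exists j.
  have tmmax t : r i0 t <= r i0 tm by rewrite /tm; case: arg_maxnP => // t1 _; apply.
  apply/setP => v; rewrite !inE; apply/andP/eqP => [[vtau /dominantP domv]|->].
    have domT t : rk i0 (inl t) <= rk i0 v.
      have [i Hi] := domv (inl t); have [ii0|ii0] := eqVneq i i0.
        by rewrite -ii0; apply: Hi; rewrite setU11.
      by have := Hi _ (setU1r _ (slack _ ii0)); rewrite /= eqxx.
    case: v vtau {domv} domT => [t|j] vtau domT; last first.
      have [ji|/slack ji] := eqVneq j i0; last by rewrite ji in vtau.
      by have := domT t0; rewrite /= ji eqxx.
    congr inl; apply: (@r_inj i0); apply/eqP; rewrite eqn_leq tmmax.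
    by have := domT tm.
  split; first by apply/negP => /tau0P[].
  apply/dominantP => -[t|j]; last first.
    exists j => x _; by rewrite /= eqxx.
  exists i0 => x /setU1P[->|/tau0P[j ji ->]]; first by rewrite /= ltnS.
  by apply/ltnW/lt_slack; rewrite eq_sym.
have -> : (tau == tau0) = false.
  apply/negP => /eqP tauE; move: ttau; rewrite tauE => /imsetP[] //.
have [domtau|domtauN] := boolP (dom tau).
  rewrite (@card_pivots _ _ rk rk_inj tau (inl t)) //.
  by move=> j; exists (inr j) => l lj; exists (inl t) => //; exact: lt_slack.
rewrite (_ : [set x | _] = finset.set0) ?cards0//; apply/setP => x; rewrite !inE.
apply: contraNF domtauN => /andP[_]; apply: dominantS; exact: finset.subsetUr.
Qed.

(** Sperner's argument: the pairs of a dominant set with #|I| elements and an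
    element whose removal leaves the colors I minus i0 are counted in two ways. By
    count_door their number is odd, and by count_rainbow it would be even if no
    dominant set were rainbow. *)
Lemma rainbow_cell : exists sigma : {set T},
  forall y, exists i, i \in color @: sigma /\
    forall x, x \in sigma -> r i y <= r i x.
Proof.
suff [S domS rainbowS] : exists2 S : {set V}, dom S & colorV @: S = finset.setT.
  exists [set x | inl x \in S] => y.
  have /dominantP/(_ (inl y))[i Hi] := domS; exists i; split; last first.
    by move=> x; rewrite inE => /Hi.
  have : i \in colorV @: S by rewrite rainbowS.
  case/imsetP => -[x xS ->|j jS ij].
    by apply: (imset_f color); rewrite inE.
  by have := Hi _ jS; rewrite ij /= eqxx.
pose A (S : {set V}) (x : V) := [&& dom S, #|S| == n & colorV @: (S :\ x) == [set~ i0]].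
have AE (x : V) : \sum_(S : {set V} | x \in S) A S x =
    \sum_(tau : {set V} | x \notin tau) A (x |: tau) x.
  rewrite (reindex_onto (fun tau => x |: tau) (fun S => S :\ x)) /=; last first.
    by move=> S xS; rewrite finset.setD1K.
  apply: eq_bigl => tau; rewrite setU11 /=; apply/eqP/idP => [<-|xtau].
    by rewrite !inE eqxx.
  by rewrite finset.setU1K.
have : \sum_(S : {set V}) \sum_(x in S) A S x =
       \sum_(tau : {set V}) \sum_(x | x \notin tau) A (x |: tau) x.
  rewrite (exchange_big_dep xpredT)//= [RHS](exchange_big_dep xpredT)//=.
  by apply: eq_bigr.
move/(congr1 odd).
have -> : odd (\sum_(tau : {set V}) \sum_(x | x \notin tau) A (x |: tau) x) = true.
  have doorE (tau : {set V}) : odd (\sum_(x | x \notin tau) A (x |: tau) x) = (tau == tau0).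
    have [/andP[/eqP ct /eqP it]|tN] :=
        boolP ((#|tau|.+1 == n) && (colorV @: tau == [set~ i0])).
      rewrite -(count_door ct it) -sum1_card big_mkcond [in RHS]big_mkcond /=.
      congr odd; apply: eq_bigr => x _; rewrite inE.
      case: (boolP (x \in tau)) => //= xtau.
      by rewrite /A cardsU1 xtau add1n ct eqxx finset.setU1K// it eqxx/= andbT; case: dom.
    rewrite big1 => [|x xtau].
      apply/esym; apply: contraNF tN => /eqP->; apply/andP; split.
        rewrite card_imset; last exact: inr_inj.
        by have := cardsC [set i0]; rewrite cards1 -/n => <-.
      by apply/eqP; rewrite -imset_comp -[RHS]imset_id; apply: eq_imset.
    by rewrite /A cardsU1 xtau add1n finset.setU1K// (negbTE tN) andbF.
  rewrite (bigD1 tau0)//= oddD doorE eqxx/=.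
  by apply/negP; elim/big_ind: _ => // [x y|tau /negbTE tN];
    rewrite ?oddD ?doorE ?tN//; do 2!case: odd.
have [/existsP[S /andP[domS /eqP rS]] _|noS] :=
  boolP [exists S, dom S && (colorV @: S == finset.setT)]; first by exists S.
suff -> : odd (\sum_(S : {set V}) \sum_(x in S) A S x) = false by [].
apply/negP; elim/big_ind: _ => // [x y|S _]; first by rewrite oddD; do 2!case: odd.
have [/andP[dS /eqP cS]|SN] := boolP (dom S && (#|S| == n)); last first.
  by rewrite big1 // => x _; rewrite /A andbA (negbTE SN).
move/existsPn: noS => /(_ S); rewrite dS /= => /(count_rainbow cS).
move/negP; congr (~ odd _); rewrite -sum1_card big_mkcond [RHS]big_mkcond/=.
by apply: eq_bigr => x _; rewrite inE /A dS cS eqxx; case: (x \in S); case: (_ == _).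
Qed.
End RainbowCell.

Local Open Scope classical_set_scope.
Local Open Scope ring_scope.

(** * Approximate Brouwer fixed points on a cube *)

(** Ranks of grid points are two-digit numbers in base B: the leading digit is the
    quantity to be compared, the other one breaks ties. *)
Lemma leq_digit (B a a' e e' : nat) : (e' < B -> a * B + e <= a' * B + e' -> a <= a')%N.
Proof.
move=> e'B; apply: contraTT; rewrite -!ltnNge => a'a.
have := leq_mul2r B a'.+1 a; rewrite a'a orbT mulSn => /idP; lia.
Qed.

Lemma leq_close (a b c m : nat) :
  (a <= c + m -> c <= b.+1 -> a <= b + (2 * m + 2))%N.
Proof. lia. Qed.

Lemma ler_dist_nat (R : realType) (a b M : nat) :
  (a <= b + M)%N -> (b <= a + M)%N -> `|a%:R - b%:R| <= M%:R :> R.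
Proof.
move=> ab ba; rewrite ler_norml lerBlDr -natrD ler_nat addnC ab andbT.
by rewrite lerBrDr addrC lerBlDr -natrD ler_nat.
Qed.

(** A grid point is colored by a coordinate that F does not decrease, or by None if
    F decreases all of them. The orders are the m coordinates and the reverse of
    their sum. The points of a rainbow dominant set lie within a few mesh sizes of
    each other and are almost 0 in the coordinates that are not among their colors;
    hence at its point of color None no coordinate can decrease by much. *)
Lemma approx_brouwer (R : realType) (m : nat) (V : R) (F : ('I_m -> R) -> 'I_m -> R) :
  0 < V ->
  (forall a i, (forall j, 0 <= a j) -> 0 <= F a i <= V) ->
  (forall e : R, 0 < e -> exists2 d : R, 0 < d & forall a a',
     (forall j, `|a j - a' j| <= d) -> forall i, `|F a i - F a' i| <= e) ->
  forall e : R, 0 < e -> exists2 a : 'I_m -> R, forall j, 0 <= a j & forall i, `|F a i - a i| <= e.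
Proof.
move=> V0 F0V Fcont e e0.
have e20 : 0 < e / 2 by lra.
have [d d0 Fd] := Fcont _ e20.
pose M := (2 * m + 2)%N.
pose mn := Num.min d (e / 2).
have mn0 : 0 < mn by rewrite /mn lt_min d0.
have M0 : 0 < M%:R :> R by rewrite ltr0n /M; lia.
(* the points of a dominant set differ by at most M = 2m+2 mesh sizes *)
pose N := (Num.bound (V * M%:R / mn)).+1.
have N0 : 0 < N%:R :> R by rewrite ltr0n.
pose h := V / N%:R.
have h0 : 0 < h by rewrite divr_gt0.
have Mh : M%:R * h <= mn.
  rewrite /h mulrCA mulrA ler_pdivrMr// -ler_pdivrMl//.
  rewrite mulrC; apply/ltW/(@lt_trans _ _ (Num.bound (V * M%:R / mn))%:R).
    by apply: archi_boundP; rewrite divr_ge0 ?mulr_ge0// ltW.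
  by rewrite ltr_nat.
(* the grid exceeds V by one step, so that F x >= x forces x < K *)
pose K := N.+1.
pose T : finType := {ffun 'I_m -> 'I_K.+1}.
pose pt (x : T) : 'I_m -> R := fun i => (x i : nat)%:R * h.
have pt0 x j : 0 <= pt x j by rewrite mulr_ge0 ?ler0n// ltW.
pose color (x : T) : option 'I_m := [pick i | pt x i <= F (pt x) i].
have color_some x i : color x = Some i -> pt x i <= F (pt x) i.
  by rewrite /color; case: pickP => // j Hj [<-].
have color_none x i : color x = None -> F (pt x) i <= pt x i.
  by rewrite /color; case: pickP => // H _; apply/ltW; rewrite ltNge H.
have color_lt x i : color x = Some i -> (x i < K)%N.
  move=> /color_some Hx; have /andP[_ FV] := F0V (pt x) i (pt0 x).
  have : pt x i <= V by lra.
  by rewrite /pt /h mulrA ler_pdivrMr// mulrC ler_pM2l// ler_nat ltnS.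
pose B := #|T|.
pose sm (x : T) : nat := (\sum_i x i)%N.
pose r (c : option 'I_m) (x : T) : nat :=
  ((if c is Some i then x i : nat else (m * K - sm x)) * B + enum_rank x)%N.
have sm_le x : (sm x <= m * K)%N.
  rewrite (_ : m * K = \sum_(i < m) K)%N; last by rewrite sum_nat_const card_ord.
  rewrite /sm; apply: leq_sum => i _.
  by rewrite -ltnS.
have r_inj c : injective (r c).
  move=> x y rxy; apply: enum_rank_inj; apply: val_inj => /=.
  have := congr1 (fun k => k %% B)%N rxy.
  by rewrite /r !modnMDl !modn_small ?ltn_ord.
have r_some i x y : (r (Some i) x <= r (Some i) y -> x i <= y i)%N.
  by apply: leq_digit; exact: ltn_ord.
have r_none x y : (r None x <= r None y -> sm y <= sm x)%N.
  move=> /leq_digit => /(_ (ltn_ord _)); have := sm_le x; have := sm_le y; lia.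
pose t0 : T := [ffun=> ord0].
have [sigma dom_sigma] := rainbow_cell color t0 r_inj.
have [x0 x0s] : exists x0, x0 \in sigma.
  by have [_ [/imsetP[x xs _] _]] := dom_sigma t0; exists x.
pose lo i := [arg min_(x < x0 in sigma) (x i : nat)] : T.
have loP i : lo i \in sigma by rewrite /lo; case: arg_minnP.
have lo_min i x : x \in sigma -> (lo i i <= x i)%N.
  by move=> xs; rewrite /lo; case: arg_minnP => // z _; apply.
pose C := (color @: sigma)%SET.
(* y is just above the minima in the coordinates of C; dominance shows that its
   sum bounds that of every point of sigma *)
pose y : T := [ffun i => if Some i \in C then inord (lo i i).+1 else ord0].
have yC i : Some i \in C -> (y i = (lo i i).+1 :> nat)%N.
  move=> iC; rewrite ffunE iC inordK// ltnS.
  case/imsetP: iC => q qs /esym /color_lt; apply: leq_ltn_trans; exact: lo_min.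
have yNC i : Some i \notin C -> y i = 0%N :> nat.
  by move=> iC; rewrite ffunE (negbTE iC).
have [c [cC domy]] := dom_sigma y.
have cN : c = None.
  case: c cC domy => // i iC /(_ _ (loP i)) /r_some; rewrite yC//.
  by rewrite ltnn.
subst c.
have sm_y x : x \in sigma -> (sm x <= sm y)%N by move=> /domy /r_none.
have y_le x i : x \in sigma -> (y i <= (x i).+1)%N.
  move=> xs; have [iC|/yNC ->//] := boolP (Some i \in C).
  by rewrite yC// ltnS lo_min.
have x_le x i : x \in sigma -> (x i <= y i + m)%N.
  move=> xs; have := sm_y x xs; rewrite /sm (bigD1 i)//= [in leqRHS](bigD1 i)//=.
  have : (\sum_(j | j != i) y j <= \sum_(j | j != i) x j + m)%N.
    apply: (@leq_trans (\sum_(j < m | j != i) ((x j : nat) + 1))%N).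
      by apply: leq_sum => j _; rewrite addn1 y_le.
    rewrite big_split /= leq_add2l sum1_card.
    by apply: leq_trans (max_card _) _; rewrite card_ord.
  move=> H2 H1; have := leq_trans H1 (leq_add (leqnn (y i)) H2).
  by rewrite [X in (_ <= X)%N]addnCA [X in (X <= _)%N]addnC leq_add2l.
have close x x' j : x \in sigma -> x' \in sigma -> `|pt x j - pt x' j| <= M%:R * h.
  move=> xs xs'; rewrite /pt -mulrBl normrM (gtr0_norm h0) ler_pM2r//.
  by apply: ler_dist_nat; apply: leq_close (x_le _ _ _) (y_le _ _ _).
have [p ps pN] : exists2 p, p \in sigma & color p = None.
  by case/imsetP: cC => p ps /esym; exists p.
have mnd : M%:R * h <= d by rewrite (le_trans Mh)// /mn ge_min lexx.
have mne : M%:R * h <= e / 2 by rewrite (le_trans Mh)// /mn ge_min lexx orbT.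
exists (pt p) => // i.
have up := color_none p i pN.
rewrite ler_norml; apply/andP; split; last by lra.
have [iC|iC] := boolP (Some i \in C).
  case/imsetP: (iC) => q qs /esym /color_some qF.
  have cl := close _ _ i ps qs.
  have := Fd (pt p) (pt q) (fun j => le_trans (close _ _ j ps qs) mnd) i.
  move: cl; rewrite !ler_norml => /andP[? ?] /andP[? ?]; lra.
have : pt p i <= M%:R * h.
  rewrite /pt ler_pM2r// ler_nat; apply: leq_trans (x_le _ i ps) _.
  by rewrite yNC// add0n /M mul2n -addnn -addnA leq_addr.
have /andP[F0 _] := F0V (pt p) i (pt0 p).
lra.
Qed.

(** * A Borel version of the kernel *)

Notation leb0 R := (@lebesgue_measure R).

(** Completed measurable sets are Borel up to a Borel null set. *)
Lemma completed_measurable_split (R : realType) (A : set R) :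
  (wlength idfun)^*%mu.-cara.-measurable A ->
  exists B N : set R, [/\ measurable B, measurable N, leb0 R N = 0%E &
    A `\` N = B `\` N].
Proof.
rewrite -completed_caratheodory_measurable g_sigma_completed_algebra_genE.
move=> [B mB [N' [N [mN N0 N'N]] <-]]; exists B, N; split => //.
apply/seteqP; split => x [].
  by case=> [Bx|/N'N Nx] nNx.
by move=> Bx nNx; split => //; left.
Qed.

(** A single null set N serves all superlevel sets of k at rational levels; on its
    complement these sets are Borel, so k becomes Borel once it is set to 0 on N. *)
Lemma borel_version (R : realType) (k : R -> R) :
  (leb R).-integrable setT (fun y => (k y)%:E) ->
  exists k0 N : _ , [/\ measurable_fun setT (k0 : measurableTypeR R -> R),
    measurable N, leb0 R N = 0%E & forall x, k0 x = if x \in N then 0 else k x].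
Proof.
move=> /measurable_int mk.
have split_q (q : rat) : exists BN : set R * set R,
    [/\ measurable BN.1, measurable BN.2, leb0 R BN.2 = 0%E &
      [set x | ratr q < k x] `\` BN.2 = BN.1 `\` BN.2].
  have mq : (wlength idfun)^*%mu.-cara.-measurable [set x | ratr q < k x].
    have := emeasurable_fun_o_infty measurableT mk (ratr q)%:E.
    rewrite setTI; congr (_ _); apply/seteqP; split => x /=; by rewrite lte_fin.
  by have [B [N H]] := completed_measurable_split mq; exists (B, N).
have [BN BNP] := choice split_q.
(* rationals are enumerated by nat, as null sets are closed under sequences *)
pose qn n : rat := odflt 0 (unpickle n).
pose N := \bigcup_n (BN (qn n)).2.
have BN_N q : (BN q).2 `<=` N.
  by move=> x Nx; exists (pickle q) => //; rewrite /qn pickleK.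
have mN : measurable N by apply: bigcupT_measurable => n; have [] := BNP (qn n).
pose k0 x := if x \in N then 0 else k x.
exists k0, N; split => //.
- move=> _; apply: (measurability _ (RGenOInfty.measurableE R)) => //.
  move=> _ [_ [a ->] <-]; rewrite setTI.
  have -> : k0 @^-1` `]a, +oo[%classic =
      \bigcup_(q : rat) (((BN q).1 `\` N) `&` [set _ | a < ratr q]) `|`
      (N `&` [set _ | a < 0]).
    apply/seteqP; split => x /=; rewrite in_itv/= andbT /k0.
      case: ifPn => [/set_mem Nx a0|/negP xN]; first by right.
      have {}xN : ~ N x by move=> ?; apply: xN; exact/mem_set.
      move=> /rat_in_itvoo[q]; rewrite in_itv/= => /andP[aq qk].
      left; exists q => //; split => //; split => //.
      have [_ _ _ E] := BNP q.
      have : ([set x | ratr q < k x] `\` (BN q).2) x.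
        by split => // /BN_N.
      by rewrite E => -[].
    case=> [[q _ [[Bx xN] /= aq]]|[Nx a0]]; last by rewrite mem_set.
    rewrite memNset//.
    have [_ _ _ E] := BNP q.
    have : ((BN q).1 `\` (BN q).2) x.
      by split => // /BN_N.
    by rewrite -E => -[/= + _]; exact: lt_trans.
  have mcst (P : Prop) : measurable [set _ : R | P].
    have [p|np] := pselect P.
      by rewrite (_ : [set _ | _] = setT)//; apply/seteqP; split.
    by rewrite (_ : [set _ | _] = set0)//; apply/seteqP; split.
  apply: measurableU; last exact: measurableI (mcst _).
  apply: bigcupT_measurable_rat => q; apply: measurableI; last exact: mcst.
  by apply: measurableD => //; have [] := BNP q.
- apply/negligibleP => //; apply: negligible_bigcup => n.
  by apply/negligibleP; have [] := BNP (qn n).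
Qed.

Lemma measurable_completed (R : realType) (A : set R) :
  measurable (A : set (measurableTypeR R)) ->
  (wlength idfun)^*%mu.-cara.-measurable A.
Proof. by move=> mA; apply: sub_caratheodory. Qed.

(** The identity pushes the completed measure forward to the Borel one. *)
Lemma ge0_integral_completed (R : realType) (f : R -> \bar R) :
  measurable_fun setT (f : measurableTypeR R -> \bar R) ->
  (forall x, (0 <= f x)%E) ->
  (\int[leb R]_y f y = \int[leb0 R]_y f y)%E.
Proof.
move=> mf f0.
pose Tc := caratheodory_type (@wlength R idfun)^*%mu.
have mid : measurable_fun setT (id : Tc -> measurableTypeR R).
  by move=> _ A mA; rewrite setTI; exact: measurable_completed.
have := @ge0_integral_pushforward _ _ Tc (measurableTypeR R) R id mid (leb R) setT f
  measurableT mf (fun x _ => f0 x).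
rewrite preimage_setT /= => <-.
exact: eq_measure_integral.
Qed.

Lemma integral_kernel_borel (R : realType) (k k0 : R -> R) (N : set R) (f : R -> R) :
  (leb R).-integrable setT (fun y => (k y)%:E) ->
  (forall x, 0 <= k x) -> (forall x, k0 x = if x \in N then 0 else k x) ->
  measurable (N : set (measurableTypeR R)) -> leb0 R N = 0%E ->
  measurable_fun setT (k0 : measurableTypeR R -> R) ->
  measurable_fun setT (f : measurableTypeR R -> R) -> (forall x, 0 <= f x) ->
  (\int[leb R]_y (f y * k y)%:E = \int[leb0 R]_y (f y * k0 y)%:E)%E.
Proof.
move=> /measurable_int /measurable_EFinP mk k_ge0 k0E mN N0 mk0 mf f0.
have k0_ge0 x : 0 <= k0 x by rewrite k0E; case: ifP.
rewrite -ge0_integral_completed//; last 2 first.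
- by apply/measurable_EFinP; exact: measurable_funM.
- by move=> x; rewrite lee_fin mulr_ge0.
have mf' : measurable_fun setT (f : caratheodory_type (@wlength R idfun)^*%mu -> R).
  by move=> _ A mA; apply: measurable_completed; exact: mf.
have mk0' : measurable_fun setT (k0 : caratheodory_type (@wlength R idfun)^*%mu -> R).
  by move=> _ A mA; apply: measurable_completed; exact: mk0.
apply: ge0_ae_eq_integral => //.
- by apply/measurable_EFinP; exact: measurable_funM.
- by apply/measurable_EFinP; exact: measurable_funM.
- by move=> x _; rewrite lee_fin mulr_ge0.
- by move=> x _; rewrite lee_fin mulr_ge0.
exists N; split => //; first exact: measurable_completed.
move=> x /= nx; apply: contrapT => Nx; apply: nx => _.
by rewrite k0E memNset.
Qed.

(** * Averages against the kernel *)

Definition bounded_borel (R : realType) (f : R -> R) : Prop :=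
  measurable_fun setT (f : measurableTypeR R -> R) /\ exists M : R, forall x, `|f x| <= M.

(** All that the construction of waves uses of the functional f |-> int f k,
    exponential moments aside. The field avg_shift is the continuity of
    translations in L1, written on the side of the test function; avg_small says
    uniformly that k dy has no atoms. *)
Record averaging (R : realType) (E : (R -> R) -> R) : Prop := {
  avgD : forall f g, bounded_borel f -> bounded_borel g ->
    E (fun x => f x + g x) = E f + E g;
  avgZ : forall a f, bounded_borel f -> E (fun x => a * f x) = a * E f;
  avg_ge0 : forall f, bounded_borel f -> (forall x, 0 <= f x) -> 0 <= E f;
  avg1 : E (fun=> 1) = 1;
  avg_even : forall f, bounded_borel f -> E (fun x => f (- x)) = E f;
  avg_tail : forall e : R, 0 < e -> exists2 r : R, 0 < r & E \1_[set y | r < `|y|] <= e;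
  avg_small : forall e : R, 0 < e -> exists2 d : R, 0 < d &
    forall x, E \1_[set y | `|y - x| <= d] <= e;
  avg_shift : forall e : R, 0 < e -> exists2 d : R, 0 < d &
    forall h, `|h| <= d -> forall f, bounded_borel f -> (forall x, `|f x| <= 1) ->
      `|E (fun y => f (y + h)) - E f| <= e;
  avg_null : forall f, bounded_borel f -> (forall x, 0 <= f x) -> E f = 0 ->
    E \1_[set y | 0 < f y] = 0 }.

Lemma heine (R : realType) (f : R -> R) (a b : R) : continuous f ->
  forall e : R, 0 < e -> exists2 d : R, 0 < d &
    forall x y, a <= x <= b -> `|x - y| <= d -> `|f x - f y| <= e.
Proof.
move=> cf e e0.
have := @segment_compact R a b; rewrite compact_near_coveringP => /(_ R 0^'+
  (fun d x => forall y, `|x - y| <= d -> `|f x - f y| <= e) _).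
have near_x x : `[a, b]%classic x -> \forall x' \near x & d \near 0^'+,
    forall y, `|x' - y| <= d -> `|f x' - f y| <= e.
  move=> _; have e2 : 0 < e / 2 by lra.
  have [r r0 Hr] : exists2 r : R, 0 < r &
      forall z, `|x - z| < r -> `|f x - f z| < e / 2.
    have /cvgrPdist_lt/(_ _ e2)/nbhs_ballP[r /= r0 Hr] := cf x.
    by exists r => // z xz; apply: Hr; rewrite -ball_normE.
  have r2 : 0 < r / 2 by lra.
  exists (ball x (r / 2), [set d | d < r / 2]) => /=.
    by split; [exact: nbhsx_ballx|exact: nbhs_right_lt].
  move=> [x' d] /= [xx' dr] y x'y.
  have {}xx' : `|x - x'| < r / 2 by move: xx'; rewrite -ball_normE.
  have H1 : `|f x - f x'| < e / 2 by apply: Hr; lra.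
  have H2 : `|f x - f y| < e / 2.
    by apply: Hr; have := ler_distD x' x y; lra.
  have := ler_distD (f x) (f x') (f y); rewrite (distrC (f x') (f x)); lra.
move=> /(_ near_x) H2.
have [d [d0 Hd]] := filter_ex (filterI (nbhs_right_gt 0) H2).
by exists d => // x y xab; apply: Hd => /=; rewrite in_itv.
Qed.

Lemma ler_dist_max (R : realType) (a b c d e : R) :
  `|a - c| <= e -> `|b - d| <= e -> `|Num.max a b - Num.max c d| <= e.
Proof.
by rewrite !ler_norml => /andP[? ?] /andP[? ?]; case: (leP a b); case: (leP c d) => ? ?;
  apply/andP; split; lra.
Qed.

Lemma ler_dist_min (R : realType) (a b c d e : R) :
  `|a - c| <= e -> `|b - d| <= e -> `|Num.min a b - Num.min c d| <= e.
Proof.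
by rewrite !ler_norml => /andP[? ?] /andP[? ?]; case: (leP a b); case: (leP c d) => ? ?;
  apply/andP; split; lra.
Qed.

Lemma dist_continuous (R : realType) (f : R -> R) :
  (forall x e : R, 0 < e -> exists2 d : R, 0 < d &
     forall y, `|x - y| <= d -> `|f x - f y| <= e) -> continuous f.
Proof.
move=> H x; apply/cvgrPdist_le => e e0; have [d d0 Hd] := H x e e0.
apply/nbhs_ballP; exists d => // y.
by move=> /= /ltW; exact: Hd.
Qed.

Lemma continuous_dist (R : realType) (f : R -> R) x : {for x, continuous f} ->
  forall e : R, 0 < e -> exists2 d : R, 0 < d &
    forall y, `|x - y| <= d -> `|f x - f y| <= e.
Proof.
move=> cf e e0; have /cvgrPdist_lt/(_ _ e0)/nbhs_ballP[r /= r0 Hr] := cf.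
exists (r / 2) => [|y xy]; first by rewrite divr_gt0.
apply/ltW/Hr; rewrite -ball_normE/=; apply: le_lt_trans xy _.
by rewrite ltr_pdivrMr// ltr_pMr// ltr1n.
Qed.

Lemma lipschitz_continuous (R : realType) (f : R -> R) :
  (forall x y, `|f x - f y| <= `|x - y|) -> continuous f.
Proof. by move=> H; apply: dist_continuous => x e e0; exists e => // y; exact: le_trans. Qed.

Section BoundedBorel.
Variable R : realType.
Implicit Types f g : R -> R.

Lemma bounded_borel_cst (a : R) : bounded_borel (fun=> a).
Proof. by split; [exact: measurable_cst|exists `|a|]. Qed.

Lemma bounded_borelD f g : bounded_borel f -> bounded_borel g ->
  bounded_borel (fun x => f x + g x).
Proof.
move=> [mf [M fM]] [mg [M' gM]]; split; first exact: measurable_funD.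
by exists (M + M') => x; rewrite (le_trans (ler_normD _ _))// lerD.
Qed.

Lemma bounded_borelZ (a : R) f : bounded_borel f -> bounded_borel (fun x => a * f x).
Proof.
move=> [mf [M fM]]; split; first exact: measurable_funM.
by exists (`|a| * M) => x; rewrite normrM ler_wpM2l.
Qed.

Lemma bounded_borel_indic (A : set R) : measurable (A : set (measurableTypeR R)) ->
  bounded_borel (\1_A : R -> R).
Proof.
move=> mA; split; first exact: measurable_indic.
by exists 1 => x; rewrite indicE ger0_norm// lern1; case: (_ \in _).
Qed.

Lemma bounded_borel_continuous f : continuous f -> (exists M : R, forall x, `|f x| <= M) ->
  bounded_borel f.
Proof. by move=> cf bf; split=> //; exact: continuous_measurable_fun. Qed.

Lemma bounded_borel_shift f (h : R) : bounded_borel f -> bounded_borel (fun x => f (x + h)).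
Proof.
move=> [mf [M fM]]; split; last by exists M.
apply: (measurableT_comp mf); exact: measurable_funD.
Qed.

Lemma bounded_borelN f : bounded_borel f -> bounded_borel (fun x => f (- x)).
Proof.
move=> [mf [M fM]]; split; last by exists M.
exact: (measurableT_comp mf).
Qed.
End BoundedBorel.

Section Density.
Variables (R : realType) (g : R -> R).
Notation lam := (leb0 R).
Hypothesis mg : measurable_fun setT (g : measurableTypeR R -> R).
Hypothesis g_ge0 : forall x, 0 <= g x.
Hypothesis g_mass : (\int[lam]_y (g y)%:E = 1)%E.
Hypothesis g_even : forall f : R -> R,
  measurable_fun setT (f : measurableTypeR R -> R) -> (forall x, 0 <= f x) ->
  (\int[lam]_y (f (- y) * g y)%:E = \int[lam]_y (f y * g y)%:E)%E.

Definition density_mean (f : R -> R) : R := \int[lam]_y (f y * g y).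
Notation E := density_mean.

Lemma density_integrable : lam.-integrable setT (EFin \o g).
Proof.
apply/integrableP; split; first exact/measurable_EFinP.
under eq_integral do rewrite /= ger0_norm//.
by rewrite g_mass ltry.
Qed.

Lemma density_integrableM f : bounded_borel f ->
  lam.-integrable setT (EFin \o (fun y => f y * g y)).
Proof.
move=> [mf [M fM]].
have := integrableMr measurableT mf _ density_integrable.
rewrite (_ : (_ \* _)%E = EFin \o (fun y => f y * g y))//; apply.
by exists M; split; [exact: num_real|move=> x Mx y _; exact: le_trans (fM y) (ltW Mx)].
Qed.

Lemma density_meanE f : bounded_borel f ->
  (E f)%:E = (\int[lam]_y (f y * g y)%:E)%E.
Proof.
move=> bf; rewrite /E /Rintegral fineK//.
exact: integrable_fin_num (density_integrableM bf).
Qed.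

Lemma density_meanD f f' : bounded_borel f -> bounded_borel f' ->
  E (fun x => f x + f' x) = E f + E f'.
Proof.
move=> bf bf'; rewrite /E -RintegralD//; [|exact: density_integrableM..].
by apply: eq_Rintegral => x _; rewrite mulrDl.
Qed.

Lemma density_meanZ a f : bounded_borel f -> E (fun x => a * f x) = a * E f.
Proof.
move=> bf; rewrite /E -RintegralZl//; last exact: density_integrableM.
by apply: eq_Rintegral => x _; rewrite mulrA.
Qed.

Lemma density_mean_ge0 f : (forall x, 0 <= f x) -> 0 <= E f.
Proof. by move=> f0; apply: Rintegral_ge0 => x _; rewrite mulr_ge0. Qed.

Lemma density_mean1 : E (fun=> 1) = 1.
Proof.
by rewrite /E /Rintegral; under eq_integral do rewrite mul1r; rewrite g_mass.
Qed.

Lemma density_mean_even f : bounded_borel f -> E (fun x => f (- x)) = E f.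
Proof.
move=> bf; have [_ [M fM]] := bf.
have bM := bounded_borelD bf (bounded_borel_cst M).
have E_M : E (fun x => f (- x) + M) = E (fun x => f x + M).
  apply: EFin_inj; rewrite !density_meanE//; last exact: bounded_borelN bM.
  apply: (g_even (f := fun x => f x + M)); first exact: bM.1.
  by move=> x; have := fM x; rewrite ler_norml; lra.
move: E_M; rewrite !density_meanD//; [|exact: bounded_borel_cst|exact: bounded_borelN|
  exact: bounded_borel_cst].
by move/addIr.
Qed.

Lemma measurable_normB_le (x d : R) :
  measurable ([set y | `|y - x| <= d] : set (measurableTypeR R)).
Proof.
rewrite (_ : [set y | _] = `[x - d, x + d]%classic); first exact: measurable_itv.
by apply/seteqP; split => y /=; rewrite in_itv/= ler_distl.
Qed.

Lemma measurable_norm_gt (r : R) :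
  measurable ([set y | r < `|y|] : set (measurableTypeR R)).
Proof.
rewrite (_ : [set y | _] = ~` [set y | `|y - 0| <= r]).
  by apply: measurableC; exact: measurable_normB_le.
by apply/seteqP; split => y /=; rewrite subr0 ltNge => /negP.
Qed.

Lemma density_mean_indic (A : set R) : measurable (A : set (measurableTypeR R)) ->
  E \1_A = \int[lam]_(x in A) g x.
Proof.
move=> mA; rewrite [RHS]Rintegral_mkcond; apply: eq_Rintegral => x _.
by rewrite /= patchE indicE; case: (_ \in _); rewrite ?mul1r ?mul0r.
Qed.

Lemma density_mean_small (e : R) : 0 < e -> exists2 d : R, 0 < d &
  forall x, E \1_[set y | `|y - x| <= d] <= e.
Proof.
move=> e0; have [d [d0 Hd]] := integral_normr_continuous density_integrable e0.
(* the interval has length 2d/3 < d *)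
exists (d / 3) => [|x]; first by lra.
rewrite density_mean_indic; last exact: measurable_normB_le.
have := Hd _ (measurable_normB_le x (d / 3)) _.
under eq_Rintegral do rewrite ger0_norm//.
move=> H; apply/ltW/H.
rewrite (_ : [set y | _] = `[x - d / 3, x + d / 3]%classic); last first.
  by apply/seteqP; split => y /=; rewrite in_itv/= ler_distl.
suff L : (leb0 R `[(x - d / 3)%R, (x + d / 3)%R]%classic < d%:E)%E by exact: L.
rewrite lebesgue_measure_itv/= lte_fin; case: ifP => _; last by rewrite lte_fin.
rewrite -EFinD lte_fin; lra.
Qed.

Lemma density_mean_tail (e : R) : 0 < e ->
  exists2 r : R, 0 < r & E \1_[set y | r < `|y|] <= e.
Proof.
move=> e0.
pose u (n : nat) (y : R) : \bar R := (\1_[set y | n.+1%:R < `|y|] y * g y)%:E.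
have mu n : measurable_fun setT (u n : measurableTypeR R -> \bar R).
  apply/measurable_EFinP/measurable_funM => //.
  by apply: measurable_indic; exact: measurable_norm_gt.
have ule n x : (`|u n x| <= (g x)%:E)%E.
  rewrite /u lee_fin normrM (ger0_norm (g_ge0 x)) indicE.
  by case: (_ \in _); rewrite ?normr1 ?mul1r// normr0 mul0r.
have ucvg x : setT x -> (u n x @[n --> \oo] --> (cst 0%E : R -> \bar R) x).
  move=> _; apply: cvg_near_cst.
  near=> n; rewrite /u indicE memNset ?mul0r//=.
  apply/negP; rewrite -leNgt; near: n.
  exists (Num.bound `|x|) => // m /= xm; apply/ltW.
  by rewrite (lt_trans (archi_boundP _))// ltr_nat ltnS.
have := @dominated_cvg _ (measurableTypeR R) R lam setT measurableT u (cst 0%E)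
  (EFin \o g) mu ucvg (fun x _ => isT) density_integrable (fun n x _ => ule n x).
rewrite /= integral0 => /fine_cvgP[_ /cvgrPdist_lt/(_ _ e0)[N _ /(_ N (leqnn N))/=]].
rewrite sub0r normrN => H; exists N.+1%:R; first by rewrite ltr0n.
apply: le_trans (ltW H); rewrite /E /Rintegral; exact: ler_norm.
Unshelve. all: by end_near. Qed.

Lemma density_mean_null f : bounded_borel f -> (forall x, 0 <= f x) -> E f = 0 ->
  E \1_[set y | 0 < f y] = 0.
Proof.
move=> bf f0 Ef0.
have mA : measurable ([set y | 0 < f y] : set (measurableTypeR R)).
  rewrite (_ : [set y | _] = f @^-1` `]0, +oo[%classic).
    by rewrite -[X in measurable X]setTI; apply: bf.1 => //; exact: measurable_itv.
  by apply/seteqP; split => y /=; rewrite in_itv/= andbT.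
have mfg := measurable_int _ (density_integrableM bf).
have fg0 : ae_eq lam setT (EFin \o (fun y => f y * g y)) (cst 0%E).
  apply/ae_eq_integral_abs => //; under eq_integral do rewrite /= ger0_norm ?mulr_ge0//.
  by rewrite -density_meanE// Ef0.
apply: EFin_inj; rewrite density_meanE; last exact: bounded_borel_indic.
transitivity (\int[lam]_y (cst 0%E y))%E; last by rewrite integral0.
apply: ae_eq_integral => //.
  exact: measurable_int _ (density_integrableM (bounded_borel_indic mA)).
case: fg0 => N [mN N0 HN]; exists N; split => //.
apply: subset_trans HN => x /= nx; apply: contra_not nx => /(_ I) [/eqP].
rewrite mulf_eq0 indicE => /orP[/eqP fx0|/eqP ->] _; last by rewrite mulr0.
by rewrite memNset ?mul0r//= fx0 ltxx.
Qed.
End Density.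

Section Translation.
Variable R : realType.
Notation lam := (leb0 R).

Let tr (h : R) : measurableTypeR R -> measurableTypeR R := fun y => (y : R) + h.

Let mtr h : measurable_fun setT (tr h).
Proof. exact: measurable_funD. Qed.

Lemma lebesgue_measure_translate (h : R) (A : set (measurableTypeR R)) :
  measurable A -> pushforward lam (tr h) A = lam A.
Proof.
move=> mA.
have E := @lebesgue_measure_unique R [the measure _ _ of pushforward lam (tr h)].
apply/esym/E => // _ [[a b] _ <-] /=.
rewrite /pushforward (_ : tr h @^-1` _ = `](a - h), (b - h)]%classic); last first.
  by apply/seteqP; split => y /=; rewrite !in_itv/= /tr ltrBlDr lerBrDr.
rewrite !lebesgue_measure_itv/= !lte_fin ltrD2r; case: ifP => // _.
rewrite -!EFinD; congr EFin; lra.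
Qed.

Lemma Rintegral_translate (h : R) (f : R -> R) :
  lam.-integrable setT (EFin \o (fun y => f (y + h))) ->
  lam.-integrable setT (EFin \o f) ->
  \int[lam]_y f (y + h) = \int[lam]_y f y.
Proof.
move=> fh fi; rewrite /Rintegral; congr fine.
have := @integral_pushforward _ _ (measurableTypeR R) (measurableTypeR R) R (tr h) (mtr h)
   lam setT (EFin \o f).
rewrite preimage_setT => /(_ (measurable_int _ fi) fh measurableT) /= <-.
by apply: eq_measure_integral => A mA _; exact: lebesgue_measure_translate.
Qed.
End Translation.

Section DensityShift.
Variables (R : realType) (g : R -> R).
Notation lam := (leb0 R).
Hypothesis mg : measurable_fun setT (g : measurableTypeR R -> R).
Hypothesis g_ge0 : forall x, 0 <= g x.
Hypothesis g_mass : (\int[lam]_y (g y)%:E = 1)%E.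
Notation E := (density_mean g).
Let gint := density_integrable mg g_ge0 g_mass.

Let intM (f u : R -> R) : measurable_fun setT (f : measurableTypeR R -> R) ->
  (forall x, `|f x| <= 1) -> lam.-integrable setT (EFin \o u) ->
  lam.-integrable setT (EFin \o (fun y => f y * u y)).
Proof.
move=> mf f1 iu; have mu := measurable_int _ iu.
apply: (le_integrable measurableT _ _ iu).
  by apply/measurable_EFinP/measurable_funM => //; apply/measurable_EFinP.
by move=> x _; rewrite /= lee_fin normrM ler_piMl.
Qed.

Let bound_intM (f u w : R -> R) : measurable_fun setT (f : measurableTypeR R -> R) ->
  (forall x, `|f x| <= 1) -> lam.-integrable setT (EFin \o u) ->
  lam.-integrable setT (EFin \o w) -> (forall x, `|u x| <= w x) ->
  `|\int[lam]_y (f y * u y)| <= \int[lam]_y w y.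
Proof.
move=> mf f1 iu iw uw; have ifu := intM mf f1 iu.
apply: le_trans (le_normr_Rintegral measurableT ifu) _.
apply: le_Rintegral => //; first exact: integrable_abse ifu.
by move=> x _; rewrite normrM (le_trans _ (uw x))// ler_piMl.
Qed.

(** The density is replaced by a continuous compactly supported G at small distance
    in L1, and the translation is moved from f to G, where it is uniformly small by
    uniform continuity. *)
Lemma density_mean_shift (e : R) : 0 < e -> exists2 d : R, 0 < d &
  forall h, `|h| <= d -> forall f, bounded_borel f -> (forall x, `|f x| <= 1) ->
    `|E (fun y => f (y + h)) - E f| <= e.
Proof.
move=> e0; pose e' := e / 5; have e'0 : 0 < e' by rewrite /e'; lra.
have [r0 r00 tail] := density_mean_tail mg g_ge0 g_mass e'0.
pose r := r0 + 1.
pose A : set R := `[- r, r]%classic.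
have mA : measurable (A : set (measurableTypeR R)) by exact: measurable_itv.
have Afin : (lam A < +oo)%E.
  suff : (leb0 R `[(- r)%R, r]%classic < +oo)%E by [].
  by rewrite lebesgue_measure_itv/=; case: ifP => _; rewrite ?ltry// -EFinD ltry.
have gA : lam.-integrable A (EFin \o g) by apply: integrableS gint.
have [p_ [cp ip plim]] := approximation_continuous_integrable mA Afin gA.
have [p [cont_p ip' pclose]] : exists p : R -> R, [/\ continuous p,
    lam.-integrable A (EFin \o p) & \int[lam]_(z in A) `|g z - p z| <= e'].
  move/fine_cvgP: plim => [_ /cvgrPdist_lt/(_ _ e'0)[N _ /(_ N (leqnn N))/=]].
  rewrite sub0r normrN => H; exists (p_ N); split => //.
  by apply: le_trans (ltW H); exact: ler_norm.
(* cut-off: chi = 1 on [-r0, r0] and 0 outside [-r, r] *)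
pose chi (y : R) := Num.max 0 (Num.min 1 (r - `|y|)).
have chi01 y : 0 <= chi y <= 1.
  by rewrite /chi le_max lexx /= ge_max ler01 ge_min lexx.
have chi_in y : `|y| <= r0 -> chi y = 1.
  move=> yr; rewrite /chi min_l; last by rewrite /r; lra.
  by rewrite max_r// ler01.
have chi_out y : r <= `|y| -> chi y = 0.
  move=> yr; rewrite /chi max_l// ge_min; apply/orP; right; lra.
have cont_chi : continuous chi.
  apply: lipschitz_continuous => x y; apply: ler_dist_max.
    by rewrite subrr normr0.
  apply: ler_dist_min; first by rewrite subrr normr0.
  have := ler_dist_dist y x; rewrite (distrC y x) => H; apply: le_trans H.
  by rewrite le_eqVlt; apply/orP; left; apply/eqP; congr `| _ |; lra.
pose G y := p y * chi y.
have cont_G : continuous G by move=> y; apply: cvgM; [exact: cont_p|exact: cont_chi].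
have G_out y : r <= `|y| -> G y = 0 by move=> /chi_out; rewrite /G => ->; rewrite mulr0.
have in_A y : (y \in A) = (`|y| <= r).
  by rewrite /A; apply/idP/idP => [/set_mem|H]; [|apply/mem_set];
    rewrite /= in_itv/= -ler_norml.
have mG : measurable_fun setT (G : measurableTypeR R -> R) by exact: continuous_measurable_fun.
have iG : lam.-integrable setT (EFin \o G).
  have /(integrable_mkcond _ mA) := ip'.
  apply: le_integrable => //; first exact/measurable_EFinP.
  move=> x _; rewrite /= patchE in_A.
  have /andP[c0 c1] := chi01 x.
  case: ifPn => [xr|]; last by rewrite -ltNge => /ltW/G_out ->; rewrite normr0 lee_fin.
  by rewrite lee_fin normrM (ger0_norm c0) ler_piMr.
have r1 : 0 < r by rewrite /r; lra.
pose eta := e' / (2 * (r + 1)).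
have eta0 : 0 < eta by rewrite divr_gt0//; lra.
have [d0 d00 Gunif] := heine (- (r + 1)) (r + 1) cont_G eta0.
pose B : set R := `[- (r + 1), r + 1]%classic.
have mB : measurable (B : set (measurableTypeR R)) by exact: measurable_itv.
have in_B y : (y \in B) = (`|y| <= r + 1).
  by rewrite /B; apply/idP/idP => [/set_mem|H]; [|apply/mem_set];
    rewrite /= in_itv/= -ler_norml.
have Bmeas : lam B = (2 * (r + 1))%:E.
  suff : leb0 R `[- (r + 1), r + 1]%classic = (2 * (r + 1))%:E by [].
  rewrite lebesgue_measure_itv/= lte_fin ifT; last by lra.
  by rewrite -EFinD; congr EFin; lra.
have iB : lam.-integrable setT (EFin \o (fun y => eta * \1_B y)).
  have := integrableZl measurableT eta (integrable_indic_itv (- (r + 1)) (r + 1) true false).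
  by under eq_fun do rewrite -EFinM.
have iBmass : \int[lam]_y (eta * \1_B y) = e'.
  rewrite RintegralZl//; last exact: (integrable_indic_itv (- (r + 1)) (r + 1) true false).
  rewrite /Rintegral integral_indic// setIT.
  transitivity (eta * fine (lam B)); first by [].
  rewrite Bmeas /= /eta divfK//.
  by apply: lt0r_neq0; lra.
pose T := [set y : R | r0 < `|y|].
have mT : measurable (T : set (measurableTypeR R)) by exact: measurable_norm_gt.
have iT : lam.-integrable setT (EFin \o (fun y => \1_T y * g y)).
  exact: density_integrableM (bounded_borel_indic mT).
have igp : lam.-integrable A (EFin \o (fun y => `|g y - p y|)).
  have igp : lam.-integrable A (EFin \o (fun y => g y - p y)).
    exact: (integrableB mA gA ip').
  exact: integrable_abse igp.
have iAgp : lam.-integrable setT (EFin \o (fun y => \1_A y * `|g y - p y|)).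
  have /(integrable_mkcond _ mA) := igp; congr (lam.-integrable _ _); apply/funext => y.
  by rewrite /= patchE indicE; case: ifP => _; rewrite ?mul1r ?mul0r.
have gG_le y : `|g y - G y| <= \1_A y * `|g y - p y| + \1_T y * g y.
  rewrite !indicE in_A /G; have /andP[c0 c1] := chi01 y.
  have [yr|yr] := leP `|y| r; last first.
    rewrite -/(G y) (G_out _ (ltW yr)) subr0 mul0r add0r mem_set ?mul1r ?ger0_norm//.
    by rewrite /T/=; move: yr; rewrite /r; lra.
  rewrite mul1r; have [y0|y0] := leP `|y| r0.
    by rewrite chi_in// mulr1 lerDl mulr_ge0 // ler0n.
  rewrite mem_set// mul1r.
  have -> : g y - p y * chi y = (g y - p y) * chi y + g y * (1 - chi y) by ring.
  apply: le_trans (ler_normD _ _) _; apply: lerD.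
    by rewrite normrM (ger0_norm c0) ler_piMr.
  by rewrite normrM !ger0_norm ?subr_ge0// ler_piMr// lerBlDr lerDl.
have igG : lam.-integrable setT (EFin \o (fun y => g y - G y)).
  exact: (integrableB measurableT gint iG).
have E_G f : bounded_borel f -> (forall x, `|f x| <= 1) ->
    `|E f - \int[lam]_y (f y * G y)| <= 2 * e'.
  move=> bf f1; rewrite /E -RintegralB//; last 2 first.
    exact: density_integrableM.
    exact: intM bf.1 f1 iG.
  under eq_Rintegral do rewrite -mulrBr.
  apply: le_trans (bound_intM bf.1 f1 igG _ gG_le) _.
    exact: (integrableD measurableT iAgp iT).
  rewrite RintegralD//; have -> : 2 * e' = e' + e' by lra.
  apply: lerD; last exact: tail.
  rewrite (_ : \int[lam]_x (\1_A x * `|g x - p x|) = \int[lam]_(x in A) `|g x - p x|)//.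
  rewrite [RHS]Rintegral_mkcond; apply: eq_Rintegral => y _.
  by rewrite patchE indicE; case: ifP => _; rewrite ?mul1r ?mul0r.
exists (Num.min d0 1) => [|h]; first by rewrite lt_min d00 ltr01.
rewrite le_min => /andP[hd0 h1] f bf f1.
have bfh := bounded_borel_shift h bf.
have fh1 x : `|f (x + h)| <= 1 by [].
have A1 := E_G _ bfh fh1; have A2 := E_G _ bf f1.
have Gh_le y : `|G (y - h) - G y| <= eta * \1_B y.
  rewrite indicE in_B; have [yr|yr] := leP `|y| (r + 1).
    rewrite mulr1 distrC; apply: Gunif; first by rewrite -ler_norml.
    by rewrite opprB addrC subrK.
  rewrite mulr0 (G_out y) ?subr0; last by lra.
  rewrite G_out ?normr0//; have := lerB_dist y h; lra.
have mGh : measurable_fun setT ((fun y => G (y - h)) : measurableTypeR R -> R).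
  by apply: (measurableT_comp mG); exact: measurable_funB.
have iGhG : lam.-integrable setT (EFin \o (fun y => G (y - h) - G y)).
  apply: (le_integrable measurableT _ _ iB).
    exact/measurable_EFinP/measurable_funB.
  move=> x _; rewrite /= lee_fin; apply: le_trans (Gh_le x) _; exact: ler_norm.
have iGh : lam.-integrable setT (EFin \o (fun y => G (y - h))).
  have := integrableD measurableT iGhG iG; congr (lam.-integrable _ _).
  by apply/funext => y /=; rewrite -EFinD subrK.
have trans : \int[lam]_y (f (y + h) * G y) = \int[lam]_y (f y * G (y - h)).
  rewrite -(@Rintegral_translate _ h (fun y => f y * G (y - h))).
  - by apply: eq_Rintegral => y _; rewrite addrK.
  - have := intM bfh.1 fh1 iG; congr (lam.-integrable _ _).
    by apply/funext => y /=; rewrite addrK.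
  - exact: intM bf.1 f1 iGh.
have A3 : `|\int[lam]_y (f (y + h) * G y) - \int[lam]_y (f y * G y)| <= e'.
  rewrite trans -RintegralB//; last 2 first.
    exact: intM bf.1 f1 iGh.
    exact: intM bf.1 f1 iG.
  under eq_Rintegral do rewrite -mulrBr.
  by rewrite -[leRHS]iBmass; exact: bound_intM bf.1 f1 iGhG iB Gh_le.
move: A1 A2 A3; rewrite !ler_norml /e' => /andP[? ?] /andP[? ?] /andP[? ?].
by apply/andP; split; lra.
Qed.
End DensityShift.

Lemma ge0_integral_opp (R : realType) (f : R -> \bar R) :
  measurable_fun setT (f : measurableTypeR R -> \bar R) -> (forall x, (0 <= f x)%E) ->
  (\int[leb0 R]_y f (- y)%R = \int[leb0 R]_y f y)%E.
Proof.
move=> mf f0.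
have mN : measurable_fun setT (-%R : measurableTypeR R -> measurableTypeR R) by [].
have := @ge0_integral_pushforward _ _ (measurableTypeR R) (measurableTypeR R) R -%R mN
  (leb0 R) setT f measurableT mf (fun x _ => f0 x).
rewrite preimage_setT /= => <-.
by apply: eq_measure_integral => A mA _; exact: lebesgue_measureN.
Qed.

(** The evenness of the Borel version holds only almost everywhere, off N and -N,
    which is enough for the averages. *)
Lemma kernel_averaging (R : realType) (k : R -> R) : dispersal_kernel k ->
  exists E : (R -> R) -> R, [/\ averaging E,
    forall f, bounded_borel f -> (forall x, 0 <= f x) ->
      \int[leb R]_y (f y * k y) = E f &
    forall (l A : R) f, 0 <= l -> bounded_borel f ->
      (forall y, 0 <= f y <= A * expR (l * y)) ->
      E f <= A * \int[leb R]_y (expR (l * y) * k y)].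
Proof.
move=> hk.
have k_ge0 := kernel_ge0 hk; have ki := kernel_integrable hk.
have [g [N [mg mN N0 gE]]] := borel_version ki.
have kg f : measurable_fun setT (f : measurableTypeR R -> R) -> (forall x, 0 <= f x) ->
    (\int[leb R]_y (f y * k y)%:E = \int[leb0 R]_y (f y * g y)%:E)%E.
  exact: integral_kernel_borel.
have g_ge0 x : 0 <= g x by rewrite gE; case: ifP.
have g_mass : (\int[leb0 R]_y (g y)%:E = 1)%E.
  rewrite -(kernel_mass hk); have := kg (fun=> 1) (measurable_cst _) (fun=> ler01).
  by under eq_integral do rewrite mul1r; under [in RHS]eq_integral do rewrite mul1r.
have g_even f : measurable_fun setT (f : measurableTypeR R -> R) -> (forall x, 0 <= f x) ->
    (\int[leb0 R]_y (f (- y) * g y)%:E = \int[leb0 R]_y (f y * g y)%:E)%E.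
  move=> mf f0.
  have mgN : measurable_fun setT ((fun y => g (- y)) : measurableTypeR R -> R).
    exact: (measurableT_comp mg).
  have m1 : measurable_fun setT ((fun y => (f y * g (- y))%:E) : measurableTypeR R -> \bar R).
    by apply/measurable_EFinP; exact: measurable_funM.
  rewrite -[RHS](_ : (\int[leb0 R]_y (f y * g (- y))%:E = _)%E).
    rewrite -[RHS]ge0_integral_opp//; last by move=> x; rewrite lee_fin mulr_ge0.
    by under [RHS]eq_integral do rewrite opprK.
  apply: ge0_ae_eq_integral => //.
  - by apply/measurable_EFinP; exact: measurable_funM.
  - by move=> x _; rewrite lee_fin mulr_ge0.
  - by move=> x _; rewrite lee_fin mulr_ge0.
  have mNN : measurable (-%R @^-1` N : set (measurableTypeR R)).
    rewrite -[X in measurable X]setTI.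
    by have mopp : measurable_fun setT (-%R : measurableTypeR R -> measurableTypeR R);
      [|exact: mopp].
  exists (N `|` (-%R @^-1` N)); split.
  - exact: measurableU.
  - apply: null_set_setU => //.
    exact: etrans (lebesgue_measureN mN) N0.
  - move=> x /= nx; apply: contrapT => /not_orP[xN NxN]; apply: nx => _.
    by rewrite !gE !memNset// -(kernel_even hk).
exists (density_mean g); split.
- split.
  + exact: density_meanD.
  + exact: density_meanZ.
  + by move=> f _; exact: density_mean_ge0.
  + exact: density_mean1.
  + exact: density_mean_even.
  + exact: density_mean_tail.
  + exact: density_mean_small.
  + exact: density_mean_shift.
  + exact: density_mean_null.
- by move=> f [mf _] f0; rewrite /density_mean /Rintegral kg.
- move=> l A f l0 bf fA.
  have me : measurable_fun setT ((fun y => expR (l * y)) : measurableTypeR R -> R).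
    by apply: continuous_measurable_fun => y; apply: continuous_comp;
      [apply: cvgM; [exact: cvg_cst|exact: cvg_id]|exact: continuous_expR].
  have efin := kernel_exp_moments hk l0.
  have A0 : 0 <= A.
    by have /andP[H1 H2] := fA 0; have := le_trans H1 H2; rewrite mulr0 expR0 mulr1.
  rewrite -lee_fin (density_meanE mg g_ge0 g_mass bf) EFinM /Rintegral.
  rewrite fineK; last first.
    rewrite ge0_fin_numE; last by apply: integral_ge0 => x _; rewrite lee_fin mulr_ge0// expR_ge0.
    by under eq_integral do rewrite mulrC.
  rewrite kg//.
  rewrite -(ge0_integralZl _ measurableT); first last.
  + by rewrite lee_fin.
  + by move=> x _; rewrite lee_fin mulr_ge0// expR_ge0.
  + by apply/measurable_EFinP; exact: measurable_funM.
  apply: ge0_le_integral => //.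
  + by move=> x _; rewrite lee_fin mulr_ge0//; have /andP[] := fA x.
  + by apply/measurable_EFinP; apply: measurable_funM => //; exact: bf.1.
  + apply/measurable_EFinP; apply: measurable_funM => //.
    exact: measurable_funM.
  + by move=> x _; rewrite -EFinM lee_fin mulrA ler_wpM2r//; have /andP[] := fA x.
Qed.

(** * The redistribution operator *)

Section AveragingTheory.
Variables (R : realType) (E : (R -> R) -> R).
Hypothesis hE : averaging E.

Lemma avg_cst a : E (fun=> a) = a.
Proof.
by have := avgZ hE a (bounded_borel_cst 1); rewrite (avg1 hE) mulr1.
Qed.

Lemma avg_le f g : bounded_borel f -> bounded_borel g -> (forall x, f x <= g x) ->
  E f <= E g.
Proof.
move=> bf bg fg; have b1 := bounded_borelZ (-1) bf.
have : 0 <= E (fun x => g x + -1 * f x).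
  by apply: (avg_ge0 hE) (bounded_borelD bg b1) _ => x; have := fg x; lra.
by rewrite (avgD hE bg b1) (avgZ hE _ bf); lra.
Qed.

(** Integrands are compared on a large interval and merely bounded beyond it. *)
Lemma avg_dist f g (r e M : R) : bounded_borel f -> bounded_borel g ->
  (forall x, `|f x - g x| <= e + M * \1_[set y | r < `|y|] x) ->
  `|E f - E g| <= e + M * E \1_[set y | r < `|y|].
Proof.
move=> bf bg fg.
have bT := bounded_borel_indic (measurable_norm_gt r).
have bM := bounded_borelZ M bT.
have be := bounded_borel_cst e.
have beM := bounded_borelD be bM.
have eE : E (fun x => e + M * \1_[set y | r < `|y|] x) = e + M * E \1_[set y | r < `|y|].
  by rewrite (avgD hE be bM) (avgZ hE _ bT) avg_cst.
rewrite ler_norml -eE; apply/andP; split.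
  rewrite lerBrDl lerBlDr -(avgD hE bf beM); apply: avg_le => //.
    exact: bounded_borelD.
  by move=> x; have := fg x; rewrite ler_norml; lra.
rewrite lerBlDr addrC -(avgD hE bg beM); apply: avg_le => //.
  exact: bounded_borelD.
by move=> x; have := fg x; rewrite ler_norml; lra.
Qed.

Lemma avg_dist_unif f g (e : R) : bounded_borel f -> bounded_borel g ->
  (forall x, `|f x - g x| <= e) -> `|E f - E g| <= e.
Proof.
move=> bf bg fg; have := @avg_dist f g 0 e 0 bf bg.
rewrite mul0r addr0; apply => x; by rewrite mul0r addr0.
Qed.

End AveragingTheory.

Section Operator.
Variables (R : realType) (E : (R -> R) -> R) (beta : R -> R) (V : R).
Hypothesis hE : averaging E.
Hypothesis V_gt0 : 0 < V.
Hypothesis beta_range : forall v, 0 <= beta v <= V.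
Hypothesis beta_unif : forall e : R, 0 < e -> exists2 d : R, 0 < d &
  forall u v, `|u - v| <= d -> `|beta u - beta v| <= e.

(** The wave equation with speed c is phi x = redistribute phi (x - c). *)
Definition redistribute (phi : R -> R) (z : R) : R := E (fun y => beta (phi (z + y))).
Notation A := redistribute.

Lemma beta_continuous : continuous beta.
Proof.
by apply: dist_continuous => x e /beta_unif[d d0 Hd]; exists d => // y; exact: Hd.
Qed.

Lemma bounded_borel_beta phi z : continuous phi ->
  bounded_borel (fun y => beta (phi (z + y))).
Proof.
move=> cphi; apply: bounded_borel_continuous.
  move=> y; apply: (continuous_comp (f := fun y => phi (z + y))); last exact: beta_continuous.
  apply: (continuous_comp (f := fun y => z + y)); last exact: cphi.
  by apply: cvgD; [exact: cvg_cst|exact: cvg_id].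
by exists V => y; have /andP[? ?] := beta_range (phi (z + y)); rewrite ger0_norm.
Qed.

Lemma redistribute_range phi z : continuous phi -> 0 <= A phi z <= V.
Proof.
move=> cphi; have bb := bounded_borel_beta z cphi; apply/andP; split.
  by apply: (avg_ge0 hE) => // y; have /andP[] := beta_range (phi (z + y)).
rewrite -[leRHS](avg_cst hE V); apply: avg_le => //; first exact: bounded_borel_cst.
by move=> y; have /andP[] := beta_range (phi (z + y)).
Qed.

(** A change of z translates the integrand, so that avg_shift gives a modulus of
    continuity common to all profiles. *)
Lemma redistribute_modulus (e : R) : 0 < e -> exists2 d : R, 0 < d &
  forall phi, continuous phi -> forall z z', `|z - z'| <= d -> `|A phi z - A phi z'| <= e.
Proof.
move=> e0; have eV : 0 < e / V by rewrite divr_gt0.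
have [d d0 Hd] := avg_shift hE eV; exists d => // phi cphi z z' zz'.
have bb := bounded_borel_beta z' cphi.
have f1 y : `|V^-1 * beta (phi (z' + y))| <= 1.
  have /andP[b0 bV] := beta_range (phi (z' + y)).
  by rewrite ger0_norm ?mulr_ge0 ?invr_ge0 ?(ltW V_gt0)// ler_pdivrMl// mulr1.
have := Hd _ zz' _ (bounded_borelZ V^-1 bb) f1.
rewrite (_ : (fun y => _) = (fun y => V^-1 * beta (phi (z + y)))); last first.
  by apply/funext => y; congr (_ * beta (phi _)); ring.
rewrite !(avgZ hE)//; last exact: bounded_borel_beta.
by rewrite -mulrBr normrM ger0_norm ?invr_ge0 ?(ltW V_gt0)// mulrC ler_pM2r ?invr_gt0.
Qed.

Lemma redistribute_stable (e : R) : 0 < e -> exists2 eta : R, 0 < eta &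
  exists2 r : R, 0 < r & forall phi psi, continuous phi -> continuous psi -> forall z,
    (forall y, `|y| <= r -> `|phi (z + y) - psi (z + y)| <= eta) ->
    `|A phi z - A psi z| <= e.
Proof.
move=> e0; have e2 : 0 < e / 2 by lra.
have eV : 0 < e / 2 / V by rewrite divr_gt0.
have [eta eta0 Heta] := beta_unif e2; have [r r0 Hr] := avg_tail hE eV.
exists eta => //; exists r => // phi psi cphi cpsi z close.
apply: le_trans (_ : e / 2 + V * E \1_[set y | r < `|y|] <= e); last first.
  by have := ler_wpM2l (ltW V_gt0) Hr; rewrite mulrCA divff ?lt0r_neq0// mulr1; lra.
apply: avg_dist => //; [exact: bounded_borel_beta..|].
move=> y; rewrite indicE; have [yr|yr] := leP `|y| r.
  rewrite memNset/=; last by apply/negP; rewrite -leNgt.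
  by rewrite mulr0 addr0; apply/Heta/close.
rewrite mem_set// mulr1.
have /andP[b0 bV] := beta_range (phi (z + y)).
have /andP[b0' bV'] := beta_range (psi (z + y)).
by rewrite ler_norml; apply/andP; split; lra.
Qed.
End Operator.

(** * Locally uniform cluster points *)

Definition equicontinuous_seq (R : realType) (psi : nat -> R -> R) : Prop :=
  forall e : R, 0 < e -> exists2 d : R, 0 < d &
    forall n x y, `|x - y| <= d -> `|psi n x - psi n y| <= e.

(** A cluster point is as good as a limit along a subsequence here, because each use
    needs a single good index. *)
Definition loc_unif_cluster (R : realType) (psi : nat -> R -> R) (phi : R -> R) : Prop :=
  forall (e r : R) N, 0 < e -> exists2 n, (N <= n)%N &
    forall x, `|x| <= r -> `|psi n x - phi x| <= e.

Lemma segment_grid (R : realType) (r d : R) : 0 < d -> exists s : seq R,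
  forall x, `|x| <= r -> exists2 y, y \in s & `|x - y| <= d.
Proof.
move=> d0; pose m := (Num.truncn (2 * r / d)).+1.
exists [seq - r + i%:R * d | i <- iota 0 m] => x; rewrite ler_norml => /andP[rx xr].
pose i := Num.truncn ((x + r) / d).
have q0 : 0 <= (x + r) / d by rewrite divr_ge0 ?(ltW d0)//; lra.
have /andP[i1 i2] := truncn_itv q0.
have id1 : i%:R * d <= x + r by rewrite -ler_pdivlMr.
have id2 : x + r < i.+1%:R * d by rewrite -ltr_pdivrMr.
exists (- r + i%:R * d).
  apply/mapP; exists i => //; rewrite mem_iota /= add0n /m ltnS.
  by apply: le_truncn; rewrite ler_pM2r ?invr_gt0//; lra.
by rewrite -natr1 mulrDl mul1r in id2; rewrite ger0_norm; lra.
Qed.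

(** Tychonoff's theorem gives a pointwise cluster point; equicontinuity turns
    closeness on a finite grid into uniform closeness on an interval. *)
Lemma arzela_ascoli_cluster (R : realType) (V : R) (psi : nat -> R -> R) :
  (forall n x, 0 <= psi n x <= V) -> equicontinuous_seq psi ->
  exists phi, loc_unif_cluster psi phi.
Proof.
move=> psiV equi.
pose PT : topologicalType := prod_topology (fun _ : R => R : topologicalType).
have cK : @compact PT [set f | forall x, `[0, V]%classic (f x)].
  exact: (@tychonoff R (fun _ => R : topologicalType) (fun _ => `[0, V]%classic)
    (fun _ => @segment_compact R 0 V)).
pose F : set_system PT := psi @ \oo.
have FF : ProperFilter F by exact: fmap_proper_filter.
have FK : F [set f | forall x, `[0, V]%classic (f x)].
  by exists 0%N => // n _ x /=; rewrite in_itv/=.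
have [phi [phiK clus]] := cK F FF FK.
(* basic neighborhoods of the pointwise topology *)
pose B (s : seq R) (e : R) : set PT := [set f | forall x, x \in s -> `|f x - phi x| <= e].
have near_pts s e : 0 < e -> nbhs phi (B s e).
  move=> e0; elim: s => [|a s IH].
    by apply: filterE => f x; rewrite in_nil.
  have bb : nbhs (phi a : R) (ball (phi a : R) e) by exact: nbhsx_ballx.
  pose Ba : set PT := [set f | ball (phi a : R) e (f a)].
  have Ha : nbhs phi Ba := @proj_continuous R (fun _ : R => R : topologicalType) a phi _ bb.
  have sub : Ba `&` B s e `<=` B (a :: s) e.
    move=> f [fa fs] x; rewrite in_cons => /orP[/eqP->|/fs//].
    by rewrite distrC; apply: ltW; move: fa; rewrite /Ba/= -ball_normE.
  exact: filterS sub (filterI Ha IH).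
have pts (s : seq R) (e : R) N : 0 < e -> exists2 n, (N <= n)%N &
    forall x, x \in s -> `|psi n x - phi x| <= e.
  move=> e0.
  have FN : F [set psi n | n in [set n | (N <= n)%N]].
    by exists N => // n /= Nn; exists n.
  have [f [[n Nn <-] Hn]] := clus _ _ FN (near_pts s e e0).
  by exists n.
exists phi => e r N e0.
have e4 : 0 < e / 4 by lra.
have [d d0 Hd] := equi _ e4.
have phi_mod x y : `|x - y| <= d -> `|phi x - phi y| <= e / 2.
  move=> xy; have e8 : 0 < e / 8 by lra.
  have [n _ Hn] := pts [:: x; y] _ 0%N e8.
  have := Hd n x y xy; have := Hn x _; have := Hn y _.
  rewrite !inE !eqxx orbT !ler_norml => /(_ isT)/andP[? ?] /(_ isT)/andP[? ?] /andP[? ?].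
  by apply/andP; split; lra.
have [s Hs] := segment_grid r d0.
have [n Nn Hn] := pts s _ N e4.
exists n => // x /Hs[y ys xy].
have := Hd n _ _ xy; have := phi_mod _ _ xy; have := Hn _ ys.
rewrite !ler_norml => /andP[? ?] /andP[? ?] /andP[? ?].
by apply/andP; split; lra.
Qed.

Section Cluster.
Variables (R : realType) (psi : nat -> R -> R) (phi : R -> R).
Hypothesis clus : loc_unif_cluster psi phi.

Lemma cluster_modulus (e d : R) :
  (forall n x y, `|x - y| <= d -> `|psi n x - psi n y| <= e) ->
  forall x y, `|x - y| <= d -> `|phi x - phi y| <= e.
Proof.
move=> Hd x y xy; apply/ler_addgt0Pr => t t0.
have t2 : 0 < t / 2 by lra.
have [n _ Hn] := clus (Num.max `|x| `|y|) 0 t2.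
have := Hn x; have := Hn y; rewrite !le_max !lexx orbT => /(_ isT) + /(_ isT).
have := Hd n _ _ xy; rewrite !ler_norml => /andP[? ?] /andP[? ?] /andP[? ?].
by apply/andP; split; lra.
Qed.

Lemma cluster_continuous : equicontinuous_seq psi -> continuous phi.
Proof.
move=> equi; apply: dist_continuous => x e /equi[d d0 Hd]; exists d => // y.
exact: cluster_modulus.
Qed.

Lemma cluster_ge (N : nat) (a x : R) : (forall n, (N <= n)%N -> a <= psi n x) -> a <= phi x.
Proof.
move=> H; apply/ler_addgt0Pr => t t0; have [n Nn Hn] := clus `|x| N t0.
by have := H n Nn; have := Hn x (lexx _); rewrite ler_norml => /andP[? ?]; lra.
Qed.

Lemma cluster_le (N : nat) (a x : R) : (forall n, (N <= n)%N -> psi n x <= a) -> phi x <= a.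
Proof.
move=> H; apply/ler_addgt0Pr => t t0; have [n Nn Hn] := clus `|x| N t0.
by have := H n Nn; have := Hn x (lexx _); rewrite ler_norml => /andP[? ?]; lra.
Qed.
End Cluster.

(** * Limits of approximate solutions and a Schauder theorem *)

Lemma continuous_minr (R : realType) (f g : R -> R) :
  continuous f -> continuous g -> continuous (fun x => Num.min (f x) (g x)).
Proof.
move=> cf cg; apply: dist_continuous => x e e0.
have [d d0 Hd] := continuous_dist (cf x) e0.
have [d' d'0 Hd'] := continuous_dist (cg x) e0.
exists (Num.min d d') => [|y]; first by rewrite lt_min d0.
by rewrite le_min => /andP[/Hd ? /Hd' ?]; exact: ler_dist_min.
Qed.

Lemma continuous_sumr (R : realType) (I : Type) (s : seq I) (f : I -> R -> R) :
  (forall i, continuous (f i)) -> continuous (fun x => \sum_(i <- s) f i x).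
Proof.
move=> cf; elim: s => [|i s IH].
  by under eq_fun do rewrite big_nil; exact: cst_continuous.
under eq_fun do rewrite big_cons.
by move=> x; apply: cvgD; [exact: cf|exact: IH].
Qed.

Lemma archi_inv (R : realType) (e : R) : 0 < e -> exists N, forall n, (N <= n)%N ->
  n.+1%:R^-1 <= e.
Proof.
move=> e0; exists (Num.bound e^-1) => n Nn.
rewrite -[leRHS]invrK lef_pV2 ?posrE ?invr_gt0// ?ltr0n//.
apply/ltW/(lt_le_trans (archi_boundP _)); first by rewrite invr_ge0 ltW.
by rewrite ler_nat ltnW// ltnS.
Qed.

Section FixedPoint.
Variables (R : realType) (E : (R -> R) -> R) (beta : R -> R) (V : R).
Hypothesis hE : averaging E.
Hypothesis V_gt0 : 0 < V.
Hypothesis beta_range : forall v, 0 <= beta v <= V.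
Hypothesis beta_unif : forall e : R, 0 < e -> exists2 d : R, 0 < d &
  forall u v, `|u - v| <= d -> `|beta u - beta v| <= e.
Notation A := (redistribute E beta).

(** The equation passes to the cluster point because redistribute is continuous for
    locally uniform convergence and has a common modulus, which absorbs cs n - c. *)
Lemma limit_solution (g : R -> R) (c : R) (cs : nat -> R) (psi : nat -> R -> R) phi :
  equicontinuous_seq psi -> (forall n, continuous (psi n)) ->
  (forall n, `|cs n - c| <= n.+1%:R^-1) ->
  (forall n x, `|x| <= n%:R ->
     `|psi n x - Num.max (A (psi n) (x - cs n)) (g x)| <= n.+1%:R^-1) ->
  loc_unif_cluster psi phi ->
  forall x, phi x = Num.max (A phi (x - c)) (g x).
Proof.
move=> equi cpsi csc Hpsi clus x.
have cphi := cluster_continuous clus equi.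
apply/eqP; rewrite -subr_eq0 -normr_le0; apply/ler_addgt0Pr => t t0; rewrite add0r.
have t4 : 0 < t / 4 by lra.
have [eta eta0 [r r0 stable]] := redistribute_stable hE V_gt0 beta_range beta_unif t4.
have [d d0 modulus] := redistribute_modulus hE V_gt0 beta_range beta_unif t4.
have m0 : 0 < Num.min (t / 4) d by rewrite lt_min t4.
have [N HN] := archi_inv m0.
have e0 : 0 < Num.min eta (t / 4) by rewrite lt_min eta0.
have [n Nn Hn] := clus _ (Num.max `|x| (`|x - c| + r)) (maxn N (Num.bound `|x|)) e0.
move: Nn; rewrite geq_max => /andP[Nn xn].
have := HN n Nn; rewrite le_min => /andP[nt nd].
have xn' : `|x| <= n%:R.
  by apply/ltW/(lt_le_trans (archi_boundP (normr_ge0 x))); rewrite ler_nat.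
have H1 : `|psi n x - phi x| <= t / 4.
  by have := Hn x; rewrite le_max lexx /= => /(_ isT); rewrite le_min => /andP[].
have H2 := le_trans (Hpsi n x xn') nt.
have H3 : `|A (psi n) (x - cs n) - A (psi n) (x - c)| <= t / 4.
  apply: modulus => //; rewrite (_ : _ - _ = c - cs n); last by ring.
  by rewrite distrC; apply: le_trans (csc n) nd.
have H4 : `|A (psi n) (x - c) - A phi (x - c)| <= t / 4.
  apply: stable => // y yr.
  have := Hn (x - c + y); rewrite le_max le_min.
  have -> : `|x - c + y| <= `|x - c| + r.
    by apply: le_trans (ler_normD _ _) _; rewrite lerD2l.
  by rewrite orbT => /(_ isT)/andP[].
have H5 : `|Num.max (A (psi n) (x - cs n)) (g x) - Num.max (A phi (x - c)) (g x)| <= t / 2.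
  apply: ler_dist_max; last by rewrite subrr normr0; lra.
  by move: H3 H4; rewrite !ler_norml => /andP[? ?] /andP[? ?]; apply/andP; split; lra.
by move: H1 H2 H5; rewrite !ler_norml => /andP[? ?] /andP[? ?] /andP[? ?];
  apply/andP; split; lra.
Qed.

Section Schauder.
Variables (g W : R -> R) (c : R).
Hypothesis g_range : forall x, 0 <= g x <= V.
Hypothesis g_unif : forall e : R, 0 < e -> exists2 d : R, 0 < d &
  forall x y, `|x - y| <= d -> `|g x - g y| <= e.
Hypothesis W_ge0 : forall x, 0 <= W x.
Hypothesis W_cont : continuous W.

Let G (phi : R -> R) (x : R) := Num.max (A phi (x - c)) (g x).

Hypothesis W_super : forall phi : R -> R, continuous phi -> (forall x, 0 <= phi x <= W x) ->
  forall x, G phi x <= W x.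

Let G_range (phi : R -> R) x : continuous phi -> 0 <= G phi x <= V.
Proof.
move=> cphi; have /andP[A0 AV] := redistribute_range hE beta_range beta_unif (x - c) cphi.
by have /andP[g0 gV] := g_range x; rewrite /G le_max A0 /= ge_max AV.
Qed.

Let G_modulus (e : R) : 0 < e -> exists2 d : R, 0 < d &
  forall phi : R -> R, continuous phi -> forall x y, `|x - y| <= d -> `|G phi x - G phi y| <= e.
Proof.
move=> e0; have [d d0 Hd] := redistribute_modulus hE V_gt0 beta_range beta_unif e0.
have [d' d'0 Hd'] := g_unif e0.
exists (Num.min d d') => [|phi cphi x y]; first by rewrite lt_min d0.
rewrite le_min => /andP[xy xy']; apply: ler_dist_max; last exact: Hd'.
by apply: Hd => //; rewrite (_ : _ - _ = x - y)//; ring.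
Qed.

(** Schauder's projection: profiles are interpolated from their values at finitely
    many points by a partition of unity and cut off at W. On the vectors of values
    the map G is uniformly continuous, so approx_brouwer applies; equicontinuity of
    the image controls the interpolation error. *)
Lemma approx_fixed_point (e r0 : R) : 0 < e -> exists2 phi : R -> R, continuous phi &
  (forall x, 0 <= phi x <= W x) /\
  forall x, `|x| <= r0 -> `|G phi x - G (G phi) x| <= e.
Proof.
move=> e0.
have [eta eta0 [r r00 stable]] := redistribute_stable hE V_gt0 beta_range beta_unif e0.
have eta2 : 0 < eta / 2 by lra.
have [d d0 modulus] := G_modulus eta2.
have d2 : 0 < d / 2 by lra.
pose rho := r0 + `|c| + r.
have [s grid] := segment_grid rho d2.
pose m := size s.
pose pt (j : 'I_m) : R := nth 0 s j.
pose q (j : 'I_m) (x : R) := Num.max 0 (d - `|x - pt j|).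
have q_ge0 j x : 0 <= q j x by rewrite /q le_max lexx.
pose Q (x : R) := \sum_j q j x.
have Q_ge0 x : 0 <= Q x by rewrite sumr_ge0.
(* the lower bound d / 2 keeps the quotients continuous where Q vanishes; on
   [-rho, rho] the grid makes it inactive *)
pose D (x : R) := Num.max (Q x) (d / 2).
have D_gt0 x : 0 < D x by rewrite /D lt_max d2 orbT.
pose p (j : 'I_m) (x : R) := q j x / D x.
have p_ge0 j x : 0 <= p j x by rewrite divr_ge0// ltW.
have p_sum x : \sum_j p j x <= 1.
  by rewrite -mulr_suml ler_pdivrMr// mul1r /D le_max lexx.
have p_sum1 x : `|x| <= rho -> \sum_j p j x = 1.
  move=> /grid[y ys xy].
  have yi : (index y s < m)%N by rewrite index_mem.
  have dQ : d / 2 <= Q x.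
    rewrite /Q (bigD1 (Ordinal yi))//=; apply: ler_wpDr; first by rewrite sumr_ge0.
    by rewrite /q /pt /= nth_index// le_max; apply/orP; right; lra.
  rewrite -mulr_suml -/(Q x) /D max_l// divff// gt_eqF//; exact: lt_le_trans dQ.
have q_cont j : continuous (q j).
  apply: lipschitz_continuous => x y; apply: ler_dist_max.
    by rewrite subrr normr0.
  rewrite (_ : d - _ - _ = `|y - pt j| - `|x - pt j|); last by ring.
  apply: le_trans (ler_dist_dist _ _) _; rewrite (_ : _ - _ = y - x); last by ring.
  by rewrite distrC.
have Q_cont : continuous Q by exact: continuous_sumr.
have D_cont : continuous D.
  apply: dist_continuous => x t t0; have [d1 d10 Hd1] := continuous_dist (Q_cont x) t0.
  exists d1 => // y /Hd1 H; apply: ler_dist_max => //; rewrite subrr normr0; exact: ltW.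
have p_cont j : continuous (p j).
  move=> x; apply: cvgM; first exact: q_cont.
  by apply: cvgV; [rewrite gt_eqF|exact: D_cont].
pose phi_ (a : 'I_m -> R) (x : R) := Num.min (W x) (\sum_j a j * p j x).
have phi_cont a : continuous (phi_ a).
  apply: continuous_minr => //; apply: continuous_sumr => j x.
  by apply: cvgM; [exact: cvg_cst|exact: p_cont].
have phi_rangeW a : (forall j, 0 <= a j) -> forall x, 0 <= phi_ a x <= W x.
  move=> a0 x; rewrite /phi_ le_min W_ge0 /= ge_min lexx /= andbT.
  by rewrite sumr_ge0// => j _; rewrite mulr_ge0.
pose F (a : 'I_m -> R) (j : 'I_m) := G (phi_ a) (pt j).
have phi_lip a a' (t : R) : 0 <= t -> (forall j, `|a j - a' j| <= t) -> forall x,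
    `|phi_ a x - phi_ a' x| <= t.
  move=> t0 aa' x; apply: ler_dist_min; first by rewrite subrr normr0.
  rewrite -sumrB; under eq_bigr do rewrite -mulrBl.
  apply: le_trans (ler_norm_sum _ _ _) _.
  apply: (@le_trans _ _ (\sum_j t * p j x)).
    by apply: ler_sum => j _; rewrite normrM (ger0_norm (p_ge0 j x)) ler_wpM2r.
  by rewrite -mulr_sumr ler_piMr.
have [a a0 Fa] : exists2 a : 'I_m -> R, forall j, 0 <= a j & forall j, `|F a j - a j| <= eta / 2.
  apply: (@approx_brouwer R m V F) => //.
  - by move=> a j _; exact: G_range.
  - move=> t t0; have [d1 d10 Hd1] := beta_unif t0; exists d1 => // a a' aa' j.
    apply: ler_dist_max; last by rewrite subrr normr0 ltW.
    apply: avg_dist_unif => // [||y]; [exact: bounded_borel_beta..|].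
    by apply: Hd1; apply: phi_lip => //; exact: ltW.
exists (phi_ a) => //; split; first exact: phi_rangeW.
have G_cont : continuous (G (phi_ a)).
  apply: dist_continuous => x t /G_modulus[d1 d10 Hd1]; exists d1 => // y; exact: Hd1.
have close x : `|x| <= rho -> `|phi_ a x - G (phi_ a) x| <= eta.
  move=> xrho; rewrite -[X in _ - X](min_r (W_super (phi_cont a) (phi_rangeW _ a0) x)).
  apply: ler_dist_min; first by rewrite subrr normr0 ltW.
  rewrite -[X in _ - X]mulr1 -(p_sum1 _ xrho) mulr_sumr -sumrB.
  under eq_bigr do rewrite -mulrBl.
  apply: le_trans (ler_norm_sum _ _ _) _.
  rewrite -[leRHS]mulr1 -(p_sum1 _ xrho) mulr_sumr; apply: ler_sum => j _.
  rewrite normrM (ger0_norm (p_ge0 j x)).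
  have [xj|xj] := leP `|x - pt j| d; last first.
    by rewrite /p /q max_l ?mul0r ?mulr0//; lra.
  rewrite ler_wpM2r//; have := Fa j; have := modulus _ (phi_cont a) _ _ xj.
  by rewrite /F !ler_norml => /andP[? ?] /andP[? ?]; apply/andP; split; lra.
move=> x xr; apply: ler_dist_max; last by rewrite subrr normr0 ltW.
apply: stable => // y yr; apply: close; rewrite /rho.
apply: le_trans (ler_normD _ _) _; apply: lerD => //.
by apply: le_trans (ler_normB _ _) _; rewrite lerD2r.
Qed.

Theorem schauder_between : exists phi : R -> R, [/\ continuous phi,
  forall x, 0 <= phi x <= V, forall x, phi x <= W x &
  forall x, phi x = Num.max (A phi (x - c)) (g x)].
Proof.
have H n : exists phi : R -> R, continuous phi /\ (forall x, 0 <= phi x <= W x) /\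
    forall x, `|x| <= n%:R -> `|G phi x - G (G phi) x| <= n.+1%:R^-1.
  have n0 : 0 < n.+1%:R^-1 :> R by rewrite invr_gt0 ltr0n.
  by have [phi cphi H] := approx_fixed_point n%:R n0; exists phi.
have [phis Hphis] := choice H.
pose psi n := G (phis n).
have cphis n : continuous (phis n) by have [] := Hphis n.
have psi_equi : equicontinuous_seq psi.
  by move=> e /G_modulus[d d0 Hd]; exists d => // n x y; exact: Hd.
have cpsi n : continuous (psi n).
  by apply: dist_continuous => x e /psi_equi[d d0 Hd]; exists d => // y; exact: Hd.
have psiV n x : 0 <= psi n x <= V by exact: G_range.
have [phi clus] := arzela_ascoli_cluster psiV psi_equi.
exists phi; split.
- exact: cluster_continuous clus psi_equi.
- move=> x; apply/andP; split.
    by apply: (cluster_ge (N := 0) clus) => n _; have /andP[] := psiV n x.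
  by apply: (cluster_le (N := 0) clus) => n _; have /andP[] := psiV n x.
- move=> x; apply: (cluster_le (N := 0) clus) => n _.
  by apply: W_super => //; have [_ []] := Hphis n.
- apply: (limit_solution (cs := fun=> c) psi_equi cpsi _ _ clus) => //.
  + by move=> n; rewrite subrr normr0 invr_ge0 ler0n.
  + by move=> n x xn; have [_ [_]] := Hphis n; apply.
Qed.
End Schauder.
End FixedPoint.

(** * Tents and null sets *)

Lemma expr_unbounded (R : realType) (a b : R) : 1 < a -> exists N, forall n, (N <= n)%N ->
  b <= a ^+ n.
Proof.
(* Bernoulli's inequality *)
move=> a1; have bern n : 1 + n%:R * (a - 1) <= a ^+ n.
  elim: n => [|n IH]; first by rewrite mul0r addr0 expr0.
  have H : 0 <= n%:R * ((a - 1) * (a - 1)) by rewrite mulr_ge0 ?ler0n// mulr_ge0//; lra.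
  rewrite exprS -natr1; apply: le_trans (ler_wpM2l _ IH); last by lra.
  by move: H; lra.
have a10 : 0 < a - 1 by lra.
exists (Num.bound (`|b| / (a - 1))) => n Nn; apply: le_trans (bern n).
have H : `|b| <= n%:R * (a - 1).
  rewrite -ler_pdivrMr//; apply/ltW/(lt_le_trans (archi_boundP _)).
    by rewrite divr_ge0// ltW.
  by rewrite ler_nat.
by have := ler_norm b; lra.
Qed.

Definition tent (R : realType) (w x : R) : R := Num.max 0 (1 - `|x| / w).

Lemma tent_range (R : realType) (w x : R) : 0 < w -> 0 <= tent w x <= 1.
Proof.
move=> w0; rewrite /tent le_max lexx /= ge_max ler01 /= lerBlDr lerDl.
by rewrite divr_ge0// ltW.
Qed.

Lemma tent_continuous (R : realType) (w z : R) : 0 < w ->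
  continuous (fun y => tent w (z + y)).
Proof.
move=> w0; apply: dist_continuous => x e e0; exists (e * w) => [|y xy].
  exact: mulr_gt0.
apply: ler_dist_max; first by rewrite subrr normr0 ltW.
have -> : 1 - `|z + x| / w - (1 - `|z + y| / w) = (`|z + y| - `|z + x|) / w by ring.
rewrite normrM [X in _ * X]ger0_norm ?invr_ge0 ?(ltW w0)// ler_pdivrMr//.
apply: le_trans (ler_dist_dist _ _) _; rewrite (_ : _ - _ = y - x); last by ring.
by rewrite distrC.
Qed.

(** On either side of its tip the tent is convex, and the only loss occurs when x is
    within rho of the tip. *)
Lemma tent_average (R : realType) (w rho x y : R) : 0 < w -> 2 * rho <= w -> `|y| <= rho ->
  2 * ((1 - 2 * rho / w) * tent w x) <= tent w (x + y) + tent w (x - y).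
Proof.
move=> w0 rw yr; set i := w^-1; have i0 : 0 < i by rewrite invr_gt0.
have wi : w * i = 1 by rewrite mulfV// gt_eqF.
have /andP[t0 t1] := tent_range x w0.
have rho0 : 0 <= rho := le_trans (normr_ge0 y) yr.
have k0 : 0 <= 1 - 2 * rho * i by have := ler_wpM2r (ltW i0) rw; rewrite wi; lra.
have k1 : 1 - 2 * rho * i <= 1 by rewrite lerBlDr lerDl; apply: mulr_ge0 (ltW i0); lra.
have tge u : 1 - `|u| * i <= tent w u by rewrite /tent le_max lexx orbT.
have tge0 u : 0 <= tent w u by have /andP[] := tent_range u w0.
have [xr|xr] := leP rho `|x|.
  apply: (@le_trans _ _ (2 * tent w x)).
    by rewrite ler_pM2l// ler_piMl.
  have sum2 : `|x + y| * i + `|x - y| * i = 2 * (`|x| * i).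
    rewrite -mulrDl mulrA; congr (_ * _).
    move: xr yr; rewrite ler_norml => xr /andP[y1 y2].
    have [x0|x0] := leP 0 x.
      by rewrite ger0_norm in xr *; rewrite // !ger0_norm; lra.
    by rewrite (ltr0_norm x0) in xr *; rewrite !ler0_norm; lra.
  have := tge (x + y); have := tge (x - y); have := tge0 (x + y); have := tge0 (x - y).
  rewrite {5}/tent -/i; case: (leP 0 (1 - `|x| * i)) => ?; lra.
have near z : `|z| <= 2 * rho -> 1 - 2 * rho * i <= tent w z.
  move=> zr; apply: le_trans (tge z); have := ler_wpM2r (ltW i0) zr; lra.
have H1 := near (x + y) _; have H2 := near (x - y) _.
have {}H1 : 1 - 2 * rho * i <= tent w (x + y).
  by apply: H1; apply: le_trans (ler_normD _ _) _; lra.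
have {}H2 : 1 - 2 * rho * i <= tent w (x - y).
  by apply: H2; apply: le_trans (ler_normB _ _) _; lra.
have : (1 - 2 * rho * i) * tent w x <= 1 - 2 * rho * i by rewrite ler_piMr.
lra.
Qed.

Section MeanMass.
Variables (R : realType) (E : (R -> R) -> R).
Hypothesis hE : averaging E.
Local Notation mset := (set (measurableTypeR R)).

(** A wide tent is almost not decreased by averaging, because the evenness of the
    average allows the symmetrisation of tent_average. *)
Lemma tent_subeigen (q : R) : 0 <= q < 1 -> exists2 w : R, 0 < w &
  forall x, q * tent w x <= E (fun y => tent w (x + y)).
Proof.
move=> /andP[q0 q1]; have e0 : 0 < (1 - q) / 2 by lra.
have [rho rho0 tail] := avg_tail hE e0.
(* then 1 - 2 rho / w = (1 + q) / 2, and the tail costs another (1 - q) / 2 *)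
pose w := 4 * rho / (1 - q).
have w0 : 0 < w by rewrite /w divr_gt0//; lra.
have rw : 2 * rho / w = (1 - q) / 2.
  by rewrite /w; field; apply/andP; split; apply: lt0r_neq0; lra.
exists w => // x.
have /andP[t0 t1] := tent_range x w0.
have bt z : bounded_borel (fun y => tent w (z + y)).
  apply: bounded_borel_continuous; first exact: tent_continuous.
  by exists 1 => y; have /andP[? ?] := tent_range (z + y) w0; rewrite ger0_norm.
have btN := bounded_borelN (bt x).
have bT := bounded_borel_indic (measurable_norm_gt rho).
set K := 2 * ((1 - 2 * rho / w) * tent w x).
have KE : K = (1 + q) * tent w x by rewrite /K rw; lra.
have : E (fun y => K + (- K) * \1_[set y | rho < `|y|] y) <=
       E (fun y => tent w (x + y) + tent w (x + - y)).
  apply: avg_le => //.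
  - by apply: bounded_borelD; [exact: bounded_borel_cst|exact: bounded_borelZ].
  - exact: bounded_borelD.
  - move=> y; rewrite indicE; have [yr|yr] := leP `|y| rho.
      rewrite memNset/=; last by apply/negP; rewrite -leNgt.
      rewrite mulr0 addr0; apply: tent_average => //.
      by rewrite -[X in _ <= X]mul1r -ler_pdivrMr// rw; lra.
    rewrite mem_set// mulr1 subrr addr_ge0//.
      by have /andP[] := tent_range (x + y) w0.
    by have /andP[] := tent_range (x - y) w0.
rewrite (avgD hE (bounded_borel_cst K) (bounded_borelZ _ bT)) (avgD hE (bt x) btN).
rewrite (avg_even hE (bt x)) (avg_cst hE) (avgZ hE)//.
have K0 : 0 <= K by rewrite KE; apply: mulr_ge0 => //; lra.
have := ler_wpM2l K0 tail; rewrite KE => H1 H2.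
have H3 : 0 <= (1 - q) * (1 - q) * tent w x by apply: mulr_ge0 => //; apply: mulr_ge0; lra.
lra.
Qed.

Lemma mass_le (A B : mset) : measurable A -> measurable B -> A `<=` B ->
  E \1_A <= E \1_B.
Proof.
move=> mA mB AB; apply: avg_le => //; [exact: bounded_borel_indic..|move=> x].
rewrite !indicE ler_nat; have [/set_mem/AB/mem_set ->//|_] := boolP (x \in A).
by case: (_ \in _).
Qed.

Lemma mass_ge0 (A : mset) : measurable A -> 0 <= E \1_A.
Proof.
by move=> mA; apply: (avg_ge0 hE) => [|x]; [exact: bounded_borel_indic|rewrite indicE ler0n].
Qed.

Lemma mass_cover (A B C : mset) : measurable A -> measurable B -> measurable C ->
  A `<=` B `|` C -> E \1_A <= E \1_B + E \1_C.
Proof.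
move=> mA mB mC ABC.
have [bA bB bC] := And3 (bounded_borel_indic mA) (bounded_borel_indic mB) (bounded_borel_indic mC).
rewrite -(avgD hE bB bC); apply: avg_le => //; first exact: bounded_borelD.
move=> x; rewrite !indicE -natrD ler_nat.
have [/set_mem/ABC[]/mem_set ->|_] := boolP (x \in A).
- by case: (x \in C).
- by case: (x \in B).
- by [].
Qed.

Lemma mass_ball_opp (x l : R) :
  E \1_[set y | `|y - x| <= l] = E \1_[set y | `|y + x| <= l].
Proof.
have mB := measurable_normB_le (- x) l; rewrite opprK in mB.
rewrite -(avg_even hE (bounded_borel_indic mB)); congr (E _); apply/funext => y.
rewrite !indicE; congr ((_ : bool)%:R); apply/idP/idP => /set_mem /= H; apply/mem_set => /=.
  by rewrite addrC distrC.
by rewrite distrC addrC.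
Qed.

(** A bounded window consists of finitely many intervals of length l, and the part of
    N in any of them lies in the null ball about any of its points. *)
Lemma locally_null (N : mset) (l : R) : measurable N -> 0 < l ->
  (forall x, N x -> E \1_[set y | `|y - x| <= l] = 0) -> E \1_N = 0.
Proof.
move=> mN l0 Nnull; apply/eqP; rewrite eq_le mass_ge0// andbT.
apply/ler_addgt0Pr => e e0; rewrite add0r.
have [r r0 tail] := avg_tail hE e0.
pose P j : mset := N `&` `[- r, - r + j%:R * l]%classic.
have mP j : measurable (P j) by apply: measurableI => //; exact: measurable_itv.
have P0 j : E \1_(P j.+1) = 0.
  have step i : E \1_(N `&` `[- r + i%:R * l, - r + i.+1%:R * l]%classic) = 0.
    set Q := N `&` _.
    have mQ : measurable (Q : mset) by apply: measurableI => //; exact: measurable_itv.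
    have [Q0|/set0P[x [Nx /= xi]]] := eqVneq Q set0.
      by rewrite Q0 indic0 (avg_cst hE).
    apply/eqP; rewrite eq_le mass_ge0// andbT -(Nnull _ Nx).
    apply: mass_le => //; first exact: measurable_normB_le.
    move=> y [_ /=]; move: xi; rewrite !in_itv/= -natr1 mulrDl mul1r ler_norml => ? ?.
    by apply/andP; split; lra.
  elim: j => [|j IH].
    have := step 0%N; rewrite mul0r addr0; exact.
  apply/eqP; rewrite eq_le mass_ge0// andbT -[leRHS]addr0 -{1}IH -(step j.+1).
  apply: mass_cover => //; first by apply: measurableI => //; exact: measurable_itv.
  move=> y [Ny /=]; rewrite in_itv/= => /andP[y1 y2].
  have [yj|yj] := leP y (- r + j.+1%:R * l); [left|right]; split => //=;
    by rewrite in_itv/= ?y1 ?yj ?(ltW yj) ?y2.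
pose J := (Num.bound (2 * r / l)).
have J0 : 2 * r <= J.+1%:R * l.
  rewrite -ler_pdivrMr//; apply/ltW/(lt_le_trans (archi_boundP _)).
    by rewrite divr_ge0 ?(ltW l0)//; lra.
  by rewrite ler_nat.
apply: le_trans tail; rewrite -[leRHS]add0r -(P0 J).
apply: mass_cover => //; first exact: measurable_norm_gt.
move=> y Ny; have [yr|yr] := leP `|y| r; [left|by right]; split => //=.
by move: yr; rewrite in_itv/= ler_norml => /andP[? ?]; apply/andP; split; lra.
Qed.
End MeanMass.

(** * The hair-trigger effect and positivity *)

Lemma truncn_shift (R : realType) (c y : R) : 0 < c -> 0 <= y ->
  0 <= y - (Num.truncn (y / c))%:R * c < c.
Proof.
move=> c0 y0; set n := Num.truncn _; have q0 : 0 <= y / c by rewrite divr_ge0// ltW.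
have /andP[] := truncn_itv q0; rewrite -/n ler_pdivlMr// ltr_pdivrMr// -natr1 mulrDl mul1r.
by move=> ? ?; apply/andP; split; lra.
Qed.

Section Waves.
Variables (R : realType) (E : (R -> R) -> R) (beta : R -> R) (V D gam del : R).
Hypothesis hE : averaging E.
Hypothesis V_gt0 : 0 < V.
Hypothesis beta_range : forall v, 0 <= beta v <= V.
Hypothesis beta_unif : forall e : R, 0 < e -> exists2 d : R, 0 < d &
  forall u v, `|u - v| <= d -> `|beta u - beta v| <= e.
Hypothesis D_gt0 : 0 < D.
Hypothesis beta_le : forall v : R, 0 <= v -> beta v <= D * v.
Hypothesis gam_gt1 : 1 < gam.
Hypothesis del_gt0 : 0 < del.
Hypothesis beta_ge : forall v : R, 0 <= v -> gam * Num.min v del <= beta v.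
Notation A := (redistribute E beta).
Local Notation mset := (set (measurableTypeR R)).

Let bb (phi : R -> R) z := @bounded_borel_beta R beta V beta_range beta_unif phi z.

Let gam_gt0 : 0 < gam. Proof. by apply: lt_trans gam_gt1; exact: ltr01. Qed.

Let beta_gt0 (v : R) : 0 < v -> 0 < beta v.
Proof.
move=> v0; apply: lt_le_trans (beta_ge (ltW v0)).
by rewrite mulr_gt0// lt_min v0.
Qed.

Let beta0 : beta 0 = 0.
Proof.
apply/eqP; rewrite eq_le; have /andP[-> _] := beta_range 0.
by have := beta_le (lexx 0); rewrite mulr0 => ->.
Qed.

Definition supersolution (phi : R -> R) (c : R) : Prop :=
  [/\ continuous phi, forall x, 0 <= phi x & forall x, A phi (x - c) <= phi x].

(** Since beta v >= gam * min v del with gam > 1 and a wide tent is averaged almost to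
    itself, a tent below the profile grows by the factor kap > 1 with each step to
    the right by c, until its height reaches del. *)
Lemma hair_trigger : exists2 w : R, 0 < w & forall s, 0 < s -> exists N,
  forall phi c x0, supersolution phi c -> (forall x, `|x - x0| <= w -> s <= phi x) ->
  forall n, (N <= n)%N -> del <= phi (x0 + n%:R * c).
Proof.
(* any q with 1 / gam < q < 1 *)
pose q := (1 + gam^-1) / 2.
have ig : gam^-1 < 1 by rewrite invf_lt1.
have ig0 : 0 < gam^-1 by rewrite invr_gt0.
have q01 : 0 <= q < 1 by rewrite /q; apply/andP; split; lra.
have kapE : gam * q = (gam + 1) / 2 by rewrite /q mulrA mulrDr mulr1 mulfV ?gt_eqF.
pose kap := gam * q.
have kap1 : 1 < kap by rewrite /kap kapE; have := gam_gt1; lra.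
have [w w0 Hw] := tent_subeigen hE q01.
exists w => // s s0; pose s0' := Num.min s del.
have s0'0 : 0 < s0' by rewrite lt_min s0.
have [N HN] := expr_unbounded (del / s0') kap1.
exists N => phi c x0 [cphi phi0 sup] phis n Nn.
pose sn m := Num.min (kap ^+ m * s0') del.
have sn_le m : sn m <= del by rewrite /sn ge_min lexx orbT.
have sn_ge0 m : 0 <= sn m.
  rewrite /sn le_min (ltW del_gt0) andbT; apply: mulr_ge0 (ltW s0'0).
  by apply: exprn_ge0; apply: le_trans (ltW kap1); exact: ler01.
have below m x : sn m * tent w (x - (x0 + m%:R * c)) <= phi x.
  elim: m x => [|m IH] x.
    rewrite mul0r addr0 /sn expr0 mul1r min_l; last by rewrite /s0' ge_min lexx orbT.
    have [xw|xw] := leP `|x - x0| w.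
      apply: le_trans (phis x xw); apply: (@le_trans _ _ s0').
        by apply: ler_piMr (ltW s0'0) _; have /andP[] := tent_range (x - x0) w0.
      by rewrite /s0' ge_min lexx.
    rewrite {1}/tent max_l ?mulr0//.
    by rewrite subr_le0 ler_pdivlMr// mul1r ltW.
  apply: le_trans (sup x).
  apply: (@le_trans _ _ (gam * sn m * (q * tent w (x - c - (x0 + m%:R * c))))).
    have -> : x - (x0 + m.+1%:R * c) = x - c - (x0 + m%:R * c).
      by rewrite -natr1; ring.
    rewrite mulrA ler_wpM2r//.
      by have /andP[] := tent_range (x - c - (x0 + m%:R * c)) w0.
    have -> : gam * sn m * q = kap * sn m by rewrite /kap; ring.
    rewrite /sn exprS -mulrA; case: (leP (kap ^+ m * s0') del) => H.
      by rewrite ge_min lexx.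
    rewrite ge_min; apply/orP; right.
    by have := ler_wpM2r (ltW del_gt0) (ltW kap1); rewrite mul1r.
  apply: (@le_trans _ _ (gam * sn m * E (fun y => tent w (x - c - (x0 + m%:R * c) + y)))).
    by apply: ler_wpM2l (Hw _); rewrite mulr_ge0// ltW.
  have bt z : bounded_borel (fun y => tent w (z + y)).
    apply: bounded_borel_continuous; first exact: tent_continuous.
    by exists 1 => y; have /andP[? ?] := tent_range (z + y) w0; rewrite ger0_norm.
  rewrite -(avgZ hE)//; apply: avg_le => //; first exact: bounded_borelZ.
    exact: bb.
  move=> y; rewrite -mulrA; apply: le_trans (beta_ge (phi0 _)).
  rewrite ler_pM2l// le_min; apply/andP; split.
    by have := IH (x - c + y); congr (_ * tent w _ <= _); ring.
  apply: le_trans (sn_le m); rewrite ler_piMr//.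
  by have /andP[] := tent_range (x - c - (x0 + m%:R * c) + y) w0.
have := below n (x0 + n%:R * c); rewrite subrr /tent normr0 mul0r subr0.
rewrite max_r ?ler01// mulr1 /sn min_r//.
by rewrite -ler_pdivrMr//; exact: HN.
Qed.

(** Every far point is reached from a center in a fixed window, and on such a
    window the profile has a positive minimum. *)
Lemma eventually_ge_del (phi : R -> R) c P : 0 < c -> supersolution phi c ->
  (forall x, P <= x -> 0 < phi x) -> exists X, forall x, X <= x -> del <= phi x.
Proof.
move=> c0 sup pos; have [w w0 HT] := hair_trigger; have [cphi phi0 _] := sup.
have ab : P <= P + 2 * w + c by lra.
have cw : {within `[P, P + 2 * w + c], continuous phi} by exact: continuous_subspaceT.
have [z zab zmin] := EVT_min ab cw.
have z0 : 0 < phi z by apply: pos; move: zab; rewrite in_itv/= => /andP[].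
have [N HN] := HT _ z0.
exists (P + w + N%:R * c) => x xX.
have xP : 0 <= x - (P + w).
  by have : 0 <= N%:R * c by [apply: mulr_ge0; [exact: ler0n|exact: ltW]]; lra.
pose n := Num.truncn ((x - (P + w)) / c).
have /andP[n1 n2] := truncn_shift c0 xP; rewrite -/n in n1 n2.
have Nn : (N <= n)%N.
  rewrite -ltnS -(ltr_nat R) -natr1 -(ltr_pM2r c0) mulrDl mul1r; lra.
have := HN phi c (x - n%:R * c) sup _ n Nn; rewrite subrK; apply => t.
rewrite ler_norml => /andP[t1 t2]; apply: zmin; rewrite in_itv/=.
by apply/andP; split; lra.
Qed.

Let redistribute_zero (phi : R -> R) z : continuous phi -> (forall x, 0 <= phi x) -> A phi z <= 0 ->
  E \1_[set y | 0 < phi (z + y)] = 0.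
Proof.
move=> cphi phi0 Az.
have bnn y : 0 <= beta (phi (z + y)) by have /andP[] := beta_range (phi (z + y)).
have A0 : A phi z = 0.
  by apply/eqP; rewrite eq_le Az (avg_ge0 hE)//; exact: bb.
have := avg_null hE (bb z cphi) bnn A0.
rewrite (_ : [set y | 0 < beta (phi (z + y))] = [set y | 0 < phi (z + y)])//.
apply/seteqP; split => y /=; last exact: beta_gt0.
by rewrite !lt_def => /andP[+ _]; rewrite phi0 andbT; apply: contraNN => /eqP->; rewrite beta0.
Qed.

Let measurable_pos (phi : R -> R) z : continuous phi ->
  measurable ([set y | 0 < phi (z + y)] : mset).
Proof.
move=> cphi.
have c1 : continuous (fun y => phi (z + y)).
  move=> y; apply: (continuous_comp (f := fun y => z + y)); last exact: cphi.
  by apply: cvgD; [exact: cvg_cst|exact: cvg_id].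
have m1 : measurable_fun setT ((fun y => phi (z + y)) : measurableTypeR R -> R).
  exact: continuous_measurable_fun.
rewrite (_ : [set y | _] = (fun y => phi (z + y)) @^-1` `]0, +oo[%classic).
  by rewrite -[X in measurable X]setTI; apply: m1 => //; exact: measurable_itv.
by apply/seteqP; split => y /=; rewrite in_itv/= andbT.
Qed.

Let pos_ball (phi : R -> R) p : continuous phi -> 0 < phi p ->
  exists2 l : R, 0 < l & forall y, `|p - y| <= l -> 0 < phi y.
Proof.
move=> cphi p0; have p2 : 0 < phi p / 2 by lra.
have [l l0 Hl] := continuous_dist (cphi p) p2; exists l => // y /Hl.
by rewrite ler_norml => /andP[? ?]; lra.
Qed.

(** Two steps fill an interval. If phi > 0 near p, the set N where the first step
    may vanish is null for the average, so by avg_shift its small translates have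
    mass less than 1. But the vanishing at p + 2c + h would put the whole mass on the
    translate of N by h. *)
Lemma positivity_spreads : exists2 r : R, 0 < r & forall phi c p, supersolution phi c ->
  0 < phi p -> forall h, `|h| <= r -> 0 < phi (p + 2 * c + h).
Proof.
have e0 : 0 < 1 / 2 :> R by lra.
have [r r0 shift] := avg_shift hE e0.
exists r => // phi c p [cphi phi0 sup] p0 h hr.
have [l l0 pl] := pos_ball cphi p0.
pose N : mset := ~` [set x | 0 < phi (p + c + x)].
have mN : measurable N by apply: measurableC; exact: measurable_pos.
have Nnull : E \1_N = 0.
  apply: (locally_null hE mN l0) => x /negP; rewrite -leNgt => xN.
  have Ax : A phi (p + x) <= 0.
    by apply: le_trans xN; have := sup (p + c + x); congr (A phi _ <= _); ring.
  rewrite (mass_ball_opp hE); apply/eqP; rewrite eq_le.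
  have mb := measurable_normB_le (- x) l; rewrite opprK in mb.
  rewrite (mass_ge0 hE)// andbT -(redistribute_zero cphi phi0 Ax).
  apply: (mass_le hE) => //; first exact: measurable_pos.
  move=> y /= yx; apply: pl; rewrite (_ : _ - _ = - (y + x)); last by ring.
  by rewrite normrN.
have bN := bounded_borel_indic mN.
have := shift h hr _ bN _; rewrite Nnull subr0 => H.
have {}H : `|E (fun y => \1_N (y + h))| <= 1 / 2.
  by apply: H => x; rewrite indicE ger0_norm// lern1; case: (_ \in _).
rewrite ltNge; apply/negP => ph.
have Ah : A phi (p + c + h) <= 0.
  by apply: le_trans ph; have := sup (p + 2 * c + h); congr (A phi _ <= _); ring.
have mpos := measurable_pos (p + c + h) cphi.
have := redistribute_zero cphi phi0 Ah.
have -> : (\1_[set y | 0 < phi (p + c + h + y)] : R -> R) = (fun y => 1 + -1 * \1_N (y + h)).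
  apply/funext => y; rewrite !indicE /N in_setC.
  have -> : (y + h \in [set x | 0 < phi (p + c + x)]) = (y \in [set y | 0 < phi (p + c + h + y)]).
    by apply/idP/idP => /set_mem /= H1; apply/mem_set => /=; move: H1;
      rewrite (_ : p + c + (y + h) = p + c + h + y)//; ring.
  by case: (_ \in _) => /=; ring.
have bNh := bounded_borel_shift h bN.
rewrite (avgD hE (bounded_borel_cst 1) (bounded_borelZ _ bNh)) (avg1 hE) (avgZ hE)//.
by move: H; rewrite ler_norml => /andP[? ?]; lra.
Qed.

(** The positivity intervals about p + 2nc have length proportional to n, hence
    overlap as soon as n is large, for reasons independent of p. *)
Lemma positive_half_line c : 0 < c -> exists C : R, forall phi p, supersolution phi c ->
  0 < phi p -> forall x, p + C <= x -> 0 < phi x.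
Proof.
move=> c0; have [r r0 spread] := positivity_spreads.
pose k := (Num.bound (2 * c / r)).
have k0 : 2 * c < k%:R * r.
  by rewrite -ltr_pdivrMr//; apply: archi_boundP; rewrite divr_ge0 ?(ltW r0)//; lra.
exists (2 * c * k.+1%:R) => phi p sup p0 x xC.
(* each double step widens the interval by r on both sides *)
have cone n y : `|y - p - 2 * c * n%:R| <= n%:R * r -> 0 < phi y.
  elim: n y => [|n IH] y.
    by rewrite mulr0 subr0 mul0r normr_le0 subr_eq0 => /eqP->.
  set t := y - p - _ => tr; have n1 : 0 < n.+1%:R :> R by rewrite ltr0n.
  have := spread phi c (y - 2 * c - t / n.+1%:R) sup _ (t / n.+1%:R).
  have -> : y - 2 * c - t / n.+1%:R + 2 * c + t / n.+1%:R = y by ring.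
  apply.
    apply: IH.
    have -> : y - 2 * c - t / n.+1%:R - p - 2 * c * n%:R = n%:R * (t / n.+1%:R).
      rewrite /t -!natr1; field; by rewrite natr1 gt_eqF.
    rewrite normrM (ger0_norm (ler0n _ _)) ler_wpM2l ?ler0n//.
    by rewrite normrM [X in _ * X]ger0_norm ?invr_ge0 ?ler0n// ler_pdivrMr// mulrC.
  by rewrite normrM [X in _ * X]ger0_norm ?invr_ge0 ?ler0n// ler_pdivrMr// mulrC.
have c2 : 0 < 2 * c by lra.
have ck : 0 <= 2 * c * k.+1%:R by rewrite mulr_ge0 ?ler0n// ltW.
have xp : 0 <= x - p by lra.
pose n := Num.truncn ((x - p) / (2 * c)).
have /andP[n1 n2] := truncn_shift c2 xp; rewrite -/n in n1 n2.
have kn : (k <= n)%N.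
  rewrite -ltnS -(ltr_nat R) -[n.+1%:R]natr1 -(ltr_pM2r c2) mulrDl mul1r.
  by move: xC; rewrite -natr1; lra.
apply: (cone n); rewrite mulrC in n1 n2; rewrite ger0_norm//.
apply/ltW/(lt_trans n2)/(lt_le_trans k0); rewrite ler_pM2r// ler_nat//.
Qed.

Definition wave (phi : R -> R) (c : R) : Prop :=
  [/\ continuous phi, forall x, 0 <= phi x <= V & forall x, phi x = A phi (x - c)].

Lemma wave_supersolution phi c : wave phi c -> supersolution phi c.
Proof.
move=> [cphi phiV eqn]; split => // x; first by have /andP[] := phiV x.
by rewrite -eqn.
Qed.

(** Let b be the end of the maximal zero half-line. Points of positivity arbitrarily
    close to b force the average to ignore y > c. So phi just beyond b depends only
    on values up to the same point, with a weight that is small because there are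
    no atoms; its maximum there is at most half of itself. *)
Lemma wave_zero_left phi c a : wave phi c -> (forall x, x <= a -> phi x = 0) ->
  forall x, phi x = 0.
Proof.
move=> wv za p; have [cphi phi0 _] := wave_supersolution wv; have [_ phiV eqn] := wv.
apply/eqP; apply: contrapT => /negP phip.
pose S : set R := [set a | forall x, x <= a -> phi x = 0].
have Sa : S a by [].
have Sub : ubound S p.
  by move=> t St; rewrite leNgt; apply/negP => /ltW/St/eqP; rewrite (negbTE phip).
have supS : has_sup S by split; [exists a|exists p].
pose b := sup S.
have zltb x : x < b -> phi x = 0.
  move=> xb; have [t St xt] := sup_gt (ex_intro _ a Sa : S !=set0) xb.
  by apply: St; exact: ltW.
have zb x : x <= b -> phi x = 0.
  rewrite le_eqVlt => /orP[/eqP->|/zltb//].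
  apply/eqP; rewrite eq_le phi0 andbT leNgt; apply/negP => pb.
  have [l l0 Hl] := pos_ball cphi pb.
  have := Hl (b - l) _; rewrite zltb ?ltxx; last by rewrite ltrBlDr ltrDl.
  by move=> H; suff: false by []; apply: H; rewrite opprB addrC subrK gtr0_norm.
have posb s : 0 < s -> exists2 q, b < q <= b + s & 0 < phi q.
  move=> s0; apply: contrapT => no; have : S (b + s).
    move=> x xs; have [/zb//|bx] := leP x b.
    apply/eqP; rewrite eq_le phi0 andbT leNgt; apply/negP => px; apply: no.
    by exists x => //; rewrite bx.
  by move/(ub_le_sup (proj2 supS)); rewrite -/b; lra.
have mray z : measurable ([set y | z < y] : mset).
  rewrite (_ : [set y | _] = `]z, +oo[%classic); first exact: measurable_itv.
  by apply/seteqP; split => y /=; rewrite in_itv/= andbT.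
have mray' z : measurable ([set y | z <= y] : mset).
  rewrite (_ : [set y | _] = `[z, +oo[%classic); first exact: measurable_itv.
  by apply/seteqP; split => y /=; rewrite in_itv/= andbT.
(* points of positivity near b are seen from b through every y slightly above c *)
have ray_null : E \1_[set y | c < y] = 0.
  apply/eqP; rewrite eq_le (mass_ge0 hE)// andbT; apply/ler_addgt0Pr => e e0.
  rewrite add0r; have [d d0 Hd] := avg_small hE e0.
  have [q /andP[bq qd] pq] := posb d d0.
  have [l l0 Hl] := pos_ball cphi pq.
  have N0 : E \1_[set y | q - b + c <= y] = 0.
    apply: (locally_null hE _ l0) => // x /= xq.
    have Ax : A phi (q - x) <= 0.
      rewrite (_ : q - x = q + c - x - c); last by ring.
      by rewrite -eqn zb//; lra.
    apply/eqP; rewrite eq_le; have mb := measurable_normB_le x l.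
    rewrite (mass_ge0 hE)// andbT -(redistribute_zero cphi phi0 Ax).
    apply: (mass_le hE) => //; first exact: measurable_pos.
    move=> y /= yx; apply: Hl; rewrite (_ : _ - _ = - (y - x)); last by ring.
    by rewrite normrN.
  apply: le_trans (Hd c); rewrite -[leRHS]addr0 -N0.
  apply: (mass_cover hE) => //; first exact: measurable_normB_le.
  move=> y /= cy; have [H|H] := leP (q - b + c) y; [by right|left].
  by rewrite /= ler_norml; apply/andP; split; lra.
have eD : 0 < (2 * D)^-1 by rewrite invr_gt0 mulr_gt0.
have [s s0 Hs] := avg_small hE eD.
have bs : b <= b + s by lra.
have cw : {within `[b, b + s], continuous phi} by exact: continuous_subspaceT.
have [z zab zmax] := EVT_max bs cw.
have phiz0 := phi0 z.
have phiz : phi z <= 0.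
  have b1 := bounded_borel_indic (measurable_normB_le c s).
  have b2 := bounded_borel_indic (mray c).
  have : phi z <= E (fun y => D * phi z * \1_[set y | `|y - c| <= s] y + V * \1_[set y | c < y] y).
    rewrite {1}eqn; apply: avg_le => //; first exact: bb.
      by apply: bounded_borelD; exact: bounded_borelZ.
    move=> y; have /andP[be0 beV] := beta_range (phi (z - c + y)).
    move: zab; rewrite in_itv/= => /andP[z1 z2].
    have t1 : 0 <= D * phi z * \1_[set y | `|y - c| <= s] y.
      by rewrite mulr_ge0 ?indicE ?ler0n// mulr_ge0// ltW.
    have t2 : 0 <= V * \1_[set y | c < y] y.
      by rewrite mulr_ge0 ?indicE ?ler0n// ltW.
    have [yc|yc] := ltP c y.
      by rewrite [X in _ + V * X]indicE mem_set// mulr1; lra.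
    have [ys|ys] := ltP y (c - s).
      by rewrite (zb (z - c + y)) ?beta0; lra.
    rewrite [X in _ * X + _]indicE mem_set /=; last by rewrite ler_norml; apply/andP; split; lra.
    rewrite mulr1; apply: le_trans (beta_le (phi0 _)) _.
    suff : phi (z - c + y) <= phi z.
      by move=> H; have := ler_wpM2l (ltW D_gt0) H; lra.
    have [H|H] := leP (z - c + y) b; first by rewrite zb.
    by apply: zmax; rewrite in_itv/=; apply/andP; split; lra.
  rewrite (avgD hE (bounded_borelZ _ b1) (bounded_borelZ _ b2)) !(avgZ hE)// ray_null mulr0 addr0.
  have Dp : 0 <= D * phi z by rewrite mulr_ge0// ltW.
  have := ler_wpM2l Dp (Hs c).
  have -> : D * phi z * (2 * D)^-1 = phi z / 2 by field; rewrite gt_eqF.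
  lra.
have [q /andP[bq qs] pq] := posb s s0.
have := zmax q; rewrite in_itv/= (ltW bq) qs => /(_ isT); lra.
Qed.

Lemma wave_gt0 phi c p : 0 < c -> wave phi c -> 0 < phi p -> forall x, 0 < phi x.
Proof.
move=> c0 wv p0 x; have [C HC] := positive_half_line c0.
have sup := wave_supersolution wv; have [_ phi0 _] := sup.
have [q qx pq] : exists2 q, q <= x - C & 0 < phi q.
  apply: contrapT => no.
  have z0 : forall y, y <= x - C -> phi y = 0.
    move=> y yx; apply/eqP; rewrite eq_le phi0 andbT leNgt; apply/negP => py.
    by apply: no; exists y.
  by have := wave_zero_left wv z0 p => p00; rewrite p00 ltxx in p0.
by apply: (HC phi q sup pq); lra.
Qed.

Lemma wave_eventually_ge phi c p : 0 < c -> wave phi c -> 0 < phi p ->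
  exists X, forall x, X <= x -> del <= phi x.
Proof.
move=> c0 wv p0; have pos := wave_gt0 c0 wv p0.
by apply: (@eventually_ge_del phi c 0) => //; exact: wave_supersolution.
Qed.
End Waves.

(** * Existence of waves and their limit on the left *)

Lemma first_crossing (R : realType) (phi : R -> R) (d a X : R) : continuous phi ->
  (forall x, x <= a -> phi x <= d) -> d < phi X ->
  exists2 z, phi z = d & forall x, x <= z -> phi x <= d.
Proof.
move=> cphi phia phiX.
pose S : set R := [set t | forall x, x <= t -> phi x <= d].
have Sa : S a by [].
have SX : ubound S X.
  by move=> t St; rewrite leNgt; apply/negP => /ltW/St; rewrite leNgt phiX.
have supS : has_sup S by split; [exists a|exists X].
have below x : x < sup S -> phi x <= d.
  by move=> xz; have [t St xt] := sup_gt (ex_intro _ a Sa : S !=set0) xz; apply/St/ltW.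
have at_sup : phi (sup S) <= d.
  rewrite leNgt; apply/negP => dz.
  have e0 : 0 < (phi (sup S) - d) / 2 by lra.
  have [r r0 Hr] := continuous_dist (cphi (sup S)) e0.
  have := Hr (sup S - r); rewrite opprB addrC subrK gtr0_norm// => /(_ (lexx _)).
  have := below (sup S - r); rewrite ltrBlDr ltrDl => /(_ r0) H.
  by rewrite ler_norml => /andP[? ?]; lra.
have le_sup x : x <= sup S -> phi x <= d.
  by rewrite le_eqVlt => /orP[/eqP->|/below].
exists (sup S) => //; apply/eqP; rewrite eq_le at_sup leNgt; apply/negP => zd.
have e0 : 0 < d - phi (sup S) by lra.
have [r r0 Hr] := continuous_dist (cphi (sup S)) e0.
have : S (sup S + r).
  move=> x xr; have [/le_sup//|zx] := leP x (sup S).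
  have := Hr x; rewrite ler_norml => H; have : - r <= sup S - x <= r by apply/andP; split; lra.
  by move/H; rewrite ler_norml => /andP[? ?]; lra.
by move/(ub_le_sup (proj2 supS)); lra.
Qed.

Section WaveExistence.
Variables (R : realType) (E : (R -> R) -> R) (beta : R -> R) (V D gam del : R).
Hypothesis hE : averaging E.
Hypothesis V_gt0 : 0 < V.
Hypothesis beta_range : forall v, 0 <= beta v <= V.
Hypothesis beta_unif : forall e : R, 0 < e -> exists2 d : R, 0 < d &
  forall u v, `|u - v| <= d -> `|beta u - beta v| <= e.
Hypothesis D_gt0 : 0 < D.
Hypothesis beta_le : forall v : R, 0 <= v -> beta v <= D * v.
Hypothesis gam_gt1 : 1 < gam.
Hypothesis del_gt0 : 0 < del.
Hypothesis beta_ge : forall v : R, 0 <= v -> gam * Num.min v del <= beta v.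
Notation A := (redistribute E beta).
Notation wave := (wave E beta V).

(** The function exp (l x) is an upper solution of the equation linearized at 0
    with speed c. The bound M on the exponential moment is given by its action on
    bounded functions, since averages are only defined for these. *)
Definition exp_rate (c l : R) : Prop := 0 < l /\ exists M, D * M <= expR (c * l) /\
  forall (K : R) f, bounded_borel f -> (forall y, 0 <= f y <= K * expR (l * y)) -> E f <= K * M.

Let ramp (x : R) : R := Num.max 0 (Num.min 1 x).

Let ramp_range x : 0 <= ramp x <= 1.
Proof. by rewrite /ramp le_max lexx /= ge_max ler01 ge_min lexx. Qed.

Let ramp_lip x y : `|ramp x - ramp y| <= `|x - y|.
Proof.
apply: ler_dist_max; first by rewrite subrr normr0.
by apply: ler_dist_min => //; rewrite subrr normr0.
Qed.

(** The two bounds of W are preserved: the constant one because beta <= V, the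
    exponential one because beta v <= D v and l is an admissible rate. *)
Lemma forced_wave (c l th : R) : exp_rate c l -> 0 < th -> th <= V -> th <= 1 ->
  exists phi : R -> R, [/\ continuous phi, forall x, 0 <= phi x <= V,
    forall x, phi x <= V * expR (l * x) &
    forall x, phi x = Num.max (A phi (x - c)) (th * ramp x)].
Proof.
move=> [l0 [M [DM expE]]] th0 thV th1.
pose W x := Num.min V (V * expR (l * x)).
have W0 x : 0 <= W x by rewrite /W le_min (ltW V_gt0) mulr_ge0 ?(ltW V_gt0)// expR_ge0.
have cexp : continuous (fun x : R => V * expR (l * x)).
  move=> x; apply: cvgM; first exact: cvg_cst.
  apply: continuous_comp; last exact: continuous_expR.
  by apply: cvgM; [exact: cvg_cst|exact: cvg_id].
have cW : continuous W by apply: continuous_minr => //; exact: cst_continuous.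
have g_range x : 0 <= th * ramp x <= V.
  have /andP[r0 r1] := ramp_range x; rewrite mulr_ge0 ?(ltW th0)//=.
  by apply: le_trans thV; rewrite ler_piMr// ltW.
have g_unif (e : R) : 0 < e -> exists2 d : R, 0 < d &
    forall x y, `|x - y| <= d -> `|th * ramp x - th * ramp y| <= e.
  move=> e0; exists e => // x y xy; rewrite -mulrBr normrM (gtr0_norm th0).
  apply: le_trans xy; apply: le_trans (ramp_lip x y); by rewrite ler_piMl.
have super (phi : R -> R) : continuous phi -> (forall x, 0 <= phi x <= W x) ->
    forall x, Num.max (A phi (x - c)) (th * ramp x) <= W x.
  move=> cphi phiW x; rewrite ge_max; apply/andP; split; last first.
    have /andP[g0 gV] := g_range x.
    rewrite /W le_min gV /=; have [x0|x0] := leP x 0.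
      rewrite /ramp [Num.min _ _]min_r; last by lra.
      by rewrite max_l// mulr0 mulr_ge0 ?(ltW V_gt0)// expR_ge0.
    apply: le_trans gV _.
    by rewrite ler_peMr ?(ltW V_gt0)// -expR0 ler_expR mulr_ge0// ltW.
  have /andP[A0 AV] := redistribute_range hE beta_range beta_unif (x - c) cphi.
  rewrite /W le_min AV /=.
  apply: (@le_trans _ _ (D * V * expR (l * (x - c)) * M)).
    apply: expE; first exact: (bounded_borel_beta beta_range).
    move=> y; have /andP[-> _] := beta_range (phi (x - c + y)).
    have /andP[p0 pW] := phiW (x - c + y).
    apply: le_trans (beta_le p0) _.
    rewrite -!mulrA ler_pM2l// -expRD -mulrDr.
    by apply: le_trans pW _; rewrite /W ge_min lexx orbT.
  have -> : V * expR (l * x) = V * expR (l * (x - c)) * expR (c * l).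
    by rewrite -mulrA -expRD; congr (_ * expR _); ring.
  rewrite [leLHS](_ : _ = V * expR (l * (x - c)) * (D * M)); last by ring.
  by rewrite ler_wpM2l// mulr_ge0 ?(ltW V_gt0)// expR_ge0.
have [phi [cphi phiV phiW eqn]] := @schauder_between R E beta V hE V_gt0 beta_range beta_unif
    (fun x => th * ramp x) W c g_range g_unif W0 cW super.
exists phi; split => // x; apply: le_trans (phiW x) _; by rewrite /W ge_min lexx orbT.
Qed.

Lemma redistribute_shift (phi : R -> R) (a z : R) : A (fun x => phi (x + a)) z = A phi (z + a).
Proof. by rewrite /redistribute; congr (E _); apply/funext => y; rewrite addrAC. Qed.

(** The forced profiles of speed c + 1/(n+1) and strength at most 1/(n+1) are
    translated so that they first reach del / 2 at 0. The normalization survives in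
    the limit, which is therefore neither trivial nor large on the left. *)
Theorem wave_exists (c : R) : 0 < c -> (forall c', c < c' -> exists l, exp_rate c' l) ->
  exists phi, [/\ wave phi c, 0 < phi 0 & forall x : R, x <= 0 -> phi x <= del / 2].
Proof.
move=> c0 rates; have d2 : 0 < del / 2 by have := del_gt0; lra.
pose th n : R := Num.min V n.+1%:R^-1.
have inv0 n : 0 < n.+1%:R^-1 :> R by rewrite invr_gt0 ltr0n.
have inv1 n : n.+1%:R^-1 <= 1 :> R by rewrite invf_le1 ?ltr0n// ler1n.
have th0 n : 0 < th n by rewrite /th lt_min V_gt0 inv0.
have th_inv n : th n <= n.+1%:R^-1 by rewrite /th ge_min lexx orbT.
have thV n : th n <= V by rewrite /th ge_min lexx.
have th1 n : th n <= 1 by apply: le_trans (inv1 n).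
pose cs n : R := c + n.+1%:R^-1.
have H n : exists psi : R -> R, [/\ continuous psi, forall x, 0 <= psi x <= V,
    psi 0 = del / 2, forall x, x <= 0 -> psi x <= del / 2 &
    exists a, forall x, psi x = Num.max (A psi (x - cs n)) (th n * ramp (x + a))].
  have [|l rate] := rates (cs n); first by rewrite /cs ltrDl.
  have [phi [cphi phiV phiexp eqn]] := forced_wave rate (th0 n) (thV n) (th1 n).
  have csn : 0 < cs n by rewrite /cs addr_gt0.
  have sup : supersolution E beta phi (cs n).
    split => // x; first by have /andP[] := phiV x.
    by rewrite [leRHS]eqn le_max lexx.
  have pos x : 1 <= x -> 0 < phi x.
    move=> x1; rewrite eqn lt_max; apply/orP; right.
    by rewrite /ramp min_l// max_r ?ler01// mulr1.
  have [X HX] := eventually_ge_del hE beta_range beta_unif gam_gt1 del_gt0 beta_ge csn sup pos.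
  have dX : del / 2 < phi X by apply: lt_le_trans (HX X (lexx _)); have := del_gt0; lra.
  have [l0 _] := rate.
  have dV : 0 < del / 2 / V by rewrite divr_gt0.
  have left_small x : x <= ln (del / 2 / V) / l -> phi x <= del / 2.
    move=> xl; apply: le_trans (phiexp x) _; rewrite [leLHS]mulrC -ler_pdivlMr//.
    by rewrite -[leRHS]lnK ?posrE// ler_expR mulrC -ler_pdivlMr.
  have [z phiz zle] := first_crossing cphi left_small dX.
  exists (fun x => phi (x + z)); split.
  - move=> x; apply: (continuous_comp (f := fun y => y + z)); last exact: cphi.
    by apply: cvgD; [exact: cvg_id|exact: cvg_cst].
  - by move=> x.
  - by rewrite add0r.
  - by move=> x x0; apply: zle; lra.
  - exists z => x; rewrite eqn redistribute_shift; congr (Num.max (A phi _) _); ring.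
have [psi Hpsi] := choice H.
have cpsi n : continuous (psi n) by have [] := Hpsi n.
have psiV n x : 0 <= psi n x <= V by have [] := Hpsi n.
have equi : equicontinuous_seq psi.
  move=> e e0; have [d dd0 Hd] := redistribute_modulus hE V_gt0 beta_range beta_unif e0.
  exists (Num.min d e) => [|n x y]; first by rewrite lt_min dd0.
  rewrite le_min => /andP[xy xye]; have [_ _ _ _ [a eqn]] := Hpsi n.
  rewrite !eqn; apply: ler_dist_max.
    by apply: Hd => //; rewrite (_ : _ - _ = x - y)//; ring.
  rewrite -mulrBr normrM (gtr0_norm (th0 n)).
  apply: le_trans xye; apply: (@le_trans _ _ `|ramp (x + a) - ramp (y + a)|).
    by rewrite ler_piMl.
  by apply: le_trans (ramp_lip _ _) _; rewrite (_ : _ - _ = x - y)//; ring.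
have [phi clus] := arzela_ascoli_cluster psiV equi.
have cphi := cluster_continuous clus equi.
have Anonneg (f : R -> R) z : continuous f -> 0 <= A f z.
  by move=> cf; have /andP[] := redistribute_range hE beta_range beta_unif z cf.
have sol := @limit_solution R E beta V hE V_gt0 beta_range beta_unif (fun=> 0) c cs psi phi
  equi cpsi _ _ clus.
exists phi; split.
- split => // x.
    apply/andP; split.
      by apply: (cluster_ge (N := 0) clus) => n _; have /andP[] := psiV n x.
    by apply: (cluster_le (N := 0) clus) => n _; have /andP[] := psiV n x.
  rewrite {1}sol ?max_l//; first exact: Anonneg.
  + by move=> n; rewrite /cs addrAC subrr add0r ger0_norm// ltW.
  + move=> n y _; rewrite max_l ?Anonneg//; have [_ _ _ _ [a eqn]] := Hpsi n.
    rewrite [X in `|X - _|]eqn -[X in _ - X](max_l (Anonneg (psi n) (y - cs n) (cpsi n))).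
    apply: ler_dist_max; first by rewrite subrr normr0 ltW.
    have /andP[r0 r1] := ramp_range (y + a).
    rewrite subr0 ger0_norm ?mulr_ge0 ?(ltW (th0 n))//.
    by apply: le_trans (th_inv n); rewrite ler_piMr// ltW.
- apply: lt_le_trans d2 _; apply: (cluster_ge (N := 0) clus) => n _.
  by have [_ _ -> _ _] := Hpsi n.
- move=> x x0; apply: (cluster_le (N := 0) clus) => n _.
  by have [_ _ _ le0 _] := Hpsi n; exact: le0.
Qed.

(** Translating back points far on the left where phi > e yields a nontrivial wave
    that stays below del / 2, whereas waves eventually exceed del. *)
Theorem wave_vanishes_left phi (c : R) : 0 < c -> wave phi c ->
  (forall x : R, x <= 0 -> phi x <= del / 2) ->
  forall e : R, 0 < e -> exists X : R, forall x, x <= X -> phi x <= e.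
Proof.
move=> c0 [cphi phiV eqn] phi_left e e0; apply: contrapT => no.
have H n : exists a : R, a <= - n%:R /\ e < phi a.
  apply: contrapT => noa; apply: no; exists (- n%:R) => x xn; rewrite leNgt; apply/negP => ex.
  by apply: noa; exists x.
have [a Ha] := choice H.
pose psi n x := phi (x + a n).
have psiV n x : 0 <= psi n x <= V := phiV (x + a n).
have equi : equicontinuous_seq psi.
  move=> t t0; have [d d0 Hd] := redistribute_modulus hE V_gt0 beta_range beta_unif t0.
  exists d => // n x y xy; rewrite /psi !(eqn (_ + a n)); apply: Hd => //.
  by rewrite (_ : _ - _ = x - y)//; ring.
have cpsi n : continuous (psi n).
  by apply: dist_continuous => x t /equi[d d0 Hd]; exists d => // y; exact: Hd.
have [chi clus] := arzela_ascoli_cluster psiV equi.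
have cchi := cluster_continuous clus equi.
have Anonneg (f : R -> R) z : continuous f -> 0 <= A f z.
  by move=> cf; have /andP[] := redistribute_range hE beta_range beta_unif z cf.
have sol := @limit_solution R E beta V hE V_gt0 beta_range beta_unif (fun=> 0) c (fun=> c) psi chi
  equi cpsi _ _ clus.
have wchi : wave chi c.
  split => // x.
    apply/andP; split.
      by apply: (cluster_ge (N := 0) clus) => n _; have /andP[] := psiV n x.
    by apply: (cluster_le (N := 0) clus) => n _; have /andP[] := psiV n x.
  rewrite {1}sol ?max_l//; first exact: Anonneg.
  + by move=> n; rewrite subrr normr0 invr_ge0 ler0n.
  + move=> n y _; rewrite max_l ?Anonneg// redistribute_shift /psi eqn.
    by rewrite addrAC subrr normr0 invr_ge0 ler0n.
have chi0 : 0 < chi 0.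
  apply: lt_le_trans e0 _; apply: (cluster_ge (N := 0) clus) => n _.
  by rewrite /psi add0r; apply: ltW; have [] := Ha n.
have [X HX] := wave_eventually_ge hE V_gt0 beta_range beta_unif D_gt0 beta_le gam_gt1 del_gt0
  beta_ge c0 wchi chi0.
have chile : chi X <= del / 2.
  apply: (cluster_le (N := Num.bound `|X|) clus) => n Xn; apply: phi_left.
  have [an _] := Ha n.
  have : `|X| <= n%:R.
    by apply/ltW/(lt_le_trans (archi_boundP (normr_ge0 X))); rewrite ler_nat.
  by rewrite ler_norml => /andP[? ?]; lra.
have := HX X (lexx _); have := del_gt0; lra.
Qed.
End WaveExistence.

(** * The growth function and its envelopes *)

Lemma within_itv_dist (R : realType) (f : R -> R) (a b x : R) :
  {within `[a, b], continuous f} -> a <= x <= b ->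
  forall e : R, 0 < e -> exists2 d : R, 0 < d &
    forall y, a <= y <= b -> `|x - y| <= d -> `|f x - f y| <= e.
Proof.
move=> /subspace_continuousP cf xab e e0.
have xab' : `[a, b]%classic x by rewrite /= in_itv.
have := cf x xab'; move=> /cvgrPdist_le/(_ _ e0).
rewrite near_withinE => /nbhs_ballP[d /= d0 Hd].
exists (d / 2) => [|y yab xy]; first by rewrite divr_gt0.
apply: Hd; last by rewrite /= in_itv.
rewrite -ball_normE/=; apply: le_lt_trans xy _.
by rewrite ltr_pdivrMr// ltr_pMr// ltr1n.
Qed.

Lemma near_interior (R : realType) (v V u d : R) : v < V -> v <= u <= V -> 0 < d ->
  exists2 u', v < u' < V & `|u - u'| <= d.
Proof.
move=> vV /andP[vu uV] d0; pose t := Num.min d ((V - v) / 4).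
have t0 : 0 < t by rewrite lt_min d0 /=; lra.
have td : t <= d by rewrite /t ge_min lexx.
have tV : t <= (V - v) / 4 by rewrite /t ge_min lexx orbT.
have [H|H] := ltP u ((v + V) / 2).
  exists (u + t); first by apply/andP; split; lra.
  by rewrite opprD addrA subrr add0r normrN ger0_norm// ltW.
exists (u - t); first by apply/andP; split; lra.
by rewrite opprB addrC subrK ger0_norm// ltW.
Qed.

Section Growth.
Variables (R : realType) (b : R -> R) (vstar V D : R).
Hypothesis hb : growth_function b vstar V D.

Lemma growth_cap_gt0 : 0 < V.
Proof. exact: lt_le_trans (growth_vstar_gt0 hb) (growth_vstar_le hb). Qed.
Let V0 := growth_cap_gt0.

Let D1 : 1 < D. Proof. exact: growth_deriv0_gt1 hb. Qed.

Definition clamp (v : R) : R := Num.max 0 (Num.min V v).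
(** The profiles take their values in [0, V], where b is continuous; precomposing
    with the projection gives a function that is uniformly continuous on the line. *)
Definition capped (v : R) : R := b (clamp v).

Lemma clamp_range v : 0 <= clamp v <= V.
Proof. by rewrite /clamp le_max lexx /= ge_max (ltW V0) /= ge_min lexx. Qed.

Lemma clamp_id v : 0 <= v <= V -> clamp v = v.
Proof. by move=> /andP[v0 vV]; rewrite /clamp min_r// max_r. Qed.

Lemma capped_id v : 0 <= v <= V -> capped v = b v.
Proof. by move=> /clamp_id; rewrite /capped => ->. Qed.

Lemma clamp_lip u v : `|clamp u - clamp v| <= `|u - v|.
Proof.
apply: ler_dist_max; first by rewrite subrr normr0.
by apply: ler_dist_min => //; rewrite subrr normr0.
Qed.

Lemma capped_range v : 0 <= capped v <= V.
Proof. exact: growth_invariant hb _ (clamp_range v). Qed.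

Lemma capped_continuous : continuous capped.
Proof.
apply: dist_continuous => x e e0.
have [d d0 Hd] := within_itv_dist (growth_continuous_vbar hb) (clamp_range x) e0.
exists d => // y xy; apply: Hd; first exact: clamp_range.
exact: le_trans (clamp_lip x y) xy.
Qed.

Lemma capped_unif (e : R) : 0 < e -> exists2 d : R, 0 < d &
  forall u v, `|u - v| <= d -> `|capped u - capped v| <= e.
Proof.
move=> e0; have [d d0 Hd] := heine 0 V capped_continuous e0.
exists d => // u v uv.
have cc x : capped x = capped (clamp x) by rewrite /capped (clamp_id (clamp_range x)).
rewrite (cc u) (cc v); apply: Hd; first exact: clamp_range.
exact: le_trans (clamp_lip u v) uv.
Qed.

Lemma capped_le v : 0 <= v -> capped v <= D * v.
Proof.
have D0 : 0 < D by apply: lt_trans D1; exact: ltr01.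
rewrite le_eqVlt => /orP[/eqP<-|v0].
  by rewrite mulr0 capped_id ?lexx ?(ltW V0)// (growth_0 hb).
have [vV|vV] := leP v V.
  rewrite capped_id ?(ltW v0)//.
  by have /(growth_sublinear hb)/andP[_ /ltW] : 0 < v <= V by rewrite v0.
rewrite /capped /clamp min_l ?(ltW vV)// max_r ?(ltW V0)//.
have /(growth_sublinear hb)/andP[_ /ltW bV] : 0 < V <= V by rewrite V0 lexx.
by apply: le_trans bV _; rewrite ler_pM2l// ltW.
Qed.

(** Near 0 the quadratic bound leaves any slope below D, here (1 + D) / 2; away from
    0 the function has a positive minimum, which fixes how small del must be. *)
Lemma capped_ge : exists gam del : R, [/\ 1 < gam, 0 < del, del <= V &
  forall v : R, 0 <= v -> gam * Num.min v del <= capped v].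
Proof.
have := D1; have [L L0 quad] := growth_quadratic hb => D1'.
pose gam := (1 + D) / 2.
have gam1 : 1 < gam by rewrite /gam; lra.
have gam0 : 0 < gam by rewrite /gam; lra.
pose v0 := Num.min V ((D - gam) / L).
have Dg : 0 < D - gam by rewrite /gam; lra.
have v00 : 0 < v0 by rewrite lt_min V0 divr_gt0.
have v0V : v0 <= V by rewrite /v0 ge_min lexx.
have low v : 0 <= v <= v0 -> gam * v <= b v.
  move=> /andP[vge vle]; have /quad/andP[_] : 0 <= v <= V by rewrite vge (le_trans vle).
  have vL : L * v <= D - gam.
    rewrite mulrC -ler_pdivlMr//; apply: le_trans vle _.
    by rewrite /v0 ge_min lexx orbT.
  by have := ler_wpM2r vge vL; rewrite expr2; lra.
have cw : {within `[v0, V], continuous capped}.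
  exact/continuous_subspaceT/capped_continuous.
have [z zab zmin] := EVT_min v0V cw.
have z0 : 0 < capped z.
  move: zab; rewrite in_itv/= => /andP[z1 z2]; have zp := lt_le_trans v00 z1.
  rewrite capped_id ?z2 ?(ltW zp)//.
  by have /(growth_sublinear hb)/andP[] : 0 < z <= V by rewrite zp.
pose del := Num.min v0 (capped z / gam).
have del0 : 0 < del by rewrite lt_min v00 divr_gt0.
have delv0 : del <= v0 by rewrite /del ge_min lexx.
have delz : gam * del <= capped z.
  by rewrite mulrC -ler_pdivlMr// /del ge_min lexx orbT.
exists gam, del; split => //; first exact: le_trans v0V.
move=> v vge; have [vv0|vv0] := leP v v0.
  apply: (@le_trans _ _ (gam * v)); first by rewrite ler_pM2l// ge_min lexx.
  by rewrite capped_id ?vge ?(le_trans vv0)//; apply: low; rewrite vge.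
apply: (@le_trans _ _ (gam * del)); first by rewrite ler_pM2l// ge_min lexx orbT.
apply: le_trans delz _.
have -> : capped v = capped (clamp v) by rewrite /capped (clamp_id (clamp_range v)).
apply: zmin; rewrite in_itv/= /clamp; apply/andP; split.
  by rewrite le_max le_min v0V (ltW vv0) orbT.
by have /andP[] := clamp_range v.
Qed.

(** By continuity of b the ends of the open interval may be included. *)
Lemma lower_env_le (v u : R) : 0 <= v -> v <= u <= V -> lower_env b V v <= b u.
Proof.
move=> v0 /andP[vu uV]; rewrite /lower_env; case: eqVneq => [vV|vV].
  by have -> : u = V by apply/eqP; rewrite eq_le uV -vV.
have {}vV : v < V by rewrite lt_neqAle vV (le_trans vu).
apply/ler_addgt0Pr => e e0; have [d d0 Hd] := capped_unif e0.
have vuV : v <= u <= V by rewrite vu.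
have [u' /andP[vu' u'V] uu'] := near_interior vV vuV d0.
have bu' : inf [set b x | x in `]v, V[] <= b u'.
  apply: ge_inf; last by exists u' => //; rewrite /= in_itv/= vu'.
  exists 0 => _ [x + <-]; rewrite /= in_itv/= => /andP[vx _].
  by apply: growth_ge0 hb _ _; apply: le_trans v0 (ltW vx).
have := Hd _ _ uu'; rewrite !capped_id; first by rewrite ler_norml => /andP[? ?]; lra.
  by apply/andP; split; lra.
by apply/andP; split; lra.
Qed.

Lemma lower_env_ge (v a : R) : v <= V -> (forall u, v <= u <= V -> a <= b u) ->
  a <= lower_env b V v.
Proof.
move=> vV H; rewrite /lower_env; case: eqVneq => [_|vV'].
  by apply: H; rewrite vV lexx.
have {}vV : v < V by rewrite lt_neqAle vV'.
apply: lb_le_inf.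
  exists (b ((v + V) / 2)); exists ((v + V) / 2) => //=.
  by rewrite in_itv/=; apply/andP; split; lra.
move=> _ [x + <-]; rewrite /= in_itv/= => /andP[vx xV].
by apply: H; rewrite !ltW.
Qed.

Lemma upper_env_ge (v u : R) : v <= V -> 0 <= u <= v -> b u <= upper_env b v.
Proof.
move=> vV /andP[u0 uv]; rewrite /upper_env; case: eqVneq => [v0|v0].
  have -> : u = 0 by apply/eqP; rewrite eq_le u0 andbT -v0.
  by rewrite (growth_0 hb).
have {v0} v0 : 0 < v by rewrite lt_neqAle eq_sym v0 (le_trans u0).
apply/ler_addgt0Pr => e e0; have [d d0 Hd] := capped_unif e0.
have uv' : 0 <= u <= v by rewrite u0.
have [u' /andP[u'0 u'v] uu'] := near_interior v0 uv' d0.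
have bu' : b u' <= sup [set b x | x in `]0, v[].
  apply: ub_le_sup; last by exists u' => //; rewrite /= in_itv/= u'0.
  exists V => _ [x + <-]; rewrite /= in_itv/= => /andP[x0 xv].
  have /(growth_invariant hb)/andP[] // : 0 <= x <= V.
  by rewrite (ltW x0) (le_trans (ltW xv)).
have := Hd _ _ uu'; rewrite !capped_id; first by rewrite ler_norml => /andP[? ?]; lra.
  by apply/andP; split; lra.
by apply/andP; split; lra.
Qed.

Lemma upper_env_le (v a : R) : 0 <= v -> (forall u, 0 <= u <= v -> b u <= a) ->
  upper_env b v <= a.
Proof.
move=> v0 H; rewrite /upper_env; case: eqVneq => [_|v0'].
  by rewrite -(growth_0 hb); apply: H; rewrite lexx.
have {}v0 : 0 < v by rewrite lt_neqAle eq_sym v0'.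
apply: ge_sup.
  exists (b (v / 2)); exists (v / 2) => //=.
  by rewrite in_itv/=; apply/andP; split; lra.
move=> _ [x + <-]; rewrite /= in_itv/= => /andP[x0 xv].
by apply: H; rewrite !ltW.
Qed.

Let b_le_V u : 0 <= u <= V -> b u <= V.
Proof. by move=> /(growth_invariant hb)/andP[]. Qed.

(** The lower envelope is monotone, so the infimum of the points where it is at most
    the identity is a fixed point; it is positive since the envelope exceeds the
    identity below del. *)
Lemma lower_env_fixed : exists v1 : R, [/\ 0 < v1, v1 <= V, lower_env b V v1 = v1 &
  forall v : R, 0 < v < v1 -> v < lower_env b V v].
Proof.
have [gam [del [gam1 del0 delV capge]]] := capped_ge.
have gam0 : 0 < gam by lra.
have bge u : 0 <= u <= V -> gam * Num.min u del <= b u.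
  by move=> uV; rewrite -capped_id//; apply: capge; have /andP[] := uV.
have Lge v : 0 <= v <= V -> gam * Num.min v del <= lower_env b V v.
  move=> /andP[v0 vV]; apply: lower_env_ge => // u /andP[vu uV].
  apply: le_trans (bge u _); last by rewrite uV (le_trans v0).
  by rewrite ler_pM2l// le_min !ge_min vu lexx orbT.
have Lmono v v' : 0 <= v -> v <= v' -> v' <= V -> lower_env b V v <= lower_env b V v'.
  move=> v0 vv' v'V; apply: lower_env_ge => // u /andP[v'u uV].
  by apply: lower_env_le => //; rewrite uV (le_trans vv').
pose X : set R := [set v | 0 < v <= V /\ lower_env b V v <= v].
have XV : X V.
  split; first by rewrite V0 lexx.
  by rewrite /lower_env eqxx; apply: b_le_V; rewrite lexx ltW.
have Xdel v : X v -> del <= v.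
  move=> [/andP[v0 vV] Lv]; rewrite leNgt; apply/negP => vd.
  have := Lge v; rewrite (ltW v0) vV min_l ?(ltW vd)// => /(_ isT) H.
  have := ltr_pM2r v0 1 gam; rewrite gam1 mul1r => H2; lra.
have infX : has_inf X by split; [exists V|exists del].
pose v1 := inf X.
have v1del : del <= v1 by apply: lb_le_inf => //; exists V.
have v1X v : X v -> v1 <= v by move=> Xv; apply: ge_inf => //; exists del.
have v10 : 0 < v1 by lra.
have v1V : v1 <= V by exact: v1X.
have L1 : lower_env b V v1 <= v1.
  apply: lb_le_inf; first by exists V.
  move=> v Xv; have [/andP[v0 vV] Lv] := Xv; apply: le_trans Lv.
  by apply: Lmono => //; [exact: ltW|exact: v1X].
have L0 : 0 < lower_env b V v1.
  apply: lt_le_trans (Lge v1 _); last by rewrite ltW.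
  by rewrite mulr_gt0// lt_min v10.
exists v1; split => //.
  apply/eqP; rewrite eq_le L1; apply: v1X; split.
    by rewrite L0 (le_trans L1).
  by apply: Lmono => //; exact: ltW.
move=> v /andP[v0 vv1]; rewrite ltNge; apply/negP => Lv.
by have := v1X v; rewrite leNgt vv1 => H; suff : false by []; apply: H; split => //;
  rewrite v0 (le_trans (ltW vv1)).
Qed.

(** Dually, the supremum of the points where the upper envelope is at least the
    identity is a fixed point, by monotonicity. *)
Lemma upper_env_fixed v1 : 0 <= v1 <= V -> v1 <= upper_env b v1 ->
  exists v2 : R, [/\ v1 <= v2, v2 <= V, upper_env b v2 = v2 &
  forall v : R, v2 < v <= V -> upper_env b v < v].
Proof.
move=> /andP[v10 v1V] v1U.
have Umono v v' : 0 <= v -> v <= v' -> v' <= V -> upper_env b v <= upper_env b v'.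
  move=> v0 vv' v'V; apply: upper_env_le => // u /andP[u0 uv].
  by apply: upper_env_ge => //; rewrite u0 (le_trans uv).
pose X : set R := [set v | 0 <= v <= V /\ v <= upper_env b v].
have X1 : X v1 by split => //; rewrite v10.
have XV v : X v -> v <= V by move=> [/andP[]].
have ubX : has_ubound X by exists V.
pose v2 := sup X.
have Xv2 v : X v -> v <= v2 by move=> Xv; exact: ub_le_sup.
have v2V : v2 <= V by apply: ge_sup => //; exists v1.
have v12 : v1 <= v2 by exact: Xv2.
have v20 : 0 <= v2 by lra.
have U2 : v2 <= upper_env b v2.
  apply: ge_sup; first by exists v1.
  move=> v Xv; have [/andP[v0 vV] vU] := Xv; apply: le_trans vU _.
  by apply: Umono => //; exact: Xv2.
have UV : upper_env b v2 <= V.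
  by apply: upper_env_le => // u /andP[u0 uv]; apply: b_le_V; rewrite u0 (le_trans uv).
exists v2; split => //.
  apply/eqP; rewrite eq_le U2 andbT; apply: Xv2; split.
    by rewrite UV (le_trans v20).
  exact: Umono.
move=> v /andP[v2v vV]; rewrite ltNge; apply/negP => vU.
have : X v by split => //; rewrite vV andbT; lra.
by move/Xv2; rewrite leNgt v2v.
Qed.
End Growth.

(** * The profile far on the right *)

Section Asymptotics.
Variables (R : realType) (E : (R -> R) -> R) (b : R -> R) (vstar V D : R).
Hypothesis hE : averaging E.
Hypothesis hb : growth_function b vstar V D.
Notation beta := (capped b V).
Notation A := (redistribute E beta).

Let V0 := growth_cap_gt0 hb.
Let cap_range := capped_range hb.
Let cap_unif := capped_unif hb.

Lemma redistribute_tail_ge (phi : R -> R) (T a e : R) : continuous phi -> 0 < e -> a <= V ->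
  (forall y, T <= y -> a <= beta (phi y)) -> exists Z, forall z, Z <= z -> a - e <= A phi z.
Proof.
move=> cphi e0 aV low; have eV : 0 < e / V by rewrite divr_gt0.
have [r r0 tail] := avg_tail hE eV.
exists (T + r) => z zT.
have bT := bounded_borel_indic (measurable_norm_gt r).
have : E (fun y => a + (- V) * \1_[set y | r < `|y|] y) <= A phi z.
  apply: avg_le => //.
  - by apply: bounded_borelD; [exact: bounded_borel_cst|exact: bounded_borelZ].
  - exact: (bounded_borel_beta cap_range cap_unif _ cphi).
  - move=> y; rewrite indicE; have [yr|yr] := leP `|y| r.
      rewrite memNset/=; last by apply/negP; rewrite -leNgt.
      rewrite mulr0 addr0; apply: low; move: yr; rewrite ler_norml => /andP[? ?]; lra.
    rewrite mem_set// mulr1; have /andP[? ?] := cap_range (phi (z + y)); lra.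
rewrite (avgD hE (bounded_borel_cst a) (bounded_borelZ _ bT)) (avg_cst hE) (avgZ hE)//.
have := ler_wpM2l (ltW V0) tail; rewrite [V * (e / V)]mulrC divfK ?gt_eqF//.
lra.
Qed.

Lemma redistribute_tail_le (phi : R -> R) (T a e : R) : continuous phi -> 0 < e -> 0 <= a ->
  (forall y, T <= y -> beta (phi y) <= a) -> exists Z, forall z, Z <= z -> A phi z <= a + e.
Proof.
move=> cphi e0 a0 up; have eV : 0 < e / V by rewrite divr_gt0.
have [r r0 tail] := avg_tail hE eV.
exists (T + r) => z zT.
have bT := bounded_borel_indic (measurable_norm_gt r).
have : A phi z <= E (fun y => a + V * \1_[set y | r < `|y|] y).
  apply: avg_le => //.
  - exact: (bounded_borel_beta cap_range cap_unif _ cphi).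
  - by apply: bounded_borelD; [exact: bounded_borel_cst|exact: bounded_borelZ].
  - move=> y; rewrite indicE; have [yr|yr] := leP `|y| r.
      rewrite memNset/=; last by apply/negP; rewrite -leNgt.
      rewrite mulr0 addr0; apply: up; move: yr; rewrite ler_norml => /andP[? ?]; lra.
    rewrite mem_set// mulr1; have /andP[? ?] := cap_range (phi (z + y)); lra.
rewrite (avgD hE (bounded_borel_cst a) (bounded_borelZ _ bT)) (avg_cst hE) (avgZ hE)//.
have := ler_wpM2l (ltW V0) tail; rewrite [V * (e / V)]mulrC divfK ?gt_eqF//.
lra.
Qed.

Variables (phi : R -> R) (c : R).
Hypothesis hphi : wave E beta V phi c.

(** If the lower limit s were less than v1, then b >= lower_env s > s on [s, V]; by
    continuity the profile far right is mapped above a level strictly larger than s. *)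
Lemma wave_liminf (v1 del : R) : 0 < del -> del <= v1 -> v1 <= V ->
  (exists X, forall x, X <= x -> del <= phi x) ->
  (forall v, 0 < v < v1 -> v < lower_env b V v) ->
  forall e : R, 0 < e -> exists X, forall x, X <= x -> v1 - e <= phi x.
Proof.
move=> del0 delv1 v1V evdel Lgt e e0; have [cphi phiV eqn] := hphi.
pose X : set R := [set s | s <= V /\ exists T, forall x, T <= x -> s <= phi x].
have Xdel : X del by split => //; lra.
have supX : has_sup X by split; [exists del|exists V => s []].
pose s := sup X.
have dels : del <= s by apply: ub_le_sup => //; exact: (proj2 supX).
have [v1s|sv1] := leP v1 s.
  have ve : v1 - e < sup X by rewrite -/s; lra.
  have [t [_ [T HT]] vt] := sup_gt (proj1 supX) ve.
  by exists T => x /HT; lra.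
exfalso; have s0 : 0 < s by lra.
have /Lgt Ls : 0 < s < v1 by rewrite s0.
pose e' := (lower_env b V s - s) / 3.
have e'0 : 0 < e' by rewrite /e'; lra.
have [d d0 Hd] := cap_unif e'0.
have sd : s - d < sup X by rewrite -/s; lra.
have [t [tV [T HT]] st] := sup_gt (proj1 supX) sd.
have LV : lower_env b V s <= V.
  apply: (@le_trans _ _ (b V)).
    by apply: (lower_env_le hb); [exact: ltW|apply/andP; split; lra].
  by have /(growth_invariant hb)/andP[] : 0 <= V <= V by rewrite lexx (ltW V0).
have low y : T <= y -> lower_env b V s - e' <= beta (phi y).
  move=> /HT ty; pose u := Num.max (phi y) s.
  have /andP[p0 pV] := phiV y.
  have su : s <= u by rewrite /u le_max lexx orbT.
  have uV : u <= V by rewrite /u ge_max pV/=; lra.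
  have Lu : lower_env b V s <= b u.
    by apply: (lower_env_le hb); [exact: ltW|rewrite su].
  have pu : `|u - phi y| <= d.
    by rewrite /u; case: (leP (phi y) s) => H; rewrite ler_norml; apply/andP; split; lra.
  have bu : beta u = b u by apply: capped_id; rewrite uV andbT; lra.
  have := Hd _ _ pu; rewrite bu.
  by rewrite ler_norml => /andP[? ?]; lra.
have [|Z HZ] := redistribute_tail_ge cphi e'0 _ low; first by lra.
have : X (s + e').
  split; first by rewrite /e'; lra.
  exists (Z + c) => x xZ; rewrite eqn; apply: le_trans (HZ _ _); last by lra.
  by rewrite /e'; lra.
by move/(ub_le_sup (proj2 supX)); rewrite -/s; lra.
Qed.

Lemma wave_limsup (v2 : R) : 0 <= v2 ->
  (forall v, v2 < v <= V -> upper_env b v < v) ->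
  forall e : R, 0 < e -> exists X, forall x, X <= x -> phi x <= v2 + e.
Proof.
move=> v20 Ult e e0; have [cphi phiV eqn] := hphi.
pose X : set R := [set s | 0 <= s /\ exists T, forall x, T <= x -> phi x <= s].
have XV : X V.
  by split; [exact: ltW|exists 0 => x _; have /andP[] := phiV x].
have infX : has_inf X by split; [exists V|exists 0 => s []].
pose s := inf X.
have sV : s <= V by apply: ge_inf => //; exact: (proj2 infX).
have [sv2|v2s] := leP s v2.
  have ve : inf X < v2 + e by rewrite -/s; lra.
  have [t [_ [T HT]] vt] := inf_lt (proj1 infX) ve.
  by exists T => x /HT; lra.
exfalso; have s0 : 0 < s by lra.
have /Ult Us : v2 < s <= V by rewrite v2s.
have U0 : 0 <= upper_env b s.
  by rewrite -(growth_0 hb); apply: (upper_env_ge hb) => //; rewrite lexx ltW.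
pose e' := (s - upper_env b s) / 3.
have e'0 : 0 < e' by rewrite /e'; lra.
have [d d0 Hd] := cap_unif e'0.
have sd : inf X < s + d by rewrite -/s; lra.
have [t [t0 [T HT]] st] := inf_lt (proj1 infX) sd.
have up y : T <= y -> beta (phi y) <= upper_env b s + e'.
  move=> /HT ty; pose u := Num.min (phi y) s.
  have /andP[p0 pV] := phiV y.
  have us : u <= s by rewrite /u ge_min lexx orbT.
  have u0 : 0 <= u by rewrite /u le_min p0 ltW.
  have Uu : b u <= upper_env b s by apply: (upper_env_ge hb) => //; rewrite u0.
  have pu : `|u - phi y| <= d.
    by rewrite /u; case: (leP (phi y) s) => H; rewrite ler_norml; apply/andP; split; lra.
  have bu : beta u = b u by apply: capped_id; rewrite u0 /=; lra.
  have := Hd _ _ pu; rewrite bu.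
  by rewrite ler_norml => /andP[? ?]; lra.
have [|Z HZ] := redistribute_tail_le cphi e'0 _ up; first by lra.
have : X (s - e').
  split; first by rewrite /e'; lra.
  exists (Z + c) => x xZ; rewrite eqn; apply: le_trans (HZ _ _) _; first by lra.
  by rewrite /e'; lra.
by move/(ge_inf (proj2 infX)); rewrite -/s; lra.
Qed.
End Asymptotics.

Lemma near_pinfty_ge (R : realType) (X : R) : (+oo_R : set_system R) [set x | X <= x].
Proof. by exists X; split; [exact: num_real|move=> x /= /ltW]. Qed.

Lemma limf_einf_ge (R : realType) (f : R -> R) (v : R) :
  (forall e : R, 0 < e -> exists X, forall x, X <= x -> v - e <= f x) ->
  (v%:E <= limf_einf (EFin \o f) +oo_R)%E.
Proof.
move=> H; apply/lee_addgt0Pr => e e0; have [X HX] := H e e0.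
rewrite -leeBlDr// limf_einfE; apply: le_trans (ereal_sup_ubound _); last first.
  by exists [set x | X <= x]; [exact: near_pinfty_ge|reflexivity].
by apply: le_ereal_inf_tmp => _ [x /= Xx <-]; rewrite -EFinB lee_fin; exact: HX.
Qed.

Lemma limf_esup_le (R : realType) (f : R -> R) (v : R) :
  (forall e : R, 0 < e -> exists X, forall x, X <= x -> f x <= v + e) ->
  (limf_esup (EFin \o f) +oo_R <= v%:E)%E.
Proof.
move=> H; apply/lee_addgt0Pr => e e0; have [X HX] := H e e0.
rewrite limf_esupE; apply: le_trans (ereal_inf_lbound _) _.
  by exists [set x | X <= x]; [exact: near_pinfty_ge|reflexivity].
by apply: ge_ereal_sup => _ [x /= Xx <-]; rewrite -EFinD lee_fin; exact: HX.
Qed.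

Lemma limf_einf_le_esup (R : realType) (f : R -> \bar R) :
  (limf_einf f +oo_R <= limf_esup f +oo_R)%E.
Proof.
rewrite limf_einfE limf_esupE; apply: ge_ereal_sup => _ [B FB <-].
apply: le_ereal_inf_tmp => _ [C FC <-].
have [x [Bx Cx]] := filter_ex (filterI FB FC).
apply: (@le_trans _ _ (f x)); first by apply: ereal_inf_lbound; exists x.
by apply: ereal_sup_ubound; exists x.
Qed.

(** * The critical speed *)

Section CriticalSpeed.
Variables (R : realType) (k : R -> R) (E : (R -> R) -> R) (D : R).
Hypothesis hE : averaging E.
Hypothesis D_gt1 : 1 < D.
Notation M l := (\int[leb R]_y (expR (l * y) * k y)).
Hypothesis expE : forall (l K : R) f, 0 <= l -> bounded_borel f ->
  (forall y, 0 <= f y <= K * expR (l * y)) -> E f <= K * M l.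

Let expM (l : R) f : 0 <= l -> bounded_borel f ->
  (forall y, 0 <= f y <= expR (l * y)) -> E f <= M l.
Proof.
move=> l0 bf H; have := @expE l 1 f l0 bf; rewrite mul1r; apply => y.
by rewrite mul1r.
Qed.

Let M_ge1 (l : R) : 0 <= l -> 1 <= M l.
Proof.
(* f y + f (- y) >= 2, as exp t + exp (- t) >= 2 *)
move=> l0; pose f (y : R) := Num.min (expR (l * y)) 2.
have f0 y : 0 <= f y by rewrite /f le_min expR_ge0 ler0n.
have f2 y : f y <= 2 by rewrite /f ge_min lexx orbT.
have ce : continuous (fun x : R => expR (l * x)).
  move=> x; apply: continuous_comp; last exact: continuous_expR.
  by apply: cvgM; [exact: cvg_cst|exact: cvg_id].
have bf : bounded_borel f.
  apply: bounded_borel_continuous; last by exists 2 => y; rewrite ger0_norm.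
  by apply: continuous_minr => //; exact: cst_continuous.
apply: le_trans (expM l0 bf _); last by move=> y; rewrite f0 /f ge_min lexx.
have : E (fun=> 2) <= E (fun y => f y + f (- y)).
  apply: avg_le => //; first exact: bounded_borel_cst.
    by apply: bounded_borelD => //; exact: bounded_borelN.
  move=> y; have [H|H] := leP 2 (expR (l * y)).
    by have := f0 (- y); rewrite {2}/f min_r//; lra.
  have [H'|H'] := leP 2 (expR (l * - y)).
    by have := f0 y; rewrite [f (- y)]/f min_r//; lra.
  rewrite /f (min_l (ltW H)) (min_l (ltW H')).
  have ge1 z := @expR_ge1Dx R z.
  have H1 := ge1 (l * y); have H2 := ge1 (l * - y); rewrite mulrN in H2 *; lra.
rewrite (avgD hE bf (bounded_borelN bf)) (avg_even hE bf) (avg_cst hE); lra.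
Qed.

(** At least a quarter of the mass of k lies beyond some s > 0, by evenness and the
    absence of an atom at 0. *)
Let M_ge_exp : exists2 s : R, 0 < s & forall l, 0 <= l -> expR (l * s) / 4 <= M l.
Proof.
have h0 : 0 < 1 / 2 :> R by lra.
have [s s0 Hs] := avg_small hE h0.
pose B : set (measurableTypeR R) := [set y | s <= y].
have mB : measurable B.
  rewrite (_ : B = `[s, +oo[%classic); first exact: measurable_itv.
  by apply/seteqP; split => y /=; rewrite in_itv/= andbT.
have bB := bounded_borel_indic mB.
have p4 : 1 / 4 <= E \1_B.
  have bS := bounded_borel_indic (measurable_normB_le 0 s).
  have bBB := bounded_borelD bB (bounded_borelN bB).
  have : E (fun=> 1) <= E (fun y => \1_[set y | `|y - 0| <= s] y + (\1_B y + \1_B (- y))).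
    apply: avg_le => //; [exact: bounded_borel_cst|exact: bounded_borelD|move=> y].
    rewrite !indicE -!natrD ler1n; have [ys|ys] := leP `|y| s.
      by rewrite mem_set//= subr0.
    have [H|H] := leP 0 y.
      by rewrite ger0_norm// in ys; rewrite [y \in B]mem_set ?addn_gt0 ?orbT// /B/= ltW.
    rewrite ltr0_norm// in ys; rewrite [- y \in B]mem_set ?addn_gt0 ?orbT// /B/= ltW//.
  rewrite (avgD hE bS bBB) (avgD hE bB (bounded_borelN bB)) (avg_even hE bB) (avg1 hE).
  have := Hs 0; lra.
exists s => // l l0.
apply: (@le_trans _ _ (E (fun y => expR (l * s) * \1_B y))).
  rewrite (avgZ hE)// ler_wpM2l ?expR_ge0//; lra.
apply: (expM l0); first exact: bounded_borelZ.
move=> y; rewrite mulr_ge0 ?expR_ge0 ?indicE ?ler0n//=.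
have [/set_mem H|_] := boolP (y \in B); last by rewrite mulr0 expR_ge0.
by rewrite mulr1 ler_expR ler_wpM2l.
Qed.

Let speeds : set R := [set ln (D * M l) / l | l in `]0, +oo[].

(** M l >= 1 bounds the quotient from below for small l, and M_ge_exp for large l;
    a convex combination of the two bounds on ln (D * M l) is linear in l. *)
Let speeds_lbound : exists2 a : R, 0 < a & lbound speeds a.
Proof.
have D0 : 0 < D by apply: lt_trans D_gt1; exact: ltr01.
have [s s0 Hs] := M_ge_exp.
have p0 : 0 < ln D by exact: ln_gt0.
have q0 : 0 < ln 4 :> R by apply: ln_gt0; lra.
(* the weight that cancels the constant terms of the two bounds *)
pose t := ln D / (ln D + ln 4).
have pq : 0 < ln D + ln 4 by rewrite addr_gt0.
have t0 : 0 < t by rewrite divr_gt0.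
have t1 : t < 1 by rewrite ltr_pdivrMr// mul1r ltrDl.
exists (t * s) => [|_ [l + <-]]; first exact: mulr_gt0.
rewrite /= in_itv/= andbT => l0; rewrite ler_pdivlMr//.
have M1 := M_ge1 (ltW l0); have M0 : 0 < M l by apply: lt_le_trans M1; exact: ltr01.
have H1 : ln D <= ln (D * M l) by rewrite ler_ln ?posrE ?mulr_gt0// ler_peMr// ltW.
have H2 : l * s - ln 4 <= ln (D * M l).
  rewrite -[X in X - _]expRK -ln_div ?posrE ?expR_gt0//.
  rewrite ler_ln ?posrE ?divr_gt0 ?mulr_gt0 ?expR_gt0//.
  by apply: le_trans (Hs _ (ltW l0)) _; rewrite ler_peMl// ltW.
have t1' : 0 <= 1 - t by lra.
have tE : t * (ln D + ln 4) = ln D by rewrite divfK// gt_eqF.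
have := lerD (ler_wpM2l (ltW t0) H2) (ler_wpM2l t1' H1).
have -> : t * (l * s - ln 4) + (1 - t) * ln D = t * s * l + (ln D - t * (ln D + ln 4)) by ring.
rewrite tE; lra.
Qed.

Let speeds_has_inf : has_inf speeds.
Proof.
split; last by have [a _ Ha] := speeds_lbound; exists a.
by exists (ln (D * M 1) / 1), 1 => //=; rewrite in_itv/= ltr01.
Qed.

Lemma critical_speed_gt0 : 0 < critical_speed D k.
Proof.
have [a a0 Ha] := speeds_lbound; apply: lt_le_trans a0 _.
exact: lb_le_inf (proj1 speeds_has_inf) Ha.
Qed.

Lemma supercritical_rate (c : R) : critical_speed D k < c -> exists l, exp_rate E D c l.
Proof.
move=> cc; have [_ [l + <-] lc] := inf_lt (proj1 speeds_has_inf) cc.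
rewrite /= in_itv/= andbT => l0; exists l; split => //; exists (M l); split; last first.
  by move=> K f bf fK; apply: expE => //; exact: ltW.
have M0 : 0 < M l by apply: lt_le_trans (M_ge1 (ltW l0)); exact: ltr01.
have DM : 0 < D * M l by rewrite mulr_gt0//; apply: lt_trans D_gt1; exact: ltr01.
by rewrite -[leLHS]lnK ?posrE// ler_expR -ler_pdivrMr// ltW.
Qed.
End CriticalSpeed.

Theorem theorem5p3 (R : realType) (b : R -> R) (vstar vbar db0 : R)
    (hb : growth_function b vstar vbar db0) :
  exists v1 v2 : R,
    [/\ 0 < v1, v1 <= v2, v2 <= vbar, lower_env b vbar v1 = v1
      & upper_env b v2 = v2] /\
    forall k : R -> R, dispersal_kernel k ->
    forall c : R, critical_speed db0 k <= c ->
    exists phi : R -> R,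
      [/\ bounded_fun phi /\ unif_continuous phi,
          forall xi : R, 0 < phi xi,
          wave_equation b k c phi,
          phi xi @[xi --> -oo] --> 0
        & (v1%:E <= limf_einf (EFin \o phi) +oo_R /\
           limf_einf (EFin \o phi) +oo_R <= limf_esup (EFin \o phi) +oo_R /\
           limf_esup (EFin \o phi) +oo_R <= v2%:E)%E].
Proof.
have [v1 [v10 v1V L1 Lgt]] := lower_env_fixed hb.
have bv1 : v1 <= b v1 by rewrite -{1}L1 (lower_env_le hb) ?lexx// ltW.
have U1 : v1 <= upper_env b v1.
  by apply: le_trans bv1 _; apply: (upper_env_ge hb) => //; rewrite lexx ltW.
have [|v2 [v12 v2V U2 Ult]] := upper_env_fixed hb _ U1; first by rewrite v1V ltW.
exists v1, v2; split; first by split.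
move=> k hk c hc.
have [E [hE kE expE]] := kernel_averaging hk.
have D1 := growth_deriv0_gt1 hb.
have D0 : 0 < db0 by apply: lt_trans D1; exact: ltr01.
have V0 := growth_cap_gt0 hb.
have c0 : 0 < c by apply: lt_le_trans hc; exact: critical_speed_gt0 hE D1 expE.
have rates c' : c < c' -> exists l, exp_rate E db0 c' l.
  by move=> cc'; apply: (supercritical_rate hE D1 expE); exact: le_lt_trans cc'.
have [gam [del0 [gam1 del00 _ bge0]]] := capped_ge hb.
(* lowering the threshold to v1 keeps bge0 and lets wave_liminf start below v1 *)
pose del := Num.min del0 v1.
have del_gt0 : 0 < del by rewrite lt_min del00.
have delv1 : del <= v1 by rewrite /del ge_min lexx orbT.
have bge v : 0 <= v -> gam * Num.min v del <= capped b vbar v.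
  move=> vge; apply: le_trans (bge0 v vge); rewrite ler_pM2l; last by lra.
  by rewrite le_min !ge_min lexx /= lexx orbT.
have cap_range := capped_range hb; have cap_unif := capped_unif hb.
have [phi [wv phi0 phi_left]] := wave_exists hE V0 cap_range cap_unif D0 (capped_le hb) gam1 del_gt0 bge
  c0 rates.
have [cphi phiV eqn] := wv.
exists phi; split.
- split.
    by exists vbar; split; [exact: num_real|move=> x Vx y _ /=; have /andP[p0 pV] := phiV y;
      rewrite ger0_norm// (le_trans pV)// ltW].
  apply/unif_continuousP => e e0.
  have e2 : 0 < e / 2 by rewrite divr_gt0.
  have [d d0 Hd] := redistribute_modulus hE V0 cap_range cap_unif e2.
  exists d => // -[x y] /=; rewrite -!ball_normE/= => xy.
  apply: (@le_lt_trans _ _ (e / 2)); last by rewrite ltr_pdivrMr// ltr_pMr// ltr1n.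
  rewrite (eqn x) (eqn y); apply: Hd => //.
  by rewrite (_ : _ - _ = x - y); [exact: ltW|ring].
- exact: (wave_gt0 hE V0 cap_range cap_unif D0 (capped_le hb) gam1 del_gt0 bge c0 wv phi0).
- move=> xi; have bb := bounded_borel_beta cap_range cap_unif (xi - c) cphi.
  rewrite {1}eqn /redistribute -kE//; last by move=> y; have /andP[] := cap_range (phi (xi - c + y)).
  by apply: eq_Rintegral => y _; rewrite (capped_id b (phiV _)).
- apply/cvgrPdist_le => e e0.
  have [X HX] := wave_vanishes_left hE V0 cap_range cap_unif D0 (capped_le hb) gam1 del_gt0 bge c0 wv
    phi_left e0.
  exists X; split; first exact: num_real.
  by move=> x xX; rewrite sub0r normrN ger0_norm; [apply/HX/ltW|have /andP[] := phiV x].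
- split; last split; last 1 first.
  + apply: limf_esup_le; apply: (wave_limsup hE hb wv) => //.
    by apply: le_trans (ltW v10) v12.
  + apply: limf_einf_ge; apply: (wave_liminf hE hb wv del_gt0 delv1 v1V _ Lgt).
    exact: (wave_eventually_ge hE V0 cap_range cap_unif D0 (capped_le hb) gam1 del_gt0 bge c0 wv phi0).
  + exact: limf_einf_le_esup.
Qed.
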